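(* Assume $n_i/N\to\kappa_i\in(0,1]$, $i=1,\dots,a$, as $\min(n_1,\dots,n_a)\to\infty$, where $N=\sum_{i=1}^an_i$. For each $i=1,\dots,a$, given the data $\boldsymbol X=(\boldsymbol X_{ik})_{i,k}$, let $\boldsymbol Y_{i1}^\dagger,\dots,\boldsymbol Y_{in_i}^\dagger$ be (conditionally) i.i.d. $\mathcal N_{p_u}(\boldsymbol 0_{p_u},\widehat{\boldsymbol\Upsilon}_i)$ random vectors, independent across groups. Let $\overline{\boldsymbol Y}_i^\dagger=n_i^{-1}\sum_{k=1}^{n_i}\boldsymbol Y_{ik}^\dagger$, $\overline{\boldsymbol Y}^\dagger=(\overline{\boldsymbol Y}_1^{\dagger\top},\dots,\overline{\boldsymbol Y}_a^{\dagger\top})^\top$, let $\widehat{\boldsymbol\Upsilon}_i^\dagger$ be the sample covariance matrix of $\boldsymbol Y_{i1}^\dagger,\dots,\boldsymbol Y_{in_i}^\dagger$, and $\widehat{\boldsymbol\Upsilon}^\dagger:=\bigoplus_{i=1}^a\frac N{n_i}\widehat{\boldsymbol\Upsilon}_i^\dagger$. Then, given the data, the conditional distribution of (a) $\sqrt N\,\overline{\boldsymbol Y}_i^\dagger$, for $i=1,\dots,a$, converges weakly to $\mathcal N_{p_u}(\boldsymbol 0_{p_u},\kappa_i^{-1}\boldsymbol\Upsilon_i)$ in probability; (b) $\sqrt N\,\overline{\boldsymbol Y}^\dagger$ converges weakly to $\mathcal N_{ap_u}(\boldsymbol 0_{ap_u},\boldsymbol\Upsilon)$ in probability. Moreover,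 $\widehat{\boldsymbol\Upsilon}_i^\dagger\xrightarrow{\mathcal P}\boldsymbol\Upsilon_i$ for $i=1,\dots,a$ and $\widehat{\boldsymbol\Upsilon}^\dagger\xrightarrow{\mathcal P}\boldsymbol\Upsilon$.
   Context: Model: $d\ge2$, $a\ge1$; $\boldsymbol X_{ik}=\boldsymbol\mu_i+\boldsymbol\epsilon_{ik}$, $i=1,\dots,a$, $k=1,\dots,n_i$, are independent $d$-dimensional random vectors. Within each group $i$ the residuals $\boldsymbol\epsilon_{i1},\dots,\boldsymbol\epsilon_{in_i}$ are i.i.d. with $\mathbb E(\boldsymbol\epsilon_{i1})=\boldsymbol 0_d$ and $\mathbb E(\|\boldsymbol\epsilon_{i1}\|^4)<\infty$; across groups they are only independent (distributions may differ). $\operatorname{Cov}(\boldsymbol\epsilon_{i1})=\boldsymbol V_i=(V_{ijk})_{j,k\le d}$ has positive diagonal $V_{i11},\dots,V_{idd}>0$. $\boldsymbol R_i$ is the correlation matrix of group $i$. Vectorizations: $p=d(d+1)/2$, $p_u=d(d-1)/2$. For a $d\times d$ matrix $\boldsymbol A=(A_{jk})$, $\operatorname{vech}(\boldsymbol A)=(A_{11},A_{12},\dots,A_{1d},A_{22},\dots,A_{2d},\dots,A_{dd})^\top\in\mathbb R^p$ and $\operatorname{vech}^-(\boldsymbol A)=(A_{12},\dots,A_{1d},A_{23},\dots,A_{2d},\dots,A_{(d-1)d})^\top\in\mathbb R^{p_u}$. $\boldsymbol v_i=\operatorname{vech}(\boldsymbol V_i)$, $\boldsymbol r_i=\operatorname{vech}^-(\boldsymbol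 R_i)$, $\boldsymbol\Sigma_i=\operatorname{Cov}(\operatorname{vech}(\boldsymbol\epsilon_{i1}\boldsymbol\epsilon_{i1}^\top))$. Auxiliary matrices: $\boldsymbol e_{k,p}$ is the $k$-th standard basis vector of $\mathbb R^p$. $\boldsymbol a=(a_1,\dots,a_d)$ is the row vector with $a_k=1+\sum_{j=1}^{k-1}(d+1-j)$. $\boldsymbol b\in\mathbb R^{p_u}$ contains the numbers $1,\dots,p$ in ascending order without the elements of $\boldsymbol a$. $\boldsymbol H=\boldsymbol 1_d\boldsymbol a$ is the $d\times d$ matrix all of whose rows equal $\boldsymbol a$; $\boldsymbol h_1=\operatorname{vech}^-(\boldsymbol H)$, $\boldsymbol h_2=\operatorname{vech}^-(\boldsymbol H^\top)$, with $\ell$-th components $h_{1,\ell},h_{2,\ell}$. Then $\boldsymbol M_1=\sum_{\ell=1}^{p_u}\boldsymbol e_{\ell,p_u}(\boldsymbol e_{h_{1,\ell},p}+\boldsymbol e_{h_{2,\ell},p})^\top$, $\boldsymbol L_p^u=\sum_{\ell=1}^{p_u}\boldsymbol e_{\ell,p_u}\boldsymbol e_{b_\ell,p}^\top$, and $$\boldsymbol M(\boldsymbol v_i,\boldsymbol r_i)=\left[\boldsymbol L_p^u-\tfrac12\operatorname{diag}(\boldsymbol r_i)\boldsymbol M_1\right]\operatorname{diag}\Big(\operatorname{vech}\big((V_{i11},\dots,V_{idd})^\top(V_{i11},\dots,V_{idd})\big)\Big)^{-1/2},$$ $$\boldsymbol\Upsilon_i=\boldsymbol M(\boldsymbol v_i,\boldsymbol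 r_i)\boldsymbol\Sigma_i\boldsymbol M(\boldsymbol v_i,\boldsymbol r_i)^\top,\qquad \boldsymbol\Upsilon=\bigoplus_{i=1}^a\kappa_i^{-1}\boldsymbol\Upsilon_i,$$ where $\operatorname{diag}(\boldsymbol x)$ is the diagonal matrix with diagonal $\boldsymbol x$ and $\bigoplus$ is the direct sum (block diagonal matrix). Estimators: $\widehat{\boldsymbol V}_i=\frac1{n_i-1}\sum_{k=1}^{n_i}\widetilde{\boldsymbol X}_{ik}\widetilde{\boldsymbol X}_{ik}^\top$ with $\widetilde{\boldsymbol X}_{ik}=\boldsymbol X_{ik}-\overline{\boldsymbol X}_i$ is the empirical covariance matrix; $\widehat{\boldsymbol R}_i=\widehat{\boldsymbol V}_{i,0}^{-1/2}\widehat{\boldsymbol V}_i\widehat{\boldsymbol V}_{i,0}^{-1/2}$ the empirical correlation matrix, $\widehat{\boldsymbol V}_{i,0}$ being the diagonal matrix with the diagonal of $\widehat{\boldsymbol V}_i$ (defined arbitrarily on the asymptotically negligible event that a diagonal entry vanishes); $\widehat{\boldsymbol v}_i=\operatorname{vech}(\widehat{\boldsymbol V}_i)$, $\widehat{\boldsymbol r}_i=\operatorname{vech}^-(\widehat{\boldsymbol R}_i)$. $\boldsymbol M(\widehat{\boldsymbol v}_i,\widehat{\boldsymbol r}_i)$ is $\boldsymbol M$ with all quantities replaced by their estimators. $\widehat{\boldsymbol\Sigma}_i$ is a (positive semidefinite) consistent estimator of $\boldsymbol\Sigma_i$ computed from the data, for example $$\widehat{\boldsymbol\Sigma}_i=\frac1{n_i-1}\sum_{k=1}^{n_i}\Big[\operatorname{vech}\Big(\widetilde{\boldsymbol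 X}_{ik}\widetilde{\boldsymbol X}_{ik}^\top-\sum_{\ell=1}^{n_i}\tfrac{\widetilde{\boldsymbol X}_{i\ell}\widetilde{\boldsymbol X}_{i\ell}^\top}{n_i}\Big)\Big]\Big[\operatorname{vech}\Big(\widetilde{\boldsymbol X}_{ik}\widetilde{\boldsymbol X}_{ik}^\top-\sum_{\ell=1}^{n_i}\tfrac{\widetilde{\boldsymbol X}_{i\ell}\widetilde{\boldsymbol X}_{i\ell}^\top}{n_i}\Big)\Big]^\top,$$ and $\widehat{\boldsymbol\Upsilon}_i=\boldsymbol M(\widehat{\boldsymbol v}_i,\widehat{\boldsymbol r}_i)\widehat{\boldsymbol\Sigma}_i\boldsymbol M(\widehat{\boldsymbol v}_i,\widehat{\boldsymbol r}_i)^\top$. ''The conditional distribution converges weakly to $\mathcal L$ in probability'' means that the distance (in any metric metrizing weak convergence) between the conditional law given the data and $\mathcal L$ tends to $0$ in probability. $\xrightarrow{\mathcal P}$ denotes convergence in probability. *)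

(* Defs.v *)
From HB Require Import structures.
From mathcomp Require Import all_boot all_order all_algebra.
From mathcomp Require Import all_classical all_reals all_analysis.
From mathcomp Require Import measurable_realfun.

Set Implicit Arguments.
Unset Strict Implicit.
Unset Printing Implicit Defensive.

Import Order.TTheory GRing.Theory Num.Theory.
Import numFieldNormedType.Exports.

Local Open Scope classical_set_scope.
Local Open Scope ring_scope.

(* Matrices (in particular column vectors) carry the Borel sigma-algebra of
   their canonical topology. *)
HB.instance Definition _ (R : realType) (m n : nat) :=
  @isMeasurable.Build (sigma_display (@open 'M[R]_(m, n))) 'M[R]_(m, n)
    <<s @open 'M[R]_(m, n) >> (@sigma_algebra0 _ setT _)
    (@sigma_algebraC _ _) (@sigma_algebra_bigcup _ setT _).

Definition dimp (d : nat) : nat := (d * d.+1)./2.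
Definition dimpu (d : nat) : nat := (d * d.-1)./2.

Definition index_pairs (d : nat) : seq ('I_d * 'I_d) :=
  [seq (j, k) | j <- enum 'I_d, k <- enum 'I_d].

(* The lists of retained positions have lengths dimp d and dimpu d, so the
   default values of nth are never used. *)
Definition vech (T : nmodType) (d : nat) (A : 'M[T]_d) : 'cV[T]_(dimp d) :=
  \col_l nth 0
    [seq A jk.1 jk.2 | jk : 'I_d * 'I_d <- index_pairs d & (jk.1 <= jk.2)%N] l.

Definition vechm (T : nmodType) (d : nat) (A : 'M[T]_d) : 'cV[T]_(dimpu d) :=
  \col_l nth 0
    [seq A jk.1 jk.2 | jk : 'I_d * 'I_d <- index_pairs d & (jk.1 < jk.2)%N] l.

(* Positions in vectors are numbered from 1 in basisv, avec, bvec, and in the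
   entries of H, h1 and h2. *)
Definition basisv (R : realType) (k q : nat) : 'cV[R]_q :=
  \col_l (l.+1 == k)%:R.

Definition avec (d : nat) : 'rV[nat]_d :=
  \row_(k < d) (1 + \sum_(1 <= j < k.+1) (d.+1 - j))%N.

Definition bvec (d : nat) : 'cV[nat]_(dimpu d) :=
  \col_l nth 0%N
    [seq k <- iota 1 (dimp d) | k \notin [seq avec d 0 j | j : 'I_d]] l.

Definition Hmx (d : nat) : 'M[nat]_d := \matrix_(j, k) avec d 0 k.
Definition h1 (d : nat) : 'cV[nat]_(dimpu d) := vechm (Hmx d).
Definition h2 (d : nat) : 'cV[nat]_(dimpu d) := vechm (Hmx d)^T.

Definition M1mx (R : realType) (d : nat) : 'M[R]_(dimpu d, dimp d) :=
  \sum_(l < dimpu d) basisv R l.+1 (dimpu d) *m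
    (basisv R (h1 d l 0) (dimp d) + basisv R (h2 d l 0) (dimp d))^T.

Definition Lumx (R : realType) (d : nat) : 'M[R]_(dimpu d, dimp d) :=
  \sum_(l < dimpu d) basisv R l.+1 (dimpu d) *m
    (basisv R (bvec d l 0) (dimp d))^T.

(* diag(x)^(-1/2); a zero entry of x gives 0, which fixes the value of the
   empirical correlation matrix when an empirical variance vanishes. *)
Definition diag_rsqrt (R : realType) (q : nat) (x : 'cV[R]_q) : 'M[R]_q :=
  diag_mx (\row_l (Num.sqrt (x l 0))^-1).

Definition diag_col (R : realType) (d : nat) (V : 'M[R]_d) : 'cV[R]_d :=
  \col_j V j j.

(* M(v, r) depends on v = vech V only through the diagonal of V, so the matrix
   V itself is taken as argument. *)
Definition Mmx (R : realType) (d : nat) (V : 'M[R]_d) (r : 'cV[R]_(dimpu d)) :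
    'M[R]_(dimpu d, dimp d) :=
  (Lumx R d - 2^-1 *: (diag_mx r^T *m M1mx R d)) *m
  diag_rsqrt (vech (diag_col V *m (diag_col V)^T)).

Definition corrmx (R : realType) (d : nat) (V : 'M[R]_d) : 'M[R]_d :=
  diag_rsqrt (diag_col V) *m V *m diag_rsqrt (diag_col V).

(* Serves for Upsilon_i (population V and S) and for its estimator (empirical
   V and S). *)
Definition Upsilon (R : realType) (d : nat)
    (V : 'M[R]_d) (S : 'M[R]_(dimp d)) : 'M[R]_(dimpu d) :=
  let M := Mmx V (vechm (corrmx V)) in M *m S *m M^T.

Definition sample_mean (R : realType) (q n : nat) (x : nat -> 'cV[R]_q) :
    'cV[R]_q :=
  n%:R^-1 *: \sum_(k < n) x k.

Definition sample_cov (R : realType) (q n : nat) (x : nat -> 'cV[R]_q) :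
    'M[R]_q :=
  (n%:R - 1)^-1 *: \sum_(k < n)
    (x k - sample_mean n x) *m (x k - sample_mean n x)^T.

Definition enorm (R : realType) (q : nat) (x : 'cV[R]_q) : R :=
  Num.sqrt (\sum_j x j 0 ^+ 2).

Definition psdmx (R : realType) (q : nat) (S : 'M[R]_q) : Prop :=
  S^T = S /\ forall c : 'cV[R]_q, 0 <= (c^T *m S *m c) 0 0.

Section probability.
Context {dO : measure_display} {Omega : measurableType dO} {R : realType}.
Implicit Types P : probability Omega R.

Definition meanv P (q : nat) (Z : Omega -> 'cV[R]_q) : 'cV[R]_q :=
  \col_j fine 'E_P[fun w => Z w j 0].

Definition covmx P (q : nat) (Z : Omega -> 'cV[R]_q) : 'M[R]_q :=
  \matrix_(j, k) fine (covariance P (fun w => Z w j 0) (fun w => Z w k 0)).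

Definition mutually_independent P (I : choiceType) (dE : measure_display)
    (E : measurableType dE) (Z : I -> Omega -> E) : Prop :=
  forall (J : seq I) (A : I -> set E), uniq J ->
    (forall i, measurable (A i)) ->
    (P [set w | forall i, i \in J -> A i (Z i w)] =
     \prod_(i <- J) P (Z i @^-1` A i))%E.

(* Convergence in probability, with the outer measure mu_ext P induced by P;
   mu_ext P coincides with P on measurable sets. *)
Definition cvg_in_prob P (V : normedZmodType R) (Z : nat -> Omega -> V)
    (z : V) : Prop :=
  forall e : R, 0 < e ->
    mu_ext P [set w | e <= `|Z nu w - z|] @[nu --> \oo] --> 0%E.

Definition measurable_wrt (G : set_system Omega) (dE : measure_display)
    (E : measurableType dE) (f : Omega -> E) : Prop :=
  forall A, measurable A -> G (f @^-1` A).

Definition cond_law P (G : set_system Omega) (dE : measure_display)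
    (E : measurableType dE) (Z : Omega -> E)
    (K : Omega -> probability E R) : Prop :=
  (forall A, measurable A -> measurable_wrt G (fun w => K w A)) /\
  (forall A B, measurable A -> G B ->
    (P (B `&` Z @^-1` A) = \int[P]_(w in B) K w A)%E).

(* N_1(m, v), including the degenerate case v = 0, where it is the Dirac
   measure at m; the second parameter of normal_prob is the standard
   deviation and has to be nonzero. *)
Definition normal1 (m v : R) (A : set R) : \bar R :=
  if v == 0 then dirac m A else normal_prob m (Num.sqrt v) A.

(* L = N_q(m, S), with S possibly singular: every linear form c^T x is
   N_1(c^T m, c^T S c) distributed under L. *)
Definition is_mvnormal (q : nat) (m : 'cV[R]_q) (S : 'M[R]_q)
    (L : probability 'cV[R]_q R) : Prop :=
  psdmx S /\
  forall (c : 'cV[R]_q) (A : set R), measurable A ->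
    L [set x | A ((c^T *m x) 0 0)] =
    normal1 ((c^T *m m) 0 0) ((c^T *m S *m c) 0 0) A.

(* Given G, the vectors Y i k (i < a, k < n i) are independent, and Y i k is
   N_q(0, S i) distributed: by the last clause, the product of the laws Q i,
   each taken n i times, is a regular conditional distribution of the whole
   array. *)
Definition cond_indep_normal P (G : set_system Omega) (a q : nat)
    (n : 'I_a -> nat) (Y : 'I_a -> nat -> Omega -> 'cV[R]_q)
    (S : 'I_a -> Omega -> 'M[R]_q) : Prop :=
  exists Q : 'I_a -> Omega -> probability 'cV[R]_q R,
  [/\ forall i A, measurable A -> measurable_wrt G (fun w => Q i w A),
      forall i w, is_mvnormal 0 (S i w) (Q i w) &
      forall (A : 'I_a -> nat -> set 'cV[R]_q) (B : set Omega),
        (forall i k, measurable (A i k)) -> G B ->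
        (P (B `&` [set w | forall i k, (k < n i)%N -> A i k (Y i k w)]) =
         \int[P]_(w in B) \prod_(i < a) \prod_(k < n i) Q i w (A i k))%E].

Definition weak_cvg (q : nat) (mu_ : nat -> probability 'cV[R]_q R)
    (mu : probability 'cV[R]_q R) : Prop :=
  forall f : 'cV[R]_q -> R, continuous f ->
    (exists C, forall x, `|f x| <= C) ->
    (\int[mu_ k]_x (f x)%:E @[k --> \oo] --> \int[mu]_x (f x)%:E)%E.

(* dist is a metric on laws that metrizes weak convergence. Elements of
   probability 'cV[R]_q R represent the same law when they agree on
   measurable sets. *)
Definition weak_metric (q : nat)
    (dist : probability 'cV[R]_q R -> probability 'cV[R]_q R -> R) : Prop :=
  [/\ forall mu1 mu2, 0 <= dist mu1 mu2,
      forall mu1 mu2, dist mu1 mu2 = 0 <->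
        (forall A, measurable A -> mu1 A = mu2 A),
      forall mu1 mu2, dist mu1 mu2 = dist mu2 mu1,
      forall mu1 mu2 mu3, dist mu1 mu3 <= dist mu1 mu2 + dist mu2 mu3 &
      forall mu_ mu, weak_cvg mu_ mu <->
        (dist (mu_ k) mu @[k --> \oo] --> (0 : R))].

(* Conditional laws are only unique up to null sets, hence the quantification
   over all their versions; the first clause rules out that it is vacuous. *)
Definition cond_weak_cvg_in_prob P (G : nat -> set_system Omega) (q : nat)
    (Z : nat -> Omega -> 'cV[R]_q) (L : probability 'cV[R]_q R) : Prop :=
  (forall nu, exists K, cond_law P (G nu) (Z nu) K) /\
  forall K : nat -> Omega -> probability 'cV[R]_q R,
    (forall nu, cond_law P (G nu) (Z nu) (K nu)) ->
    forall dist, weak_metric dist ->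
      cvg_in_prob P (fun nu w => dist (K nu w) L) (0 : R).

Definition cond_cvg_normal P (G : nat -> set_system Omega) (q : nat)
    (Z : nat -> Omega -> 'cV[R]_q) (m : 'cV[R]_q) (S : 'M[R]_q) : Prop :=
  exists2 L, is_mvnormal m S L & cond_weak_cvg_in_prob P G Z L.

Definition data_sigma (a q : nat) (n : 'I_a -> nat)
    (X : 'I_a -> nat -> Omega -> 'cV[R]_q) : set_system Omega :=
  <<s [set B | exists i k A,
        [/\ (k < n i)%N, measurable A & B = X i k @^-1` A]] >>.

End probability.

(* Main.v *)
Require Import Defs.
From HB Require Import structures.
From mathcomp Require Import all_boot all_order all_algebra.
From mathcomp Require Import all_classical all_reals all_analysis.
From mathcomp Require Import measurable_realfun.
From mathcomp Require Import ring lra.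
Set Implicit Arguments.
Unset Strict Implicit.
Unset Printing Implicit Defensive.
Import Order.TTheory GRing.Theory Num.Theory.
Import numFieldNormedType.Exports.
Local Open Scope classical_set_scope.
Local Open Scope ring_scope.

(* Along nu, convergence in probability is ordinary convergence along a filter
   on nat * Omega, so the continuous mapping theorem is composition of limits:
   the empirical covariance matrices converge by a second-moment law of large
   numbers, hence so do the matrices Upsilon computed from them. Given the
   data, a linear combination of the array Y is exactly normal; for the scaled
   means its covariance matrix is (N / n_i) times the estimate of Upsilon_i, or
   the direct sum of these blocks. As N(0, T) tends weakly to N(0, S) when T
   tends to S, any metric for weak convergence is small between N(0, T) and
   N(0, S) once T is close to S, which yields (a) and (b). Weak convergence of
   the normal laws is obtained by approximating a bounded continuous function
   on a large box by trigonometric sums, whose integrals are explicit. The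
   sample covariance of Y is treated by the same law of large numbers,
   conditionally on the data and on the event that the conditional moments are
   close to their limits. *)

(** * Uniform approximation by trigonometric sums *)

(** Three obstacles shape the proof. The metric is arbitrary, so a set on which it is at least e
    need not be measurable, and conditional laws are determined only up to null sets: convergence is
    stated with the outer measure, one version that is normal at every point is constructed, and any
    other version is compared with it off a null set. Finally, Y may have no unconditional moments,
    since its covariance matrix is only a consistent estimate: moments are integrated over events of
    the data on which that matrix is near its limit. Conditional independence is given on
    rectangles, whence the Dynkin arguments that extend it to pairs and to sums. *)

Lemma cvg_bigsum (R : numFieldType) (V : normedModType R) (T : Type)
    (F : set_system T) {FF : Filter F} (I : Type) (r : seq I) (f : I -> T -> V)
    (l : I -> V) :
  (forall i, f i x @[x --> F] --> l i) ->
  \sum_(i <- r) f i x @[x --> F] --> \sum_(i <- r) l i.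
Proof.
move=> fl; elim: r => [|i r IH].
  rewrite big_nil; under eq_fun do rewrite big_nil; exact: cvg_cst.
by rewrite big_cons; under eq_fun do rewrite big_cons; apply: cvgD.
Qed.

(** The operation is abstract so as to serve for finite maxima and finite minima. The clause over
    all predicates Q expresses that h z is one of the values G i z; it transports equations at a
    point as well as strict inequalities. *)
Lemma lattice_finite (T R : Type) (I : eqType) (op : R -> R -> R) (le : R -> R -> Prop)
    (H : set (T -> R)) (G : I -> T -> R) (i0 : I) (s : seq I) :
  (forall x, le x x) -> (forall x y z, le x y -> le y z -> le x z) ->
  (forall x y, le x (op x y)) -> (forall x y, le y (op x y)) ->
  (forall x y (Q : set R), Q x -> Q y -> Q (op x y)) ->
  (forall g h, H g -> H h -> H (fun x => op (g x) (h x))) ->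
  (forall i, i \in i0 :: s -> H (G i)) ->
  exists2 h, H h &
    (forall i z, i \in i0 :: s -> le (G i z) (h z)) /\
    (forall z (Q : set R), (forall i, i \in i0 :: s -> Q (G i z)) -> Q (h z)).
Proof.
move=> le1 letr lel ler opQ Hop.
elim: s => [|j s IH] HG.
  exists (G i0); first by apply: HG; rewrite mem_head.
  split=> [i z|z Q]; first by rewrite inE => /eqP ->.
  by apply; rewrite mem_head.
have sub i : i \in i0 :: s -> i \in i0 :: j :: s.
  by rewrite !inE => /orP[->//|->]; rewrite !orbT.
have [i /sub|h Hh [hle hQ]] := IH; first exact: HG.
exists (fun x => op (G j x) (h x)).
  by apply: Hop => //; apply: HG; rewrite !inE eqxx orbT.
split=> [i z|z Q QG].
  rewrite !inE => /or3P[/eqP ->|/eqP ->|si].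
  - by apply: letr (ler _ _); apply: hle; rewrite mem_head.
  - exact: lel.
  - by apply: letr (ler _ _); apply: hle; rewrite inE si orbT.
apply: opQ; first by apply: QG; rewrite !inE eqxx orbT.
by apply: hQ => i /sub; exact: QG.
Qed.

(** Kakutani's argument. With x fixed, a finite maximum of interpolating functions exceeds f - e on
    A and still equals f at x; by this equality each such maximum is below f + e near its x, and a
    finite minimum of them is below f + e on all of A. *)
Lemma stone_weierstrass_lattice (R : realType) (T : ptopologicalType)
    (A : set T) (H : set (T -> R)) (f : T -> R) (e : R) :
  compact A -> A !=set0 -> continuous f -> (forall g, H g -> continuous g) ->
  (forall g h, H g -> H h -> H (fun x => Num.max (g x) (h x))) ->
  (forall g h, H g -> H h -> H (fun x => Num.min (g x) (h x))) ->
  (forall x y, exists2 g, H g & g x = f x /\ g y = f y) ->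
  0 < e -> exists2 g, H g & forall x, A x -> `|g x - f x| < e.
Proof.
move=> cA [x0 Ax0] cf cH Hmax Hmin Hsep e0.
have opn (g : T -> R) (u : R) : continuous g -> open [set z | u < g z].
  move=> cg; rewrite (_ : [set _ | _] = g @^-1` [set t | u < t]) //.
  by apply: open_comp => [? _|]; [exact: cg|exact: open_gt].
move: cA; rewrite compact_cover => cA.
have Hsep' (p : T * T) : exists g, H g /\ g p.1 = f p.1 /\ g p.2 = f p.2.
  by have [g] := Hsep p.1 p.2; exists g.
have [G HG] := choice Hsep'.
have step1 x : exists h, H h /\ h x = f x /\ forall z, A z -> f z - e < h z.
  pose U y := [set z | - e < G (x, y) z - f z].
  have [|y Ay|D DA cov] := cA T A U.
  - move=> y _; apply: (opn (fun z => G (x, y) z - f z)) => z.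
    by apply: continuousB; [exact: cH _ (HG (x, y)).1 _|exact: cf].
  - exists y => //; rewrite /U /= /U /=.
    by have [_ [_ /= ->]] := HG (x, y); rewrite subrr oppr_lt0.
  have := @lattice_finite T R T Num.max <=%R H (fun y => G (x, y)) x0
    (finmap.enum_fset D).
  case => //.
  - by move=> ? ? ? /le_trans; apply.
  - by move=> ? ?; rewrite le_max lexx.
  - by move=> ? ?; rewrite le_max lexx orbT.
  - by move=> u v Q Qu Qv; case: (leP u v).
  - by move=> i _; exact: (HG (x, i)).1.
  move=> h Hh [hle hQ]; exists h; split=> //; split.
    by have := hQ x [set t | t = f x]; apply=> i _; have [_ []] := HG (x, i).
  move=> z Az; have [i /= Di Uz] := cov _ Az.
  rewrite -subr_gt0; have := hle i z; rewrite inE Di orbT => /(_ isT) hz.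
  move: Uz; rewrite /U /= => Uz; lra.
have [h hH] := choice step1.
pose V x := [set z | - e < f z - h x z].
have [|y Ay|D DA cov] := cA T A V.
- move=> y _; apply: (opn (fun z => f z - h y z)) => z.
  by apply: continuousB; [exact: cf|exact: cH _ (hH y).1 _].
- exists y => //; rewrite /V /=.
  by have [_ [-> _]] := hH y; rewrite subrr oppr_lt0.
have := @lattice_finite T R T Num.min (fun x y => y <= x) H h x0
  (finmap.enum_fset D).
case => //.
- by move=> x y z xy yz; exact: le_trans yz xy.
- by move=> ? ?; rewrite ge_min lexx.
- by move=> ? ?; rewrite ge_min lexx orbT.
- by move=> u v Q Qu Qv; case: (leP u v).
- by move=> i _; exact: (hH i).1.
move=> g Hg [gle gQ]; exists g => // z Az.
rewrite ltr_norml; apply/andP; split.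
  have : f z - e < g z by have := gQ z [set t | f z - e < t]; apply=> i _; have [_ [_]] := hH i; exact.
  lra.
have [i /= Di Vz] := cov _ Az.
have := gle i z; rewrite inE Di orbT => /(_ isT) hz.
move: Vz; rewrite /V /=; lra.
Qed.

(** * Polynomial approximation of the absolute value *)

Section abs_poly.
Variable R : realType.

(* Newton-like scheme for [sqrt (y ^+ 2)] whose iterates are polynomials in y. *)
Fixpoint abs_iter (n : nat) (y : R) : R :=
  if n is m.+1 then abs_iter m y + (y ^+ 2 - abs_iter m y ^+ 2) / 2 else 0.

(** The iterates depend on y through its square, so y may be taken nonnegative. The error is then
    multiplied at each step by 1 - (y + r) / 2, which is nonnegative and at most 1 - y / 2. *)
Lemma abs_iter_bound (n : nat) (y : R) : `|y| <= 1 ->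
  0 <= abs_iter n y <= `|y| /\ `|y| - abs_iter n y <= `|y| * (1 - `|y| / 2) ^+ n.
Proof.
have -> : (abs_iter n y = abs_iter n `|y|).
  by elim: n => //= n ->; rewrite real_normK ?num_real.
have := normr_ge0 y; move: `|y| => {}y y0 y1.
elim: n => [|n [/andP[r0 ry] IH]] /=; first by rewrite lexx y0 subr0 expr0 mulr1.
set r := abs_iter n y in r0 ry IH *; split.
  apply/andP; split; nra.
have -> : y - (r + (y ^+ 2 - r ^+ 2) / 2) = (y - r) * (1 - (y + r) / 2) by field.
rewrite exprSr mulrA; apply: (@le_trans _ _ ((y - r) * (1 - y / 2))).
  by apply: ler_wpM2l; lra.
by apply: ler_wpM2r => //; lra.
Qed.

(** For s = |y| / 2 this bounds the error |y| (1 - |y| / 2)^n by 2 / n uniformly in y, also near y =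
    0, where the contraction factor tends to 1. *)
Lemma bernoulli_geometric (n : nat) (s : R) : 0 <= s <= 1 ->
  (1 - s) ^+ n * (1 + n%:R * s) <= 1.
Proof.
move=> /andP[s0 s1]; elim: n => [|n IH]; first by rewrite expr0 mul1r mul0r addr0.
have p0 : 0 <= (1 - s) ^+ n by rewrite exprn_ge0 // subr_ge0.
have n0 : 0 <= n%:R :> R by [].
apply: le_trans IH; rewrite exprSr -mulrA; apply: ler_wpM2l => //.
rewrite -natr1; nra.
Qed.

Lemma abs_iter_cvg (n : nat) (y : R) : `|y| <= 1 ->
  `| `|y| - abs_iter n.+1 y| <= 2 / n.+1%:R.
Proof.
move=> y1; have [/andP[r0 ry] b] := abs_iter_bound n.+1 y1.
rewrite ger0_norm ?subr_ge0 //; apply: le_trans b _.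
have s01 : 0 <= `|y| / 2 <= 1 by apply/andP; split; have := normr_ge0 y; lra.
have := bernoulli_geometric n.+1 s01; set g := (1 - _) ^+ _ => B.
have g0 : 0 <= g by rewrite exprn_ge0 //; case/andP: s01; lra.
rewrite ler_pdivlMr ?ltr0n //; move: B; have := normr_ge0 y.
set N := n.+1%:R; nra.
Qed.

End abs_poly.

(** * The uniform closure of the trigonometric sums *)

Section trigonometric_closure.
Variables (R : realType) (q : nat).

(** The phase t provides the sines, and c = 0 the constants. Products stay in the class by the
    product-to-sum formula for cosines. *)
Inductive trig : ('cV[R]_q -> R) -> Prop :=
| trig_cos (c : 'cV[R]_q) (t : R) : trig (fun x => cos ((c^T *m x) 0 0 + t))
| trig_lin (a b : R) (p r : 'cV[R]_q -> R) :
    trig p -> trig r -> trig (fun x => a * p x + b * r x).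

Lemma trig_ext p r : p =1 r -> trig p -> trig r.
Proof. by move=> /funext ->. Qed.

Lemma trig_cst (k : R) : trig (fun=> k).
Proof.
apply: (trig_ext _ (trig_lin k 0 (trig_cos 0 0) (trig_cos 0 0))) => x.
by rewrite mul0r addr0 trmx0 mul0mx mxE addr0 cos0 mulr1.
Qed.

Lemma trig_mul p r : trig p -> trig r -> trig (fun x => p x * r x).
Proof.
move=> tp; elim: tp r => {p} [c t r tr|a b p1 p2 t1 IH1 t2 IH2 r tr]; last first.
  apply: (trig_ext _ (trig_lin a b (IH1 _ tr) (IH2 _ tr))) => x; ring.
elim: tr => {r} [c' t'|a b r1 r2 _ IH1 _ IH2]; last first.
  apply: (trig_ext _ (trig_lin a b IH1 IH2)) => x; ring.
apply: (trig_ext _ (trig_lin 2^-1 2^-1 (trig_cos (c + c') (t + t'))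
  (trig_cos (c - c') (t - t')))) => x.
rewrite linearD linearB /= mulmxDl mulmxBl !mxE.
set u := \sum_(j < q) c^T 0 j * x j 0; set v := \sum_(j < q) c'^T 0 j * x j 0.
have -> : u + v + (t + t') = (u + t) + (v + t') by ring.
have -> : u - v + (t - t') = (u + t) - (v + t') by ring.
rewrite cosD cosB; by field.
Qed.

Lemma trig_bounded p : trig p -> exists2 M, 1 <= M & forall x, `|p x| <= M.
Proof.
elim => {p} [c t|a b p r _ [M M1 HM] _ [N N1 HN]].
  exists 1 => // x.
  by rewrite ler_norml; apply/andP; split; [exact: cos_geN1|exact: cos_le1].
exists (1 + (`|a| * M + `|b| * N)) => [|x].
  by rewrite lerDl addr_ge0 // mulr_ge0 //; exact: le_trans ler01 _.
apply: le_trans (ler_normD _ _) _; rewrite !normrM ler_wpDl //.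
by apply: lerD; apply: ler_wpM2l.
Qed.

Lemma linform_continuous (c : 'cV[R]_q) : continuous (fun x : 'cV[R]_q => (c^T *m x) 0 0).
Proof.
move=> x; rewrite /continuous_at mxE; under eq_fun do rewrite mxE.
apply: (@cvg_bigsum R R _ (nbhs x)) => j; apply: cvgM; first exact: cvg_cst.
exact: coord_continuous.
Qed.

Lemma trig_continuous p : trig p -> continuous p.
Proof.
elim => {p} [c t x|a b p r _ cp _ cr x].
  apply: (@continuous_comp _ _ _ (fun x : 'cV[R]_q => (c^T *m x) 0 0 + t) cos).
    exact: (cvgD (@linform_continuous c x) (cvg_cst t)).
  exact: continuous_cos.
exact: (cvgD (cvgM (cvg_cst a) (cp x)) (cvgM (cvg_cst b) (cr x))).
Qed.

Lemma trig_abs_iter (k : nat) p : trig p -> trig (fun x => abs_iter k (p x)).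
Proof.
move=> tp; elim: k => [|k IH] /=; first exact: trig_cst.
apply: (trig_ext _ (trig_lin 1 2^-1 IH
  (trig_lin 1 (-1) (trig_mul tp tp) (trig_mul IH IH)))) => x; by field.
Qed.

(** The approximation is uniform on the whole space and not only on a box: the laws are not
    compactly supported, and the approximants have to inherit a global bound. *)
Definition trig_closure (g : 'cV[R]_q -> R) : Prop :=
  continuous g /\ forall e, 0 < e -> exists2 p, trig p & forall x, `|g x - p x| <= e.

Lemma trig_closure_trig p : trig p -> trig_closure p.
Proof.
by move=> tp; split=> [|e /ltW e0]; [exact: trig_continuous|exists p => // x; rewrite subrr normr0].
Qed.

Lemma trig_closure_lin (a b : R) g h : trig_closure g -> trig_closure h ->
  trig_closure (fun x => a * g x + b * h x).
Proof.
move=> [cg Hg] [ch Hh]; split.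
  by move=> x; exact: (cvgD (cvgM (cvg_cst a) (cg x)) (cvgM (cvg_cst b) (ch x))).
move=> e e0; set D := 1 + `|a| + `|b|.
have D0 : 0 < D by rewrite /D -addrA ltr_pwDl // addr_ge0.
have ed : 0 < e / D by rewrite divr_gt0.
have [p tp Hp] := Hg _ ed; have [r tr Hr] := Hh _ ed.
exists (fun x => a * p x + b * r x); first exact: trig_lin.
move=> x; have -> : a * g x + b * h x - (a * p x + b * r x) =
  a * (g x - p x) + b * (h x - r x) by ring.
apply: le_trans (ler_normD _ _) _; rewrite !normrM.
have -> : e = D * (e / D) by rewrite mulrCA divff ?mulr1 // gt_eqF.
apply: (@le_trans _ _ (`|a| * (e / D) + `|b| * (e / D))).
  by apply: lerD; apply: ler_wpM2l.
by rewrite -mulrDl; apply: ler_wpM2r; [exact: ltW|rewrite /D; lra].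
Qed.

Lemma trig_closure_abs g : trig_closure g -> trig_closure (fun x => `|g x|).
Proof.
move=> [cg Hg]; split.
  by move=> x; apply: (@continuous_comp _ _ _ g Num.norm); [exact: cg|exact: norm_continuous].
move=> e e0; have e2 : 0 < e / 2 by lra.
have [p tp Hp] := Hg _ e2; have [M M1 HM] := trig_bounded tp.
have M0 : 0 < M by exact: lt_le_trans M1.
(* This k makes the error M * (2 / k.+1) of the rescaled iteration at most e / 2. *)
have [k Hk] : exists k : nat, 4 * M / e < k.+1%:R.
  exists (Num.trunc (4 * M / e)); apply: truncnS_gt.
(* Division by M brings p into [-1, 1], where [abs_iter] converges; the terms with coefficient 0
   only pad the two summands of [trig_lin]. *)
have tq : trig (fun x => M * abs_iter k.+1 (M^-1 * p x + 0 * p x) + 0 * p x).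
  apply: (@trig_lin M 0 (fun x => abs_iter k.+1 (M^-1 * p x + 0 * p x)) p) => //.
  by apply: trig_abs_iter; exact: trig_lin.
eexists; first exact: tq.
move=> x /=; rewrite !mul0r !addr0.
have pM : `|M^-1 * p x| <= 1.
  by rewrite normrM normfV (gtr0_norm M0) ler_pdivrMl // mulr1.
have A := abs_iter_cvg k pM.
have -> : `|g x| - M * abs_iter k.+1 (M^-1 * p x) = ( `|g x| - `|p x| ) +
    M * ( `|M^-1 * p x| - abs_iter k.+1 (M^-1 * p x)).
  rewrite mulrBr normrM normfV (gtr0_norm M0) mulrA divff ?gt_eqF //; ring.
have -> : e = e / 2 + e / 2 by field.
apply: le_trans (ler_normD _ _) _; apply: lerD.
  exact: le_trans (ler_dist_dist _ _) (Hp x).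
rewrite normrM (gtr0_norm M0); apply: (@le_trans _ _ (M * (2 / k.+1%:R))).
  by apply: ler_wpM2l => //; exact: ltW.
rewrite mulrA ler_pdivrMr ?ltr0n //; move: Hk; rewrite ltr_pdivrMr //.
set K := k.+1%:R; lra.
Qed.

Lemma trig_closure_max g h : trig_closure g -> trig_closure h ->
  trig_closure (fun x => Num.max (g x) (h x)).
Proof.
move=> Hg Hh; have := trig_closure_lin 2^-1 2^-1
  (trig_closure_lin 1 1 Hg Hh) (trig_closure_abs (trig_closure_lin 1 (-1) Hg Hh)).
congr trig_closure; apply/funext => x.
by rewrite maxr_absE !mul1r mulN1r; field.
Qed.

Lemma trig_closure_min g h : trig_closure g -> trig_closure h ->
  trig_closure (fun x => Num.min (g x) (h x)).
Proof.
move=> Hg Hh; have := trig_closure_lin 2^-1 (- 2^-1)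
  (trig_closure_lin 1 1 Hg Hh) (trig_closure_abs (trig_closure_lin 1 (-1) Hg Hh)).
congr trig_closure; apply/funext => x.
by rewrite minr_absE !mul1r mulN1r; field.
Qed.

Lemma trig_closure_interpolation (f : 'cV[R]_q -> R) (x y : 'cV[R]_q) :
  exists2 g, trig_closure g & g x = f x /\ g y = f y.
Proof.
have [->|] := eqVneq x y.
  by exists (fun=> f y) => //; apply: trig_closure_trig; exact: trig_cst.
move=> /eqP/matrixP xy.
have [j xyj] : exists j, x j 0 != y j 0.
  by apply/existsP; apply: contra_notT xy => /existsPn H i k;
     rewrite ord1; apply/eqP; have := H i; rewrite negbK.
(* After the shift by t the form is 0 at x and pi at y, so its cosine takes the values 1 and -1
   there. *)
pose c : 'cV[R]_q := \col_i ((i == j)%:R * (pi / (y j 0 - x j 0))).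
have cE z : (c^T *m z) 0 0 = pi / (y j 0 - x j 0) * z j 0.
  rewrite mxE (bigD1 j) //= big1 => [|i ij]; first by rewrite !mxE eqxx mul1r addr0.
  by rewrite !mxE (negbTE ij) !mul0r.
pose t := - (c^T *m x) 0 0.
exists (fun z => ((f x - f y) / 2) * cos ((c^T *m z) 0 0 + t) + ((f x + f y) / 2) * 1).
  by apply: trig_closure_trig; apply: trig_lin; [exact: trig_cos|exact: trig_cst].
split; first by rewrite /t subrr cos0; field.
rewrite /t !cE -mulrBr divfK; last by rewrite subr_eq0 eq_sym.
by rewrite cospi; field.
Qed.

Lemma compact_box (K : R) : compact [set x : 'cV[R]_q | forall j, `|x j 0| <= K].
Proof.
have -> : [set x : 'cV[R]_q | forall j, `|x j 0| <= K] =
    trmx @` [set v : 'rV[R]_q | forall j, `[- K, K]%classic (v 0 j)].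
  apply/seteqP; split=> [x Hx|_ [v Hv <-] j].
    exists x^T; last by rewrite trmxK.
    by move=> j /=; rewrite mxE in_itv /= -ler_norml.
  by have := Hv j; rewrite /= in_itv /= -ler_norml mxE.
apply: continuous_compact; last first.
  apply: (@rV_compact R q (fun=> `[- K, K]%classic)) => j; exact: segment_compact.
apply: continuous_subspaceT => v A [P HP sPA].
exists (fun i j => P j i) => [i j|w Hw]; first by have := HP j i; rewrite mxE.
by apply: sPA => i j; rewrite mxE; exact: Hw.
Qed.

(** The approximation on the box is clipped to [-C, C] before it is replaced by a trigonometric sum.
    Clipping stays in the closure, gives the bound outside the box, and cannot increase the distance
    to f, whose values lie in [-C, C]. *)
Lemma trig_approx (f : 'cV[R]_q -> R) (C K e : R) : continuous f ->
  (forall x, `|f x| <= C) -> 0 <= K -> 0 < e ->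
  exists2 p, trig p & (forall x, `|p x| <= C + e) /\
    forall x : 'cV[R]_q, (forall j, `|x j 0| <= K) -> `|p x - f x| <= e.
Proof.
move=> cf fC K0 e0; have e2 : 0 < e / 2 by lra.
have C0 : 0 <= C by exact: le_trans (fC 0).
have [||||||||g Hg gf] := @stone_weierstrass_lattice R 'cV[R]_q
  [set x : 'cV[R]_q | forall j, `|x j 0| <= K] trig_closure f (e / 2).
- exact: compact_box.
- by exists 0 => j; rewrite mxE normr0.
- exact: cf.
- by move=> ? [].
- exact: trig_closure_max.
- exact: trig_closure_min.
- exact: trig_closure_interpolation.
- exact: e2.
have Hc k : trig_closure (fun=> k) by apply: trig_closure_trig; exact: trig_cst.
have [_ /(_ _ e2) [p tp Hp]] := trig_closure_max (trig_closure_min Hg (Hc C)) (Hc (- C)).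
exists p => //; split=> x; have := Hp x; set h := Num.max _ _.
  have : `|h| <= C.
    by rewrite /h ler_norml le_max lexx orbT /= ge_max ge_min lexx orbT /=; lra.
  by rewrite !ler_norml => /andP[? ?] /andP[? ?]; apply/andP; split; lra.
move=> ph /gf gfx.
have /le_lt_trans/(_ gfx) : `|h - f x| <= `|g x - f x|.
  have := fC x; rewrite ler_norml => /andP[f1 f2].
  have := ler_norm (g x - f x); have := ler_norm (f x - g x); rewrite distrC ler_norml.
  rewrite /h; case: (leP (g x) C) => gC; rewrite maxEle; case: ifPn; rewrite -?ltNge => gC' ? ?;
    by apply/andP; split; lra.
move: ph; rewrite ltr_norml !ler_norml => /andP[? ?] /andP[? ?].
by apply/andP; split; lra.
Qed.

End trigonometric_closure.

(** * Laws of images and Borel sets of vectors *)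

Section law_of_image.
Context d1 d2 (T1 : measurableType d1) (T2 : measurableType d2) (R : realType).

Lemma image_law (P : probability T1 R) (f : T1 -> T2) :
  measurable_fun setT f -> exists L : probability T2 R, forall A, L A = P (f @^-1` A).
Proof.
move=> mf; pose X : {mfun T1 >-> T2} := HB.pack f (isMeasurableFun.Build _ _ _ _ f mf).
by exists (distribution P X : probability T2 R).
Qed.

Variables (L : probability T2 R) (P : probability T1 R) (f : T1 -> T2).
Hypotheses (mf : measurable_fun setT f)
  (LP : forall A, measurable A -> L A = P (f @^-1` A)).

Lemma ge0_integral_image_law (g : T2 -> \bar R) : measurable_fun setT g ->
  (forall y, 0 <= g y)%E -> (\int[L]_y g y = \int[P]_x g (f x))%E.
Proof.
move=> mg g0; pose X : {mfun T1 >-> T2} := HB.pack f (isMeasurableFun.Build _ _ _ _ f mf).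
rewrite (eq_measure_integral (distribution P X)); last by move=> A mA _; exact: LP.
by rewrite [LHS]ge0_integral_pushforward //= => y _; exact: g0.
Qed.

Lemma integral_image_law (g : T2 -> \bar R) : measurable_fun setT g ->
  P.-integrable setT (g \o f) -> (\int[L]_y g y = \int[P]_x g (f x))%E.
Proof.
move=> mg ig; pose X : {mfun T1 >-> T2} := HB.pack f (isMeasurableFun.Build _ _ _ _ f mf).
rewrite (eq_measure_integral (distribution P X)); last by move=> A mA _; exact: LP.
by rewrite [LHS]integral_pushforward.
Qed.

End law_of_image.

Section borel_vectors.
Variables (R : realType) (q : nat).
Notation E := 'cV[R]_q.

(** Rational endpoints make the family countable, so that it generates the Borel sets by countable
    unions and allows null sets to be collected; it is also closed under intersection, hence
    determines a law. *)
Definition box (I : {ffun 'I_q -> rat * rat}) : set E :=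
  [set x | forall j, ratr (I j).1 < x j 0 < ratr (I j).2].

Lemma open_bigcup_box (U : set E) : open U ->
  U = \bigcup_I (if asbool (box I `<=` U) then box I else set0).
Proof.
move=> oU; apply/seteqP; split=> [x Ux|x [I _]]; last first.
  by case: asboolP => // s; exact: s.
have : nbhs x U by move: oU; rewrite openE; exact.
move=> /nbhs_ballP[e /= e0 sU].
have /(_ _)/cid ex j : exists r : rat * rat,
    x j 0 - e < ratr r.1 < x j 0 /\ x j 0 < ratr r.2 < x j 0 + e.
  have [r] : exists r : rat, ratr r \in `](x j 0 - e), (x j 0)[ by apply: rat_in_itvoo; lra.
  have [s] : exists s : rat, ratr s \in `](x j 0), (x j 0 + e)[ by apply: rat_in_itvoo; lra.
  by rewrite !in_itv /= => hs hr; exists (r, s).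
pose I := [ffun j => sval (ex j)].
have Ie j : x j 0 - e < ratr (I j).1 < x j 0 /\ x j 0 < ratr (I j).2 < x j 0 + e.
  by rewrite ffunE; case: (ex j).
exists I => //; rewrite asboolT => [j|y By]; first by have [/andP[_ ->] /andP[->]] := Ie j.
apply: sU; split=> // j k; rewrite ord1 /ball /= ltr_norml.
have [/andP[a1 a2] /andP[a3 a4]] := Ie j; have /andP[b1 b2] := By j.
by apply/andP; split; lra.
Qed.

Lemma box_setI (I J : {ffun 'I_q -> rat * rat}) : exists K, box I `&` box J = box K.
Proof.
exists [ffun j => (Num.max (I j).1 (J j).1, Num.min (I j).2 (J j).2)].
have mxr (a b : rat) : ratr (Num.max a b) = Num.max (ratr a) (ratr b) :> R.
  by rewrite !maxEle ler_rat; case: ifP.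
have mnr (a b : rat) : ratr (Num.min a b) = Num.min (ratr a) (ratr b) :> R.
  by rewrite !minEle ler_rat; case: ifP.
apply/seteqP; split=> x.
  move=> [BI BJ] j; rewrite ffunE /= mxr mnr lt_min gt_max.
  by have /andP[-> ->] := BI j; have /andP[-> ->] := BJ j.
move=> B; split=> j; have := B j; rewrite ffunE /= mxr mnr lt_min gt_max.
  by move=> /andP[/andP[-> _] /andP[-> _]].
by move=> /andP[/andP[_ ->] /andP[_ ->]].
Qed.

Lemma open_box I : open (box I).
Proof.
rewrite openE => x Bx; exists (fun j _ => [set t | ratr (I j).1 < t < ratr (I j).2]).
  move=> j k; rewrite ord1; have Bj := Bx j.
  have : x j 0 \in `](ratr (I j).1), (ratr (I j).2)[ by rewrite in_itv.
  by move=> /near_in_itvoo; apply: filterS => t /=; rewrite in_itv.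
by move=> y By j; exact: By.
Qed.

Lemma borel_box : (@measurable _ E) = <<s range box >>.
Proof.
apply/seteqP; split.
  apply: smallest_sub; first exact: smallest_sigma_algebra.
  move=> U /open_bigcup_box ->.
  pose T' := g_sigma_algebraType (range box).
  apply: (@countable_bigcupT_measurable _ T') => [|I]; first exact: countableP.
  case: asboolP => _; last exact: (@measurable0 _ T').
  by apply: sub_sigma_algebra; exists I.
apply: smallest_sub; first exact: sigma_algebra_measurable.
by move=> _ [I _ <-]; apply: sub_sigma_algebra; exact: open_box.
Qed.

Lemma measurable_box I : measurable (box I).
Proof. by apply: sub_sigma_algebra; exact: open_box. Qed.

Context d (T : measurableType d).

Lemma measurable_fun_vector (f : T -> E) :
  (forall j, measurable_fun setT (fun w => f w j 0)) -> measurable_fun setT f.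
Proof.
move=> mf; apply: (measurability _ borel_box) => _ [_ [I _ <-] <-].
rewrite setTI (_ : _ @^-1` _ = \bigcap_(j in [set: 'I_q])
    ((fun w => f w j 0) @^-1` `](ratr (I j).1 : R), ratr (I j).2[)).
  apply: fin_bigcap_measurable => // j _; rewrite -[X in measurable X]setTI.
  by apply: mf => //; exact: measurable_itv.
apply/seteqP; split=> w /=; first by move=> B j _ /=; rewrite in_itv /=; exact: B.
by move=> B j; have := B j Logic.I; rewrite /= in_itv.
Qed.

Lemma continuous_measurable_fun_vector (f : E -> R) :
  continuous f -> measurable_fun setT f.
Proof.
move=> cf; apply: (measurability _ (RGenOInfty.measurableE R)) => _ [_ [a ->] <-].
rewrite setTI; apply: sub_sigma_algebra; apply: open_comp => [x _|]; first exact: cf.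
exact: interval_open.
Qed.

Lemma measurable_coord j : measurable_fun setT (fun x : E => x j 0).
Proof. by apply: continuous_measurable_fun_vector; exact: coord_continuous. Qed.

Lemma measurable_linform (c : E) : measurable_fun setT (fun x : E => (c^T *m x) 0 0).
Proof. by apply: continuous_measurable_fun_vector; exact: linform_continuous. Qed.

End borel_vectors.

Lemma measurable_fun_coord (R : realType) (q : nat) d (T : measurableType d)
  (f : T -> 'cV[R]_q) j : measurable_fun setT f -> measurable_fun setT (fun w => f w j 0).
Proof. by move=> mf; exact: (measurableT_comp (measurable_coord j) mf). Qed.

Lemma measurable_add_mulmx (R : realType) (m q : nat) (F : 'M[R]_(m, q)) :
  measurable_fun setT (fun zy : 'cV[R]_m * 'cV[R]_q => zy.1 + F *m zy.2).
Proof.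
apply: measurable_fun_vector => j; under eq_fun do rewrite !mxE.
apply: measurable_funD; first exact: measurable_fun_coord.
apply: measurable_sum => k; apply: measurable_funM => //.
exact: measurable_fun_coord.
Qed.

(** * Integrals against measures with a density *)

Import HBNNSimple.

(** The passage from indicators to simple functions to increasing limits, done once for an arbitrary
    functional; it then yields both the integral against a density and the disintegration of a
    mixture. *)
Lemma ge0_integral_ext d (T : measurableType d) (R : realType)
    (mu : {measure set T -> \bar R}) (Phi : (T -> \bar R) -> \bar R) :
  (forall A, measurable A -> Phi (fun x => (\1_A x)%:E) = mu A) ->
  (forall f g, measurable_fun setT f -> measurable_fun setT g ->
     (forall x, 0 <= f x)%E -> (forall x, 0 <= g x)%E ->
     Phi (fun x => f x + g x)%E = (Phi f + Phi g)%E) ->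
  (forall (k : R) (f : T -> \bar R), measurable_fun setT f ->
     (forall x, 0 <= f x)%E -> 0 <= k ->
     Phi (fun x => k%:E * f x)%E = (k%:E * Phi f)%E) ->
  (forall f : nat -> T -> \bar R, (forall n, measurable_fun setT (f n)) ->
     (forall n x, 0 <= f n x)%E ->
     (forall x, {homo f ^~ x : n m / (n <= m)%N >-> (n <= m)%E}) ->
     Phi (fun x => limn (f ^~ x)) = limn (Phi \o f)) ->
  forall f, measurable_fun setT f -> (forall x, 0 <= f x)%E ->
  Phi f = (\int[mu]_x f x)%E.
Proof.
move=> P1 PD PM Plim f mf f0.
pose h := nnsfun_approx measurableT mf.
have Ph n : Phi (fun x => (h n x)%:E) = (\int[mu]_x (h n x)%:E)%E.
  have sumE (s : seq R) : (forall y, y \in s -> 0 <= y) ->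
      Phi (fun x => \sum_(y <- s) (y%:E * (\1_(h n @^-1` [set y]) x)%:E))%E =
      (\sum_(y <- s) (y%:E * mu (h n @^-1` [set y])))%E.
    have ind0 A (x : T) : (0 <= (\1_A x : R)%:E)%E by rewrite lee_fin.
    have mind y : measurable_fun setT (fun x : T => (\1_(h n @^-1` [set y]) x : R)%:E).
      by apply/measurable_EFinP; exact: measurable_indic.
    elim: s => [|y s IH] s0.
      rewrite big_nil.
      transitivity (Phi (fun x => (\1_(@set0 T) x)%:E)%E); last by rewrite P1 ?measure0.
      by congr Phi; apply/funext => x; rewrite big_nil indic0.
    rewrite big_cons -IH; last by move=> z zs; apply: s0; rewrite inE zs orbT.
    have y0 : 0 <= y by apply: s0; rewrite mem_head.
    rewrite -P1 // -PM // -PD.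
    - by congr Phi; apply/funext => x; rewrite big_cons.
    - exact: measurable_funeM.
    - apply: emeasurable_sum => z; exact: measurable_funeM.
    - by move=> x; rewrite mule_ge0.
    - move=> x; rewrite big_seq; apply: sume_ge0 => z zs; rewrite mule_ge0 // lee_fin.
      by apply: s0; rewrite inE zs orbT.
  have hE x : (h n x)%:E = (\sum_(y <- finmap.enum_fset (fset_set (range (h n))))
      (y%:E * (\1_(h n @^-1` [set y]) x)%:E))%E.
    rewrite fimfunE fsbig_finite //= sumEFin; congr EFin.
  rewrite integralT_nnsfun sintegralE fsbig_finite //=.
  rewrite (_ : (fun x => (h n x)%:E) = (fun x => \sum_(y <- finmap.enum_fset (fset_set (range (h n))))
      (y%:E * (\1_(h n @^-1` [set y]) x)%:E))%E); last exact/funext.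
  rewrite sumE // => y; rewrite in_fset_set // inE => -[x _ <-]; exact: fun_ge0.
have fE : f = fun x => limn (fun n => (h n x)%:E).
  by apply/funext => x; apply/esym/cvg_lim => //; exact: cvg_nnsfun_approx.
rewrite fE Plim.
- rewrite monotone_convergence //.
  + by rewrite [X in lim (X @ _)](funext Ph).
  + by move=> n; apply/measurable_EFinP.
  + by move=> n x _; rewrite lee_fin.
  + by move=> x _ n m nm; rewrite lee_fin; exact/lefP/nd_nnsfun_approx.
- by move=> n; apply/measurable_EFinP.
- by move=> n x; rewrite lee_fin.
- by move=> x n m nm; rewrite lee_fin; exact/lefP/nd_nnsfun_approx.
Qed.

Lemma ge0_integral_density d (T : measurableType d) (R : realType)
    (mu nu : {measure set T -> \bar R}) (p : T -> R) (f : T -> \bar R) :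
  measurable_fun setT p -> (forall x, 0 <= p x) ->
  (forall A, measurable A -> nu A = \int[mu]_(x in A) (p x)%:E)%E ->
  measurable_fun setT f -> (forall x, 0 <= f x)%E ->
  (\int[nu]_x f x = \int[mu]_x (f x * (p x)%:E))%E.
Proof.
move=> mp p0 nuE mf f0; apply/esym.
have {}mp : measurable_fun setT (EFin \o p) by exact/measurable_EFinP.
have {}p0 x : (0 <= (p x)%:E)%E by rewrite lee_fin.
apply: (@ge0_integral_ext _ _ _ nu (fun f => \int[mu]_x (f x * (p x)%:E))%E) => //.
- move=> A mA; rewrite nuE // [RHS]integral_mkcond; apply: eq_integral => x _.
  by rewrite patchE indicE; case: (x \in A); rewrite ?mul1e ?mul0e.
- move=> g h mg mh g0 h0; rewrite -ge0_integralD //.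
  + by apply: eq_integral => x _; rewrite ge0_muleDl.
  + by move=> x _; rewrite mule_ge0.
  + exact: emeasurable_funM.
  + by move=> x _; rewrite mule_ge0.
  + exact: emeasurable_funM.
- move=> k g mg g0 k0; rewrite -ge0_integralZl //.
  + by apply: eq_integral => x _; rewrite muleA.
  + exact: emeasurable_funM.
  + by move=> x _; rewrite mule_ge0.
- move=> g mg g0 ndg; rewrite /comp.
  rewrite -monotone_convergence //; first last.
  + by move=> x _ n m nm; rewrite lee_wpmul2r // ndg.
  + by move=> n x _; rewrite mule_ge0.
  + by move=> n; exact: emeasurable_funM.
  apply: eq_integral => x _; apply/esym/cvg_lim => //.
  by apply: cvgeZr => //; exact: ereal_nondecreasing_is_cvgn (ndg x).
Qed.

(** * The standard normal law on the line *)

Section one_dimensional_normal.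
Variable R : realType.
Notation lambda := (@lebesgue_measure R).

(** Lebesgue measure is s times its image under x |-> m + s x, which by uniqueness has to be checked
    on half-open intervals only. *)
Lemma ge0_integral_affine (m s : R) (f : R -> \bar R) : 0 < s ->
  measurable_fun setT f -> (forall x, 0 <= f x)%E ->
  (\int[lambda]_x f x = \int[lambda]_x (s%:E * f (m + s * x)%R))%E.
Proof.
move=> s0 mf f0; pose F (x : measurableTypeR R) : measurableTypeR R := m + s * x.
have mF : measurable_fun setT F by apply: measurable_funD => //; exact: measurable_funM.
pose X : {mfun measurableTypeR R >-> measurableTypeR R} :=
  HB.pack F (isMeasurableFun.Build _ _ _ _ F mF).
pose s' : {nonneg R} := NngNum (ltW s0).
have E A : measurable A -> lambda A = mscale s' (pushforward lambda X) A.
  apply: lebesgue_measure_unique => _ [[a b] _ <-] /=.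
  rewrite /mscale /= (_ : pushforward lambda F [set` `]a, b]] =
    lambda [set` `]((a - m) / s), ((b - m) / s)]]); last first.
    congr (lambda _); apply/seteqP; split=> x; rewrite /= !in_itv /= ltr_pdivrMr //
      ler_pdivlMr // /F => /andP[? ?]; apply/andP; split; lra.
  rewrite !lebesgue_measure_itv /= !lte_fin ltr_pM2r ?invr_gt0 // ltrD2r.
  case: ifP => _; last by rewrite mule0.
  rewrite -!EFinD -EFinM; congr EFin; field.
  by rewrite gt_eqF.
rewrite (eq_measure_integral (mscale s' (pushforward lambda X))); last by move=> A mA _; exact: E.
rewrite ge0_integral_mscale // ge0_integral_pushforward //= preimage_setT.
rewrite -ge0_integralZl //; last by rewrite lee_fin ltW.
exact: (measurableT_comp mf mF).
Qed.

Notation gamma := (normal_prob (0 : R) 1).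
Notation phi := (normal_pdf (0 : R) 1).

Lemma normal_pdf_standardize (m s x : R) : 0 < s ->
  normal_pdf m s x = s^-1 * phi ((x - m) / s).
Proof.
move=> s0; rewrite !normal_pdfE ?oner_eq0 ?gt_eqF // /normal_fun /normal_peak subr0.
rewrite mulrA; congr (_ * expR _).
  rewrite expr1n mul1r -mulrnAr sqrtrM ?sqr_ge0 // sqrtr_sqr gtr0_norm //.
  by rewrite invfM.
by field; rewrite gt_eqF.
Qed.

Lemma phiE (x : R) : phi x = normal_peak 1 * expR (- x ^+ 2 / 2).
Proof. by rewrite normal_pdfE ?oner_eq0 // /normal_fun subr0 expr1n. Qed.

Lemma phi_gt0 x : 0 < phi x.
Proof. by rewrite phiE mulr_gt0 ?expR_gt0 // normal_peak_gt0 ?oner_eq0. Qed.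

Lemma ge0_integral_gamma (f : R -> \bar R) :
  measurable_fun setT f -> (forall x, 0 <= f x)%E ->
  (\int[gamma]_x f x = \int[lambda]_x (f x * (phi x)%:E))%E.
Proof.
move=> mf f0; apply: ge0_integral_density => //; first exact: measurable_normal_pdf.
by move=> x; exact: ltW (phi_gt0 x).
Qed.

(** The scaled standard normal also covers the Dirac mass at v = 0, so later arguments need no
    separate treatment of singular covariances. *)
Lemma normal1E (v : R) (A : set R) : 0 <= v -> measurable A ->
  normal1 0 v A = gamma [set z | A (Num.sqrt v * z)].
Proof.
move=> v0 mA; rewrite /normal1; case: eqVneq => [->|vn0].
  rewrite sqrtr0 diracE; have [A0|A0] := boolP (0 \in A).
    rewrite (_ : [set _ | _] = setT) ?probability_setT //.
    by apply/seteqP; split=> // z _ /=; rewrite mul0r; rewrite inE in A0.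
  rewrite (_ : [set _ | _] = set0) ?measure0 //.
  by apply/seteqP; split=> // z /=; rewrite mul0r => /mem_set; rewrite (negbTE A0).
have s0 : 0 < Num.sqrt v by rewrite sqrtr_gt0 lt0r vn0.
set s := Num.sqrt v in s0 *.
rewrite /normal_prob integral_mkcond (ge0_integral_affine 0 s0).
- rewrite [RHS]integral_mkcond; apply: eq_integral => z _.
  rewrite add0r !patchE (_ : (s * z \in A) = (z \in [set z | A (s * z)])); last first.
    by apply/idP/idP; rewrite !inE.
  case: ifP => _; last by rewrite mule0.
  rewrite normal_pdf_standardize // -EFinM; congr EFin.
  by rewrite subr0 mulrA divff ?mul1r ?gt_eqF // mulrAC divff ?mul1r // gt_eqF.
- apply/(measurable_restrictT _ mA); apply: measurable_funTS; apply/measurable_EFinP.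
  exact: measurable_normal_pdf.
- by move=> x; rewrite patchE; case: ifP; rewrite ?lee_fin ?normal_pdf_ge0.
Qed.

Lemma measurable_preimage_scale (s : R) (A : set R) : measurable A ->
  measurable [set z | A (s * z)].
Proof.
move=> mA; rewrite -[X in measurable X]setTI.
by apply: (measurable_funM (measurable_cst s) (@measurable_id _ _ setT)).
Qed.

Lemma gamma_opp (A : set R) : measurable A -> gamma [set z | A (- z)] = gamma A.
Proof.
move=> mA; have mN : measurable_fun setT (-%R : R -> R) by apply: continuous_measurable_fun; exact: opp_continuous.
have mNA : measurable [set z : R | A (- z)].
  by rewrite -[X in measurable X]setTI; exact: (mN measurableT).
rewrite /normal_prob integral_mkcond [RHS]integral_mkcond.
rewrite (eq_measure_integral (pushforward lambda (-%R : _ -> measurableTypeR R))); last first.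
  by move=> B mB _; rewrite -[LHS]lebesgue_measureN.
rewrite ge0_integral_pushforward //.
- apply: eq_integral => z _; rewrite /= !patchE.
  rewrite (_ : (- z \in [set z | A (- z)]) = (z \in A)); last first.
    by apply/idP/idP; rewrite !inE /= opprK.
  by rewrite !phiE sqrrN.
- apply/(measurable_restrictT _ mNA); apply: measurable_funTS; apply/measurable_EFinP; exact: measurable_normal_pdf.
- by move=> x _; rewrite patchE; case: ifP; rewrite ?lee_fin ?normal_pdf_ge0.
Qed.

Lemma gamma_indic (s m : R) (A : set R) : measurable A ->
  (gamma [set t | A (m + s * t)%R] = \int[lambda]_t ((\1_A (m + s * t)%R)%:E * (phi t)%:E))%E.
Proof.
move=> mA.
have mF : measurable_fun setT (fun t : R => m + s * t).
  by apply: measurable_funD => //; exact: measurable_funM.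
have mB : measurable [set t : R | A (m + s * t)%R].
  by rewrite -[X in measurable X]setTI; exact: (mF measurableT).
rewrite -[X in normal_prob _ _ X]setIT -integral_indic // ge0_integral_gamma //.
by apply/measurable_EFinP; exact: measurable_indic.
Qed.

(** Completion of the square in s: the joint exponent splits into a centred one in u with standard
    deviation c and one in s with mean a u / c^2 and standard deviation b / c. *)
Lemma gaussian_square_completion (a b c s u : R) : b != 0 -> 0 < c ->
  c ^+ 2 = a ^+ 2 + b ^+ 2 ->
  - s ^+ 2 / 2 + - ((u - a * s) / b) ^+ 2 / 2 =
  - (u / c) ^+ 2 / 2 + - ((s - a * u / c ^+ 2) / (b / c)) ^+ 2 / 2.
Proof.
move=> b0 c0 c2.
have num0 : s ^+ 2 * b ^+ 2 * c ^+ 2 + (u - a * s) ^+ 2 * c ^+ 2 - u ^+ 2 * b ^+ 2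
    - (s * c ^+ 2 - a * u) ^+ 2 = 0 by rewrite c2; ring.
apply/eqP; rewrite -subr_eq0 (_ : _ - _ = - (s ^+ 2 * b ^+ 2 * c ^+ 2 +
  (u - a * s) ^+ 2 * c ^+ 2 - u ^+ 2 * b ^+ 2 - (s * c ^+ 2 - a * u) ^+ 2) /
  (b ^+ 2 * c ^+ 2) / 2); last by field; rewrite b0 gt_eqF.
by rewrite num0 oppr0 !mul0r.
Qed.

(** The joint density of s and u = a s + b t, written as the marginal density of u times the
    conditional density of s given u; integrating over s then leaves the marginal. *)
Lemma phi_mul (a b c s u : R) : 0 < b -> 0 < c -> c ^+ 2 = a ^+ 2 + b ^+ 2 ->
  phi s * (b^-1 * phi ((u - a * s) / b)) =
  c^-1 * phi (u / c) * normal_pdf (a * u / c ^+ 2) (b / c) s.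
Proof.
move=> b0 c0 c2; rewrite [normal_pdf _ (b / c) s]normal_pdf_standardize ?divr_gt0 // !phiE.
have := congr1 expR (gaussian_square_completion s u (lt0r_neq0 b0) c0 c2).
rewrite !expRD => e.
set k := normal_peak 1; set e1 := expR _ in e *; set e2 := expR _ in e *.
set e3 := expR _ in e *; set e4 := expR _ in e *.
transitivity (k ^+ 2 * b^-1 * (e1 * e2)); first by ring.
by rewrite e; field; rewrite !gt_eqF.
Qed.

Lemma gamma_convolution (a b : R) (A : set R) : 0 <= a -> 0 <= b -> measurable A ->
  (\int[gamma]_s gamma [set t | A (a * s + b * t)%R] =
   gamma [set z | A (Num.sqrt (a ^+ 2 + b ^+ 2) * z)%R])%E.
Proof.
(* The substitution u = a s + b t divides by b, so b = 0 is treated apart. Otherwise the order of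
   integration is exchanged and s is integrated out by [phi_mul]. *)
move=> a0 b0 mA; have [->|bn0] := eqVneq b 0.
  rewrite expr0n addr0 sqrtr_sqr ger0_norm //.
  rewrite -[in RHS](setIT [set z | A (a * z)]) -integral_indic //; last exact: measurable_preimage_scale.
  apply: eq_integral => s _; rewrite indicE.
  have [As|As] := boolP (s \in _).
    rewrite (_ : [set _ | _] = setT) ?probability_setT //.
    by apply/seteqP; split=> // t _ /=; rewrite mul0r addr0; rewrite inE in As.
  rewrite (_ : [set _ | _] = set0) ?measure0 //.
  by apply/seteqP; split=> // t /=; rewrite mul0r addr0 => H; move: As; rewrite notin_setE.
have bp : 0 < b by rewrite lt0r bn0.
set c := Num.sqrt _.
have c2 : c ^+ 2 = a ^+ 2 + b ^+ 2 by rewrite sqr_sqrtr // addr_ge0 ?sqr_ge0.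
have cp : 0 < c by rewrite sqrtr_gt0 ltr_wpDl ?sqr_ge0 // exprn_gt0.
pose I (u : R) : \bar R := (\1_A u)%:E.
have mI : measurable_fun setT I by apply/measurable_EFinP; exact: measurable_indic.
have I0 u : (0 <= I u)%E by rewrite lee_fin.
pose K (s u : R) : R := phi s * (b^-1 * phi ((u - a * s) / b)).
have mphi : measurable_fun setT phi by exact: measurable_normal_pdf.
have phi0 x : 0 <= phi x by exact: ltW (phi_gt0 x).
have K0 s u : 0 <= K s u by rewrite /K !mulr_ge0 // invr_ge0.
have mK : measurable_fun setT (fun su : R * R => K su.1 su.2).
  apply: measurable_funM; first exact: measurableT_comp.
  apply: measurable_funM => //; apply: measurableT_comp => //.
  apply: measurable_funM => //; apply: measurable_funB => //.
  exact: measurable_funM.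
transitivity (\int[lambda]_s \int[lambda]_u (I u * (K s u)%:E))%E.
  rewrite ge0_integral_gamma //; first last.
    pose B := (fun su : R * R => a * su.1 + b * su.2) @^-1` A.
    rewrite (_ : (fun s => _) = gamma \o xsection B); last first.
      by apply/funext => s /=; congr (normal_prob _ _ _); apply/seteqP; split=> t;
         rewrite /xsection /= inE.
    apply: measurable_fun_xsection; rewrite -[X in measurable X]setTI.
    by apply: (measurable_funD (measurable_funM _ _) (measurable_funM _ _)).
  apply: eq_integral => s _.
  rewrite gamma_indic // -ge0_integralZr //.
  - rewrite (ge0_integral_affine (a * s) bp).
    + apply: eq_integral => t _.
      rewrite /K /I (_ : (a * s + b * t - a * s) / b = t); last by field.
      by rewrite -!EFinM; congr EFin; field.
    + apply: emeasurable_funM => //; apply/measurable_EFinP.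
      exact: (measurableT_comp mK (pair1_measurable s)).
    + by move=> u; rewrite mule_ge0 // lee_fin.
  - apply: emeasurable_funM.
      exact: (measurableT_comp mI (measurable_funD (measurable_cst _) (measurable_funM (measurable_cst _) _))).
    exact/measurable_EFinP.
  - by move=> t _; rewrite mule_ge0 // lee_fin.
  - by rewrite lee_fin.
rewrite (@fubini_tonelli _ _ _ _ _ lambda lambda (fun su : R * R => I su.2 * (K su.1 su.2)%:E)%E) /=; first last.
- by move=> su; rewrite mule_ge0 // lee_fin.
- apply: emeasurable_funM; first exact: measurableT_comp.
  exact/measurable_EFinP.
transitivity (\int[lambda]_u (I u * (c^-1 * phi (u / c))%:E))%E.
  apply: eq_integral => u _.
  rewrite ge0_integralZl //; first last.
  - by move=> s _; rewrite lee_fin.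
  - by apply/measurable_EFinP; exact: (measurableT_comp mK (pair2_measurable u)).
  congr (_ * _)%E.
  have KE s : K s u = c^-1 * phi (u / c) * normal_pdf (a * u / c ^+ 2) (b / c) s.
    exact: phi_mul.
  under eq_integral do rewrite KE EFinM.
  rewrite ge0_integralZl //.
  - by rewrite integral_normal_pdf mule1.
  - by apply/measurable_EFinP; exact: measurable_normal_pdf.
  - by move=> s _; rewrite lee_fin normal_pdf_ge0.
  - by rewrite lee_fin mulr_ge0 // invr_ge0 ltW.
rewrite (ge0_integral_affine 0 cp); first last.
- by move=> u; rewrite mule_ge0 // lee_fin mulr_ge0 // invr_ge0 ltW.
- apply: emeasurable_funM => //; apply/measurable_EFinP; apply: measurable_funM => //.
  apply: measurableT_comp => //; exact: measurable_funM.
rewrite (_ : [set z | A (c * z)] = [set z | A (0 + c * z)]); last first.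
  by apply/seteqP; split=> z /=; rewrite add0r.
rewrite gamma_indic //; apply: eq_integral => z _.
rewrite /I add0r mulrAC divff ?gt_eqF // mul1r -!EFinM; congr EFin.
by field; rewrite gt_eqF.
Qed.

(* The Gaussian integral itself, read as a function of the inverse variance [s ^+ 2]. *)
Lemma gamma_exp_square (s : R) : 0 < s ->
  (\int[gamma]_z (expR (- (s ^+ 2 - 1) * z ^+ 2 / 2))%:E = s^-1%:E)%E.
Proof.
move=> s0; rewrite ge0_integral_gamma //.
- transitivity (\int[lambda]_z (s^-1%:E * (normal_pdf 0 s^-1 z)%:E))%E.
    apply: eq_integral => z _; rewrite -!EFinM; congr EFin.
    rewrite [normal_pdf 0 s^-1 z]normal_pdf_standardize ?invr_gt0 // !phiE subr0 !invrK.
    rewrite (_ : - (z * s) ^+ 2 / 2 = - (s ^+ 2 - 1) * z ^+ 2 / 2 + - z ^+ 2 / 2); last by field.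
    by rewrite expRD; field; rewrite gt_eqF.
  rewrite ge0_integralZl //.
  + by rewrite integral_normal_pdf mule1.
  + by apply/measurable_EFinP; exact: measurable_normal_pdf.
  + by move=> z _; rewrite lee_fin normal_pdf_ge0.
  + by rewrite lee_fin invr_ge0 ltW.
- apply/measurable_EFinP/measurableT_comp => //; apply: measurable_funM => //.
  by apply: measurable_funM => //; exact: measurable_funX.
Qed.

Lemma gamma_setT : gamma setT = 1%E.
Proof. exact: (@probability_setT _ _ _ (gamma : probability _ R)). Qed.

Lemma measurable_pow_gamma k : measurable_fun setT (fun z : R => (z ^+ k)%:E).
Proof. by apply/measurable_EFinP; exact: measurable_funX. Qed.

Lemma gamma_fourth_lty : (\int[gamma]_z (z ^+ 4)%:E < +oo)%E.
Proof.
(* With s^2 = 1/2 the integrand of [gamma_exp_square] is exp(z^2 / 4), the square of exp(z^2 / 8) >=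
   1 + z^2 / 8, hence at least z^4 / 64. *)
pose s : R := Num.sqrt 2^-1.
have s2 : s ^+ 2 = 2^-1 by rewrite sqr_sqrtr.
have s0 : 0 < s by rewrite sqrtr_gt0 invr_gt0.
apply: (@le_lt_trans _ _ (\int[gamma]_z (64%:E * (expR (- (s ^+ 2 - 1) * z ^+ 2 / 2))%:E))%E).
  apply: ge0_le_integral => //.
  - by move=> z _; rewrite lee_fin exprn_even_ge0.
  - exact: measurable_pow_gamma.
  - apply: measurable_funeM; apply/measurable_EFinP/measurableT_comp => //; apply: measurable_funM => //.
    by apply: measurable_funM => //; exact: measurable_funX.
  - move=> z _; rewrite -EFinM lee_fin s2.
    have -> : - (2^-1 - 1) * z ^+ 2 / 2 = z ^+ 2 / 4 by field.
    have := expR_ge1Dx (z ^+ 2 / 8).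
    have -> : z ^+ 2 / 4 = z ^+ 2 / 8 + z ^+ 2 / 8 by field.
    rewrite expRD (_ : z ^+ 4 = z ^+ 2 * z ^+ 2); last by rewrite -exprD.
    have : 0 <= z ^+ 2 by rewrite sqr_ge0.
    set y := z ^+ 2; set e := expR _; nra.
rewrite ge0_integralZl //.
- by rewrite gamma_exp_square // -EFinM ltry.
- apply/measurable_EFinP/measurableT_comp => //; apply: measurable_funM => //.
  by apply: measurable_funM => //; exact: measurable_funX.
Qed.

Lemma gamma_integrable (k : nat) : (k <= 4)%N ->
  gamma.-integrable setT (fun z : R => (z ^+ k)%:E).
Proof.
move=> k4; apply/integrableP; split; first exact: measurable_pow_gamma.
apply: (@le_lt_trans _ _ (\int[gamma]_z (1 + (z ^+ 4)%:E))%E).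
  apply: ge0_le_integral => //.
  - by apply: measurableT_comp => //; exact: measurable_pow_gamma.
  - by apply: emeasurable_funD => //; exact: measurable_pow_gamma.
  - move=> z _; rewrite abse_EFin -EFinD lee_fin normrX.
    rewrite -[z ^+ 4]ger0_norm ?exprn_even_ge0 // normrX.
    have := normr_ge0 z; move: `|z| => y y0.
    have [y1|y1] := leP y 1.
      by rewrite (@le_trans _ _ 1) ?exprn_ile1 // lerDl exprn_ge0.
    by rewrite (@le_trans _ _ (y ^+ 4)) ?lerDr // ler_weXn2l // ltW.
rewrite ge0_integralD //.
- by rewrite integral_cst // mul1e [X in (X + _)%E]gamma_setT lte_add_pinfty ?ltry // gamma_fourth_lty.
- by move=> z _; rewrite lee_fin exprn_even_ge0.
- exact: measurable_pow_gamma.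
Qed.

Lemma gamma_mean : (\int[gamma]_z z%:E = 0)%E.
Proof.
have mN : measurable_fun setT (-%R : R -> R) by apply: continuous_measurable_fun; exact: opp_continuous.
have i1 := gamma_integrable (isT : (1 <= 4)%N).
have E : (\int[gamma]_z z%:E = \int[gamma]_z (- z)%:E)%E.
  apply: (@integral_image_law _ _ _ _ R gamma gamma (-%R : R -> R)) => //.
  - by move=> A mA; rewrite -[LHS]gamma_opp.
  - by exact: (integrableN i1).
move: E; under [RHS]eq_integral do rewrite EFinN.
rewrite integralN; last exact: (integrable_add_def measurableT i1).
have := integrable_fin_num measurableT i1.
case: integral => // r _ /eqP; rewrite -EFinN eqe => /eqP rr; congr EFin; lra.
Qed.

(* With m the second moment, [expR t >= 1 + t] and [gamma_exp_square] show that
   s^-1 + (s^2 - 1) / 2 * m is at least 1, its value at s = 1; the derivative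
   m - 1 there must vanish. *)
Lemma gamma_variance : (\int[gamma]_z (z ^+ 2)%:E = 1)%E.
Proof.
have i2 := gamma_integrable (isT : (2 <= 4)%N).
have := integrable_fin_num measurableT i2.
have m0 : (0 <= \int[gamma]_z (z ^+ 2)%:E)%E.
  by apply: integral_ge0 => z _; rewrite lee_fin sqr_ge0.
have mE s : measurable_fun setT (fun z : R => (expR (- (s ^+ 2 - 1) * z ^+ 2 / 2))%:E).
  apply/measurable_EFinP/measurableT_comp => //; apply: measurable_funM => //.
  by apply: measurable_funM => //; exact: measurable_funX.
case E : (\int[gamma]_z (z ^+ 2)%:E)%E m0 => [m| |] // m0 _; rewrite lee_fin in m0.
have low (s z : R) : 1 <= expR (- (s ^+ 2 - 1) * z ^+ 2 / 2) + (s ^+ 2 - 1) / 2 * z ^+ 2.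
  have := expR_ge1Dx (- (s ^+ 2 - 1) * z ^+ 2 / 2); lra.
have low' (s z : R) : 1 + (1 - s ^+ 2) / 2 * z ^+ 2 <= expR (- (s ^+ 2 - 1) * z ^+ 2 / 2).
  by have := low s z; lra.
have key s : 0 < s -> 1 <= s^-1 + (s ^+ 2 - 1) / 2 * m.
  (* The sign of s^2 - 1 decides on which side the quadratic term is integrated, so that all
     integrands are nonnegative. *)
  move=> s0; have [s1|s1] := leP 1 s.
    have h0 : 0 <= (s ^+ 2 - 1) / 2 by nra.
    rewrite -lee_fin EFinD EFinM -E -gamma_exp_square // -ge0_integralZl //; first last.
    - by move=> z _; rewrite lee_fin sqr_ge0.
    - exact: measurable_pow_gamma.
    rewrite -ge0_integralD //; first last.
    - by apply: measurable_funeM; exact: measurable_pow_gamma.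
    - by move=> z _; rewrite -EFinM lee_fin mulr_ge0 ?sqr_ge0.
    - exact: mE.
    rewrite -gamma_setT -[X in normal_prob _ _ X]setIT -integral_indic //.
    apply: ge0_le_integral => //.
    - by apply/measurable_EFinP; exact: measurable_indic.
    - by apply: emeasurable_funD; [exact: mE|apply: measurable_funeM; exact: measurable_pow_gamma].
    - by move=> z _; rewrite indicT -EFinM -EFinD lee_fin; exact: low.
  have h0 : 0 <= (1 - s ^+ 2) / 2 by nra.
  rewrite -subr_ge0 (_ : _ - 1 = s^-1 - (1 + (1 - s ^+ 2) / 2 * m)); last by field; rewrite gt_eqF.
  rewrite subr_ge0 -lee_fin EFinD EFinM -E -gamma_exp_square // -ge0_integralZl //; first last.
  - by move=> z _; rewrite lee_fin sqr_ge0.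
  - exact: measurable_pow_gamma.
  rewrite -gamma_setT -[X in normal_prob _ _ X]setIT -integral_indic //.
  rewrite -ge0_integralD //; first last.
  - by apply: measurable_funeM; exact: measurable_pow_gamma.
  - by move=> z _; rewrite -EFinM lee_fin mulr_ge0 ?sqr_ge0.
  - by apply/measurable_EFinP; exact: measurable_indic.
  apply: ge0_le_integral => //.
  - by move=> z _; rewrite -EFinM -EFinD lee_fin addr_ge0 // mulr_ge0 ?sqr_ge0.
  - apply: emeasurable_funD; first by apply/measurable_EFinP; exact: measurable_indic.
    by apply: measurable_funeM; exact: measurable_pow_gamma.
  - exact: mE.
  - by move=> z _; rewrite indicT -EFinM -EFinD lee_fin; exact: low'.
congr EFin; apply/eqP; rewrite eq_le; apply/andP; split; rewrite leNgt; apply/negP => m1.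
  (* At s = 1 - t, [key] amounts to (1 - t) (2 - t) m <= 2; with 3 m t = m - 1 the left side is at
     least m + 1 > 2. *)
  pose t := (m - 1) / (3 * m); have mp : 0 < m by lra.
  have t0 : 0 < t by rewrite divr_gt0 // ?mulr_gt0 //; lra.
  have tm : 3 * m * t = m - 1 by rewrite /t; field; rewrite gt_eqF.
  have t1 : t < 1 by nra.
  have s0 : 0 < 1 - t by lra.
  have := key _ s0; rewrite -(ler_pM2l s0) mulrDr divff ?gt_eqF //; nra.
(* At s = 1 + t, [key] amounts to 2 <= (1 + t) (2 + t) m; with 4 t = 1 - m the right side is at most
   (3 - m) m < 2. *)
pose t := (1 - m) / 4; have t0 : 0 < t by rewrite /t; lra.
have s0 : 0 < 1 + t by lra.
have tm : 4 * t = 1 - m by rewrite /t; field.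
have t1 : t <= 1 by lra.
have := key _ s0; rewrite -(ler_pM2l s0) mulrDr divff ?gt_eqF // => H.
have : t * 2 <= t * ((1 + t) * (2 + t) * m) by lra.
rewrite ler_pM2l //; have : (1 + t) * (2 + t) * m <= (2 + 4 * t) * m.
  by apply: ler_wpM2r => //; nra.
by rewrite tm; nra.
Qed.

(** The limit variance may be 0, since the square root is continuous there; domination by 1 does the
    rest. *)
Lemma gamma_cos_cvg (v_ : nat -> R) (v t : R) : v_ k @[k --> \oo] --> v ->
  (\int[gamma]_z (cos (Num.sqrt (v_ k) * z + t))%:E @[k --> \oo] -->
   \int[gamma]_z (cos (Num.sqrt v * z + t))%:E)%E.
Proof.
move=> vv.
have mcos s : measurable_fun setT (fun z : R => (cos (s * z + t))%:E).
  apply/measurable_EFinP; apply: continuous_measurable_fun => z.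
  apply: (@continuous_comp _ _ _ (fun z : R => s * z + t) cos); last exact: continuous_cos.
  by apply: cvgD; [apply: cvgM; [exact: cvg_cst|exact: cvg_id]|exact: cvg_cst].
apply: (@dominated_cvg _ _ _ gamma setT measurableT
  (fun k z => (cos (Num.sqrt (v_ k) * z + t))%:E) _ (cst 1%E)) => //.
- by move=> k; exact: mcos.
- move=> z _; apply: cvg_EFin; first by apply: nearW.
  apply: (@continuous_cvg _ _ _ _ _ _ cos); first exact: continuous_cos.
  apply: cvgD; last exact: cvg_cst.
  apply: cvgM; last exact: cvg_cst.
  by apply: (@continuous_cvg _ _ _ _ _ _ Num.sqrt); first exact: sqrt_continuous.
- apply/integrableP; split => //.
  under eq_integral do rewrite /= normr1.
  by rewrite integral_cst // mul1e [X in (X < _)%E]gamma_setT ltry.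
- move=> k z _; rewrite lee_fin ler_norml.
  by apply/andP; split; [exact: cos_geN1|exact: cos_le1].
Qed.

End one_dimensional_normal.

(** * Multivariate normal laws *)

Notation linform c x := (fun_of_matrix (trmx c *m x)%R 0%R 0%R).
Notation qform c S := (fun_of_matrix (trmx c *m S *m c)%R 0%R 0%R).

Lemma linform_affine (R : realType) m q (c z : 'cV[R]_m) (F : 'M[R]_(m, q)) (y : 'cV[R]_q) :
  linform c (z + F *m y) = linform c z + linform (F^T *m c) y.
Proof. by rewrite mulmxDr [LHS]mxE trmx_mul trmxK mulmxA. Qed.

Section multivariate_normal.
Variable R : realType.
Notation gamma := (normal_prob (0 : R) 1).

Section linear_forms.
Variables (q : nat) (S : 'M[R]_q) (L : probability 'cV[R]_q R).
Hypothesis LS : is_mvnormal 0 S L.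

Lemma mvnormal_psd (c : 'cV[R]_q) : 0 <= qform c S.
Proof. by have [[_ +] _] := LS; exact. Qed.

Lemma mvnormal_linform (c : 'cV[R]_q) (A : set R) : measurable A ->
  L [set x | A (linform c x)] =
  gamma [set z | A (Num.sqrt (qform c S) * z)].
Proof.
move=> mA; have [_ ->] // := LS; rewrite mulmx0 mxE normal1E //.
exact: mvnormal_psd.
Qed.

Lemma measurable_scale (s : R) : measurable_fun setT (fun z : R => s * z).
Proof. exact: measurable_funM. Qed.

Lemma ge0_integral_mvnormal_linform (c : 'cV[R]_q) (g : R -> \bar R) :
  measurable_fun setT g -> (forall t, 0 <= g t)%E ->
  (\int[L]_x g (linform c x) =
   \int[gamma]_z g (Num.sqrt (qform c S) * z)%R)%E.
Proof.
move=> mg g0; have [M ME] := image_law L (measurable_linform c).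
rewrite -(ge0_integral_image_law (measurable_linform c) (fun A _ => ME A)) //.
apply: ge0_integral_image_law => //.
by move=> A mA; rewrite ME; exact: mvnormal_linform.
Qed.

Lemma integral_mvnormal_linform (c : 'cV[R]_q) (g : R -> \bar R) :
  measurable_fun setT g ->
  L.-integrable setT (fun x => g (linform c x)) ->
  gamma.-integrable setT (fun z => g (Num.sqrt (qform c S) * z)) ->
  (\int[L]_x g (linform c x) =
   \int[gamma]_z g (Num.sqrt (qform c S) * z)%R)%E.
Proof.
move=> mg g1 g2; have [M ME] := image_law L (measurable_linform c).
rewrite -(integral_image_law (measurable_linform c) (fun A _ => ME A)) //.
apply: integral_image_law => //.
by move=> A mA; rewrite ME; exact: mvnormal_linform.
Qed.

Lemma mvnormal_second (c : 'cV[R]_q) :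
  (\int[L]_x ((linform c x) ^+ 2)%:E = (qform c S)%:E)%E.
Proof.
rewrite (ge0_integral_mvnormal_linform c (g := fun t => (t ^+ 2)%:E)); first last.
- by move=> t; rewrite lee_fin sqr_ge0.
- exact: measurable_pow_gamma.
under eq_integral do rewrite exprMn EFinM sqr_sqrtr ?mvnormal_psd //.
rewrite ge0_integralZl //.
- by rewrite gamma_variance mule1.
- exact: measurable_pow_gamma.
- by move=> z _; rewrite lee_fin sqr_ge0.
- by rewrite lee_fin mvnormal_psd.
Qed.

Lemma mvnormal_fourth (c : 'cV[R]_q) :
  (\int[L]_x ((linform c x) ^+ 4)%:E =
   ((qform c S) ^+ 2)%:E * \int[gamma]_z (z ^+ 4)%:E)%E.
Proof.
rewrite (ge0_integral_mvnormal_linform c (g := fun t => (t ^+ 4)%:E)); first last.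
- by move=> t; rewrite lee_fin exprn_even_ge0.
- exact: measurable_pow_gamma.
under eq_integral do rewrite exprMn EFinM (exprM _ 2 2) sqr_sqrtr ?mvnormal_psd //.
rewrite ge0_integralZl //.
- exact: measurable_pow_gamma.
- by move=> z _; rewrite lee_fin exprn_even_ge0.
- by rewrite lee_fin sqr_ge0.
Qed.

Lemma measurable_linform_pow (c : 'cV[R]_q) k :
  measurable_fun setT (fun x : 'cV[R]_q => ((linform c x) ^+ k)%:E).
Proof.
by apply/measurable_EFinP; apply: measurable_funX; exact: measurable_linform.
Qed.

Lemma mvnormal_linform_integrable (c : 'cV[R]_q) k : (k <= 4)%N ->
  L.-integrable setT (fun x => ((linform c x) ^+ k)%:E).
Proof.
move=> k4; apply/integrableP; split; first exact: measurable_linform_pow.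
rewrite (ge0_integral_mvnormal_linform c (g := fun t => `|(t ^+ k)%:E|%E)) //; last first.
  by apply: measurableT_comp => //; exact: measurable_pow_gamma.
have /integrableP[_] := integrableZl measurableT
  (Num.sqrt (qform c S) ^+ k) (gamma_integrable R k4).
by under eq_integral do rewrite -EFinM -exprMn.
Qed.

Lemma mvnormal_first (c : 'cV[R]_q) : (\int[L]_x (linform c x)%:E = 0)%E.
Proof.
have i1 := gamma_integrable R (isT : (1 <= 4)%N).
rewrite (integral_mvnormal_linform (c := c) (g := EFin)) //.
- under eq_integral do rewrite EFinM.
  by rewrite integralZl // gamma_mean mule0.
- exact: (mvnormal_linform_integrable c (isT : (1 <= 4)%N)).
- exact: (integrableZl measurableT _ i1).
Qed.

End linear_forms.

Lemma psdmxD q (S T : 'M[R]_q) : psdmx S -> psdmx T -> psdmx (S + T).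
Proof.
move=> [S1 S2] [T1 T2]; split=> [|c]; first by rewrite linearD /= S1 T1.
by rewrite mulmxDr mulmxDl mxE addr_ge0.
Qed.

Lemma psdmx_conj m q (F : 'M[R]_(m, q)) (S : 'M[R]_q) : psdmx S -> psdmx (F *m S *m F^T).
Proof.
move=> [S1 S2]; split=> [|c]; first by rewrite !trmx_mul trmxK S1 mulmxA.
by have := S2 (F^T *m c); rewrite trmx_mul trmxK !mulmxA.
Qed.

(** A linear form of z + F y is the sum of a form in z and one in y, independent under the product
    law, so [gamma_convolution] applies. The matrix F allows the summands to live in different
    dimensions, as for the blocks of the stacked vector. *)
Lemma mvnormal_convolution m q (S1 : 'M[R]_m) (S2 : 'M[R]_q) (F : 'M[R]_(m, q))
    (L1 : probability 'cV[R]_m R) (L2 : probability 'cV[R]_q R) (L : probability 'cV[R]_m R) :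
  is_mvnormal 0 S1 L1 -> is_mvnormal 0 S2 L2 ->
  (forall A, measurable A ->
     L A = (L1 \x L2)%E ((fun zy : 'cV[R]_m * 'cV[R]_q => zy.1 + F *m zy.2) @^-1` A)) ->
  is_mvnormal 0 (S1 + F *m S2 *m F^T) L.
Proof.
move=> N1 N2 LE; have [P1 P2] := (N1.1, N2.1).
have PS : psdmx (S1 + F *m S2 *m F^T) by apply: psdmxD => //; exact: psdmx_conj.
split=> // c A mA; rewrite mulmx0 mxE normal1E //; last exact: PS.2.
pose u := F^T *m c.
have vE : (c^T *m (S1 + F *m S2 *m F^T) *m c) 0 0 =
    qform c S1 + qform u S2.
  by rewrite mulmxDr mulmxDl mxE /u trmx_mul trmxK !mulmxA.
have mcA : measurable [set x : 'cV[R]_m | A (linform c x)].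
  by rewrite -[X in measurable X]setTI; exact: (measurable_linform c measurableT).
rewrite LE // /product_measure1.
transitivity (\int[L1]_z gamma [set t | A (linform c z + Num.sqrt (qform u S2) * t)%R])%E.
  apply: eq_integral => z _ /=.
  pose B := [set t | A (linform c z + t)].
  have mB : measurable B.
    by rewrite -[X in measurable X]setTI; apply: (measurable_funD (measurable_cst _) (@measurable_id _ _ _)).
  rewrite -(mvnormal_linform N2 u mB); congr (L2 _).
  apply/seteqP; split=> y; by rewrite /xsection /= inE /= /B /= linform_affine.
set b := Num.sqrt (qform u S2).
have mg : measurable_fun setT (fun s : R => gamma [set t | A (s + b * t)%R]).
  pose C := (fun su : R * R => su.1 + b * su.2) @^-1` A.
  rewrite (_ : (fun s => _) = gamma \o xsection C); last first.
    by apply/funext => s /=; congr (normal_prob _ _ _); apply/seteqP; split=> t;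
       rewrite /xsection /= inE.
  apply: measurable_fun_xsection; rewrite -[X in measurable X]setTI.
  by apply: (measurable_funD _ (measurable_funM _ _)).
apply: (eq_trans (ge0_integral_mvnormal_linform N1 c mg _)) => //.
apply: (eq_trans (gamma_convolution (sqrtr_ge0 _) (sqrtr_ge0 _) mA)).
by rewrite !sqr_sqrtr ?(mvnormal_psd N1) ?(mvnormal_psd N2) // vE.
Qed.

End multivariate_normal.

(** * Existence of normal laws with possibly singular covariance *)

Section existence_of_normal_laws.
Variable R : realType.
Notation gamma := (normal_prob (0 : R) 1).

Lemma linform_delta q (j : 'I_q) (x : 'cV[R]_q) : linform (delta_mx j 0 : 'cV[R]_q) x = x j 0.
Proof. by rewrite trmx_delta -rowE mxE. Qed.

Lemma qform_delta q (j : 'I_q) (S : 'M[R]_q) : qform (delta_mx j 0 : 'cV[R]_q) S = S j j.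
Proof. by rewrite trmx_delta -rowE -colE !mxE. Qed.

Lemma qformD q (S : 'M[R]_q) (x y : 'cV[R]_q) (t : R) : S^T = S ->
  qform (x + t *: y) S = qform x S + 2 * t * linform x (S *m y) + t ^+ 2 * qform y S.
Proof.
move=> St.
have yx : linform y (S *m x) = linform x (S *m y).
  have <- : (y^T *m (S *m x))^T = x^T *m (S *m y) by rewrite !trmx_mul trmxK St mulmxA.
  by rewrite [RHS]mxE.
have -> : (x + t *: y)^T = x^T + t *: y^T by rewrite linearD linearZ.
rewrite !mulmxDl !mulmxDr -!scalemxAl -!scalemxAr -!mulmxA.
set X := x^T *m (S *m x); set Y := y^T *m (S *m y).
set Z := x^T *m (S *m y) in yx *; set W := y^T *m (S *m x) in yx *.
by clearbody X Y Z W; rewrite !mxE yx; ring.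
Qed.

Lemma qformB_rank1 q (S : 'M[R]_q) (c u : 'cV[R]_q) (k : R) :
  qform c (S - k *: (u *m u^T)) = qform c S - k * linform c u ^+ 2.
Proof.
rewrite mulmxBr mulmxBl -scalemxAr -scalemxAl.
have -> : c^T *m (u *m u^T) *m c = (c^T *m u) *m (c^T *m u)^T.
  by rewrite trmx_mul trmxK !mulmxA.
move: (c^T *m u) (c^T *m S *m c) => U X.
by rewrite !mxE big_ord1 mxE expr2.
Qed.

Lemma psdmx_diag0 q (S : 'M[R]_q) (i j : 'I_q) : psdmx S -> S j j = 0 -> S i j = 0.
Proof.
move=> [St S0] Sjj; apply/eqP; apply: contraT => Sij.
(* If S i j were nonzero, the quadratic form would equal -1 at this vector. *)
have := S0 (delta_mx i 0 + (- (S i i + 1) / (2 * S i j)) *: delta_mx j 0).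
rewrite qformD // !qform_delta Sjj linform_delta -colE mxE mulr0 addr0.
have -> : S i i + 2 * (- (S i i + 1) / (2 * S i j)) * S i j = - 1 by field.
by rewrite ler0N1.
Qed.

(* Removing this rank one matrix clears row and column j, so that a normal law
   with covariance S is built from one with fewer nonzero variances. *)
Lemma psdmx_peel q (S : 'M[R]_q) (j : 'I_q) : psdmx S -> S j j != 0 ->
  psdmx (S - (S j j)^-1 *: (col j S *m (col j S)^T)).
Proof.
move=> [St S0] Sjj; split=> [|c].
  by rewrite linearB linearZ /= trmx_mul trmxK St.
(* This coefficient minimizes the quadratic form along the line c + t e_j, and the minimum is the
   form of the peeled matrix at c. *)
have := S0 (c + (- (linform c (col j S) / S j j)) *: delta_mx j 0).
rewrite qformD // qform_delta -colE; set b := linform c (col j S).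
suff -> : qform c (S - (S j j)^-1 *: (col j S *m (col j S)^T)) =
    qform c S + 2 * - (b / S j j) * b + (- (b / S j j)) ^+ 2 * S j j by [].
by rewrite qformB_rank1 -/b; field.
Qed.

Lemma mvnormal_dirac0 q : is_mvnormal 0 0 (dirac (0 : 'cV[R]_q) : probability _ R).
Proof.
split=> [|c A mA]; first by split=> [|c]; rewrite ?trmx0 // mulmx0 mul0mx mxE.
rewrite !mulmx0 mul0mx !mxE /normal1 eqxx !diracE; congr ((nat_of_bool _)%:R%:E).
by apply/idP/idP; rewrite !inE /= mulmx0 mxE.
Qed.

Lemma mvnormal_standard1 : exists L : probability 'cV[R]_1 R, is_mvnormal 0 1%:M L.
Proof.
have mf : measurable_fun setT (fun t : R => t%:M : 'cV[R]_1).
  apply: measurable_fun_vector => j; rewrite ord1; under eq_fun do rewrite mxE eqxx mulr1n.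
  exact: measurable_id.
have [L LE] := image_law (gamma : probability _ R) mf; exists L; split.
  split=> [|c]; first by rewrite trmx1.
  by rewrite mulmx1 mxE big_ord1 mxE -expr2 sqr_ge0.
move=> c A mA; rewrite LE mulmx0 mulmx1 mxE.
have -> : (c^T *m c) 0 0 = c 0 0 ^+ 2 by rewrite mxE big_ord1 mxE expr2.
rewrite normal1E ?sqr_ge0 // sqrtr_sqr.
have cE (t : R) : linform c (t%:M) = c 0 0 * t.
  by rewrite mul_mx_scalar !mxE mulrC.
have [c0|c0] := leP 0 (c 0 0).
  rewrite ger0_norm //; apply: (congr1 gamma).
  by apply/seteqP; split=> t /=; rewrite cE.
rewrite ltr0_norm // -[RHS]gamma_opp; last exact: measurable_preimage_scale.
apply: (congr1 gamma).
by apply/seteqP; split=> t /=; rewrite cE mulNr mulrN opprK.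
Qed.

Lemma mvnormal_exists q (S : 'M[R]_q) : psdmx S ->
  exists L : probability 'cV[R]_q R, is_mvnormal 0 S L.
Proof.
have [n] := ubnP #|[pred j | S j j != 0]|.
elim: n S => // n IH S; rewrite ltnS => Sn PS.
have [j Sj|/= Sall] := pickP (fun j => S j j != 0); last first.
  exists (dirac (0 : 'cV[R]_q) : probability _ R).
  rewrite (_ : S = 0); first exact: mvnormal_dirac0.
  by apply/matrixP => i j; rewrite mxE (psdmx_diag0 i PS) //; apply/eqP; move/negbFE: (Sall j).
have PS' := psdmx_peel PS Sj; set S' := S - _ in PS'.
have [L' NL'] : exists L : probability 'cV[R]_q R, is_mvnormal 0 S' L.
  apply: IH => //; apply: leq_trans Sn; apply: proper_card; apply/properP; split.
    apply/fintype.subsetP => i; rewrite !inE; apply: contra => /eqP Sii.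
    have Sij : S i j = 0.
      by have /matrixP/(_ i j) := PS.1; rewrite mxE => <-; exact: psdmx_diag0.
    by rewrite !mxE big_ord1 !mxE Sii Sij !(mul0r, mulr0) subr0.
  exists j; rewrite inE //= negbK.
  by rewrite !mxE big_ord1 !mxE mulrA mulVf // mul1r subrr.
have [L1 NL1] := mvnormal_standard1.
(* The image of a standard normal variable under F has as covariance exactly the rank one matrix
   that was removed. *)
pose F : 'M[R]_(q, 1) := (Num.sqrt (S j j))^-1 *: col j S.
have [L LE] := image_law (L' \x L1 : probability _ R)%E (measurable_add_mulmx F).
exists L; have -> : S = S' + F *m 1%:M *m F^T.
  rewrite mulmx1 /F linearZ /= -scalemxAl -scalemxAr scalerA -invfM -expr2 sqr_sqrtr ?subrK //.
  by have := PS.2 (delta_mx j 0); rewrite qform_delta.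
by apply: (mvnormal_convolution NL' NL1) => A _; exact: LE.
Qed.

End existence_of_normal_laws.

(** * Weak convergence of normal laws *)

Lemma bounded_integrable d (T : measurableType d) (R : realType) (P : probability T R)
    (f : T -> R) (C : R) :
  measurable_fun setT f -> (forall x, `|f x| <= C) -> P.-integrable setT (EFin \o f).
Proof.
move=> mf fC; apply: measurable_bounded_integrable => //.
  by rewrite [X in (X < _)%E]probability_setT ltry.
by exists C; split=> [|M CM x _]; [exact: num_real|exact: le_trans (fC x) (ltW CM)].
Qed.

Section weak_convergence_of_normal_laws.
Variable R : realType.
Notation gamma := (normal_prob (0 : R) 1).

Lemma coord_cvg m n (T : Type) (F : set_system T) {FF : Filter F} (A_ : T -> 'M[R]_(m, n)) (A : 'M[R]_(m, n)) i j :
  A_ k @[k --> F] --> A -> A_ k i j @[k --> F] --> A i j.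
Proof.
by move=> AA; apply: (@cvg_comp _ _ _ A_ (fun B : 'M[R]_(m, n) => B i j) _ (nbhs A)) => //;
  exact: coord_continuous.
Qed.

Lemma mx_cvg m n (T : Type) (F : set_system T) {FF : Filter F} (A_ : T -> 'M[R]_(m, n)) (A : 'M[R]_(m, n)) :
  (forall i j, A_ k i j @[k --> F] --> A i j) -> A_ k @[k --> F] --> A.
Proof.
move=> AA B [P HP sPB].
have : \forall k \near F, forall ij : 'I_m * 'I_n, P ij.1 ij.2 (A_ k ij.1 ij.2).
  by apply: filter_forall => -[i j] /=; exact: (AA i j _ (HP i j)).
by apply: filterS => k Hk; apply: sPB => i j; exact: (Hk (i, j)).
Qed.

Lemma mulmx_cvg m n p (T : Type) (F : set_system T) {FF : Filter F}
    (A_ : T -> 'M[R]_(m, n)) (B_ : T -> 'M[R]_(n, p)) (A : 'M[R]_(m, n))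
    (B : 'M[R]_(n, p)) :
  A_ k @[k --> F] --> A -> B_ k @[k --> F] --> B ->
  A_ k *m B_ k @[k --> F] --> A *m B.
Proof.
move=> AA BB; apply: mx_cvg => i j; rewrite mxE; under eq_fun do rewrite mxE.
by apply: (@cvg_bigsum R R) => l; apply: cvgM; exact: coord_cvg.
Qed.

Lemma qform_cvg q (T_ : nat -> 'M[R]_q) (S : 'M[R]_q) (c : 'cV[R]_q) :
  T_ k @[k --> \oo] --> S -> qform c (T_ k) @[k --> \oo] --> qform c S.
Proof.
move=> TS; apply: coord_cvg; apply: mulmx_cvg; last exact: cvg_cst.
by apply: mulmx_cvg => //; exact: cvg_cst.
Qed.

Lemma trig_measurable q (p : 'cV[R]_q -> R) : trig p -> measurable_fun setT p.
Proof. by move=> tp; apply: continuous_measurable_fun_vector; exact: trig_continuous. Qed.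

Lemma trig_integrable q (L : probability 'cV[R]_q R) (p : 'cV[R]_q -> R) :
  trig p -> L.-integrable setT (EFin \o p).
Proof.
move=> tp; have [M _ pM] := trig_bounded tp.
by apply: bounded_integrable pM; exact: trig_measurable.
Qed.

Lemma mvnormal_trig_cvg q (T_ : nat -> 'M[R]_q) (S : 'M[R]_q)
    (L_ : nat -> probability 'cV[R]_q R) (L : probability 'cV[R]_q R) (p : 'cV[R]_q -> R) :
  (forall k, is_mvnormal 0 (T_ k) (L_ k)) -> is_mvnormal 0 S L ->
  T_ k @[k --> \oo] --> S -> trig p ->
  \int[L_ k]_x p x @[k --> \oo] --> \int[L]_x p x.
Proof.
move=> NL_ NL TS; elim => {p} [c t|a b p r tp IHp tr IHr]; last first.
  have E (M : probability 'cV[R]_q R) : \int[M]_x (a * p x + b * r x) =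
      a * \int[M]_x p x + b * \int[M]_x r x.
    have iZ k s : trig s -> M.-integrable setT (EFin \o (fun x => k * s x)).
      move=> ts; apply: trig_integrable.
      by apply: (trig_ext _ (trig_lin k 0 ts ts)) => x; rewrite mul0r addr0.
    by rewrite RintegralD ?RintegralZl //; [exact: trig_integrable|exact: trig_integrable|
      exact: iZ|exact: iZ].
  rewrite E; under eq_fun do rewrite E.
  by apply: cvgD; apply: cvgM => //; exact: cvg_cst.
have mcos : measurable_fun setT (fun u : R => (cos (u + t))%:E).
  apply/measurable_EFinP; apply: continuous_measurable_fun => z.
  apply: (@continuous_comp _ _ _ (fun z : R => z + t) cos); last exact: continuous_cos.
  by apply: cvgD; [exact: cvg_id|exact: cvg_cst].
have icos s : gamma.-integrable setT (fun z => (cos (s * z + t))%:E).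
  apply: (@bounded_integrable _ _ R (gamma : probability _ R) (fun z : R => cos (s * z + t)) 1).
    apply/measurable_EFinP; apply: (measurableT_comp mcos); exact: measurable_scale.
  by move=> z; rewrite ler_norml; apply/andP; split; [exact: cos_geN1|exact: cos_le1].
have E (M : probability 'cV[R]_q R) U : is_mvnormal 0 U M ->
    \int[M]_x cos (linform c x + t) = fine (\int[gamma]_z (cos (Num.sqrt (qform c U) * z + t))%:E)%E.
  move=> NM; rewrite /Rintegral; congr fine.
  apply: (integral_mvnormal_linform NM (g := fun u => (cos (u + t))%:E)) => //.
  exact: (trig_integrable M (trig_cos c t)).
rewrite (E _ _ NL); under eq_fun do rewrite (E _ _ (NL_ _)).
apply: fine_cvg; rewrite fineK; last exact: integrable_fin_num.
by apply: gamma_cos_cvg; exact: qform_cvg.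
Qed.

(* Outside the box of radius K, Chebyshev's inequality bounds the error. *)
Lemma mvnormal_approx q (S : 'M[R]_q) (L : probability 'cV[R]_q R) (f p : 'cV[R]_q -> R)
    (C K e : R) :
  is_mvnormal 0 S L -> 0 < K -> 0 <= C -> 0 < e -> continuous f -> trig p ->
  (forall x, `|f x| <= C) -> (forall x, `|p x| <= C + e) ->
  (forall x : 'cV[R]_q, (forall j, `|x j 0| <= K) -> `|p x - f x| <= e) ->
  `| \int[L]_x p x - \int[L]_x f x| <= e + (2 * C + e) / K ^+ 2 * \tr S.
Proof.
move=> NL K0 C0 e0 cf tp fC pC pf.
have fi : L.-integrable setT (EFin \o f).
  by apply: bounded_integrable fC; exact: continuous_measurable_fun_vector.
have pi := trig_integrable L tp.
have K2 : 0 < K ^+ 2 by rewrite exprn_gt0.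
have x2i j : L.-integrable setT (fun x : 'cV[R]_q => (x j 0 ^+ 2)%:E).
  have := mvnormal_linform_integrable NL (delta_mx j 0) (isT : (2 <= 4)%N).
  by congr (_.-integrable _ _); apply/funext => x; rewrite linform_delta.
have si : L.-integrable setT (EFin \o (fun x : 'cV[R]_q => \sum_j x j 0 ^+ 2)).
  rewrite (_ : _ \o _ = fun x : 'cV[R]_q => \sum_(j < q) (x j 0 ^+ 2)%:E)%E; last first.
    by apply/funext => x; rewrite /= sumEFin.
  by apply: integrable_sum.
rewrite -RintegralB //; apply: le_trans (le_normr_Rintegral _ _) _ => //.
  exact: (integrableB measurableT pi fi).
apply: (@le_trans _ _ (\int[L]_x (e + (2 * C + e) / K ^+ 2 * \sum_j x j 0 ^+ 2))).
  apply: le_Rintegral => //.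
  - by apply: integrable_norm; exact: (integrableB measurableT pi fi).
  - have := integrableD measurableT (finite_measure_integrable_cst L e measurableT)
      (integrableZl measurableT ((2 * C + e) / K ^+ 2) si).
    by congr (_.-integrable _ _); apply/funext => x; rewrite /= EFinD EFinM.
  - move=> x _; have s0 : 0 <= \sum_j x j 0 ^+ 2 by apply: sumr_ge0 => j _; exact: sqr_ge0.
    have k0 : 0 <= (2 * C + e) / K ^+ 2 by rewrite divr_ge0 //; lra.
    have [H|] := pselect (forall j, `|x j 0| <= K).
      by apply: le_trans (pf x H) _; rewrite lerDl mulr_ge0.
    move=> /existsNP[j /negP]; rewrite -ltNge => Kx.
    apply: (@le_trans _ _ (2 * C + e)).
      apply: le_trans (ler_normB _ _) _; have := fC x; have := pC x; lra.
    apply: (@le_trans _ _ ((2 * C + e) / K ^+ 2 * \sum_j x j 0 ^+ 2)); last by rewrite lerDr ltW.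
    rewrite mulrAC ler_pdivlMr //; apply: ler_wpM2l; first lra.
    rewrite (bigD1 j) //=; apply: (@le_trans _ _ (x j 0 ^+ 2)).
      by rewrite -[x j 0 ^+ 2]real_normK ?num_real // lerXn2r ?nnegrE // ltW.
    by rewrite lerDl; apply: sumr_ge0 => i _; exact: sqr_ge0.
rewrite RintegralD //; first last.
- exact: (integrableZl measurableT _ si).
- exact: finite_measure_integrable_cst.
rewrite Rintegral_cst // [X in fine X]probability_setT mulr1 RintegralZl // lerD2l.
apply: ler_wpM2l; first by rewrite divr_ge0 //; lra.
rewrite /Rintegral (_ : (\int[L]_x _)%E = (\tr S)%:E) //.
under eq_integral do rewrite -sumEFin.
rewrite integral_sum // /mxtrace -sumEFin; apply: eq_bigr => j _.
have := mvnormal_second NL (delta_mx j 0); rewrite qform_delta => <-.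
by apply: eq_integral => x _; rewrite linform_delta.
Qed.

Lemma mvnormal_weak_cvg q (T_ : nat -> 'M[R]_q) (S : 'M[R]_q)
    (L_ : nat -> probability 'cV[R]_q R) (L : probability 'cV[R]_q R) :
  (forall k, is_mvnormal 0 (T_ k) (L_ k)) -> is_mvnormal 0 S L ->
  T_ k @[k --> \oo] --> S -> weak_cvg L_ L.
Proof.
move=> NL_ NL TS f cf [C0 fC0].
pose C := `|C0|; have C_ge0 : 0 <= C by exact: normr_ge0.
have fC x : `|f x| <= C by apply: le_trans (fC0 x) (ler_norm _).
have fi (M : probability 'cV[R]_q R) : M.-integrable setT (EFin \o f).
  by apply: bounded_integrable fC; exact: continuous_measurable_fun_vector.
suff H : \int[L_ k]_x f x @[k --> \oo] --> \int[L]_x f x.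
  have E (M : probability 'cV[R]_q R) : (\int[M]_x (f x)%:E)%E = (\int[M]_x f x)%:E.
    by rewrite /Rintegral fineK //; apply: integrable_fin_num => //; exact: fi.
  rewrite E; under eq_fun do rewrite E.
  by apply: cvg_EFin; [exact: nearW|exact: H].
have trS : 0 <= \tr S by apply: sumr_ge0 => j _; rewrite -qform_delta (mvnormal_psd NL).
(* Five errors of size h: two for replacing f by p under L, two under L_ k, and one for the
   convergence of the integrals of p. *)
apply/cvgrPdist_le => e e0; pose h := e / 5.
have h0 : 0 < h by rewrite divr_gt0.
(* With K^2 = D the Chebyshev term is at most h for every covariance of trace at most \tr S + 1, so
   one box serves for all large k. *)
pose D := (2 * C + h) * (\tr S + 1) / h.
have D0 : 0 < D by rewrite divr_gt0 // mulr_gt0; lra.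
pose K := Num.sqrt D; have K0 : 0 < K by rewrite sqrtr_gt0.
have K2 : K ^+ 2 = D by rewrite sqr_sqrtr // ltW.
have [p tp [pC pf]] := trig_approx cf fC (ltW K0) h0.
have near_h (M : probability 'cV[R]_q R) U : is_mvnormal 0 U M -> \tr U <= \tr S + 1 ->
    `| \int[M]_x p x - \int[M]_x f x| <= h + h.
  move=> NM trU; apply: le_trans (mvnormal_approx NM K0 C_ge0 h0 cf tp fC pC pf) _.
  rewrite lerD2l K2 /D.
  have -> : (2 * C + h) / ((2 * C + h) * (\tr S + 1) / h) = h / (\tr S + 1).
    by field; rewrite !gt_eqF //; lra.
  rewrite mulrAC ler_pdivrMr; last by lra.
  by rewrite ler_pM2l.
have trT : \forall k \near \oo, \tr (T_ k) <= \tr S + 1.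
  have : \tr (T_ k) @[k --> \oo] --> \tr S.
    rewrite /mxtrace; apply: (@cvg_bigsum R R) => j; exact: coord_cvg.
  move=> /cvgrPdist_le/(_ 1 ltr01); apply: filterS => k.
  by rewrite ler_norml => /andP[? _]; lra.
have /cvgrPdist_le/(_ h h0) pcvg := mvnormal_trig_cvg NL_ NL TS tp.
near=> k.
have A1 : `| \int[L]_x p x - \int[L]_x f x| <= h + h.
  by apply: near_h NL _; rewrite lerDl.
have A2 : `| \int[L_ k]_x p x - \int[L_ k]_x f x| <= h + h.
  by apply: near_h (NL_ k) _; near: k.
have A3 : `| \int[L]_x p x - \int[L_ k]_x p x| <= h by near: k.
move: A1 A2 A3; rewrite !ler_norml => /andP[? ?] /andP[? ?] /andP[? ?].
by apply/andP; split; rewrite (_ : e = 5 * h); [lra| |lra|]; rewrite /h; field.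
Unshelve. all: by end_near. Qed.

End weak_convergence_of_normal_laws.

(** * Continuity of Upsilon and convergence in probability *)

Section upsilon_continuity.
Variable R : realType.
Context (T : Type) (F : set_system T) {FF : Filter F}.

Lemma scalemx_cvg m n (t_ : T -> R) (t : R) (A_ : T -> 'M[R]_(m, n)) (A : 'M[R]_(m, n)) :
  t_ k @[k --> F] --> t -> A_ k @[k --> F] --> A -> t_ k *: A_ k @[k --> F] --> t *: A.
Proof.
move=> tt AA; apply: mx_cvg => i j; rewrite mxE; under eq_fun do rewrite mxE.
by apply: cvgM => //; exact: coord_cvg.
Qed.

Lemma trmx_cvg m n (A_ : T -> 'M[R]_(m, n)) (A : 'M[R]_(m, n)) :
  A_ k @[k --> F] --> A -> (A_ k)^T @[k --> F] --> A^T.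
Proof.
by move=> AA; apply: mx_cvg => i j; rewrite mxE; under eq_fun do rewrite mxE; exact: coord_cvg.
Qed.

Lemma diag_mx_cvg n (A_ : T -> 'rV[R]_n) (A : 'rV[R]_n) :
  (forall j, A_ k 0 j @[k --> F] --> A 0 j) -> diag_mx (A_ k) @[k --> F] --> diag_mx A.
Proof.
move=> AA; apply: mx_cvg => i j; rewrite mxE; under eq_fun do rewrite mxE.
by case: (i == j) => /=; [exact: AA|exact: cvg_cst].
Qed.

(** A coordinate of [vech] or [vechm] is either the same entry of every matrix or constantly the
    default 0. Continuity is clear in both cases, without computing the length of the list of
    positions. *)
Lemma nth_map_dichotomy d (s : seq ('I_d * 'I_d)) (l : nat) :
  (exists jk : 'I_d * 'I_d, forall A : 'M[R]_d, nth 0 [seq A x.1 x.2 | x <- s] l = A jk.1 jk.2) \/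
  (forall A : 'M[R]_d, nth 0 [seq A x.1 x.2 | x <- s] l = 0).
Proof.
case: s => [|x0 s]; first by right=> A; rewrite nth_nil.
have [ls|ls] := ltnP l (size (x0 :: s)).
  by left; exists (nth x0 (x0 :: s) l) => A; rewrite (nth_map x0).
by right=> A; rewrite nth_default ?size_map.
Qed.

Lemma vech_dichotomy d (l : 'I_(dimp d)) :
  (exists jk : 'I_d * 'I_d, forall A : 'M[R]_d, vech A l 0 = A jk.1 jk.2) \/
  (forall A : 'M[R]_d, vech A l 0 = 0).
Proof.
have [[jk H]|H] := nth_map_dichotomy [seq jk : 'I_d * 'I_d <- index_pairs d | (jk.1 <= jk.2)%N] l.
  by left; exists jk => A; rewrite mxE.
by right=> A; rewrite mxE.
Qed.

Lemma vechm_cvg d (A_ : T -> 'M[R]_d) (A : 'M[R]_d) :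
  A_ k @[k --> F] --> A -> vechm (A_ k) @[k --> F] --> vechm A.
Proof.
move=> AA; apply: mx_cvg => l j; rewrite mxE; under eq_fun do rewrite mxE.
have [[jk H]|H] := nth_map_dichotomy [seq jk : 'I_d * 'I_d <- index_pairs d | (jk.1 < jk.2)%N] l.
  by rewrite H; under eq_fun do rewrite H; exact: coord_cvg.
by rewrite H; under eq_fun do rewrite H; exact: cvg_cst.
Qed.

Lemma rsqrt_cvg (x_ : T -> R) (x : R) : 0 < x -> x_ k @[k --> F] --> x ->
  (Num.sqrt (x_ k))^-1 @[k --> F] --> (Num.sqrt x)^-1.
Proof.
move=> x0 xx; apply: cvgV; first by rewrite gt_eqF // sqrtr_gt0.
by apply: continuous_cvg => //; exact: sqrt_continuous.
Qed.

Lemma diag_col_cvg d (V_ : T -> 'M[R]_d) (V : 'M[R]_d) :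
  V_ k @[k --> F] --> V -> diag_col (V_ k) @[k --> F] --> diag_col V.
Proof.
by move=> VV; apply: mx_cvg => i j; rewrite mxE; under eq_fun do rewrite mxE; exact: coord_cvg.
Qed.

(** Positive limit variances keep the inverse square roots away from 0; the other operations in
    Upsilon are sums and products of entries. *)
Lemma Upsilon_cvg d (V_ : T -> 'M[R]_d) (V : 'M[R]_d)
    (S_ : T -> 'M[R]_(dimp d)) (S : 'M[R]_(dimp d)) :
  (forall j, 0 < V j j) -> V_ k @[k --> F] --> V -> S_ k @[k --> F] --> S ->
  Upsilon (V_ k) (S_ k) @[k --> F] --> Upsilon V S.
Proof.
move=> V0 VV SS.
have dV := diag_col_cvg VV.
have dr : diag_rsqrt (diag_col (V_ k)) @[k --> F] --> diag_rsqrt (diag_col V).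
  apply: diag_mx_cvg => j; rewrite !mxE; under eq_fun do rewrite !mxE.
  by apply: rsqrt_cvg => //; exact: coord_cvg.
have rr : vechm (corrmx (V_ k)) @[k --> F] --> vechm (corrmx V).
  by apply: vechm_cvg; apply: mulmx_cvg => //; exact: mulmx_cvg.
have MM : Mmx (V_ k) (vechm (corrmx (V_ k))) @[k --> F] --> Mmx V (vechm (corrmx V)).
  apply: mulmx_cvg.
    apply: cvgB; first exact: cvg_cst.
    apply: scalemx_cvg; first exact: cvg_cst.
    apply: mulmx_cvg; last exact: cvg_cst.
    apply: diag_mx_cvg => j; rewrite mxE; under eq_fun do rewrite mxE.
    exact: coord_cvg.
  apply: diag_mx_cvg => l; rewrite mxE; under eq_fun do rewrite mxE.
  have [[[i j] H]|H] := vech_dichotomy l; last first.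
    by rewrite H; under eq_fun do rewrite H; exact: cvg_cst.
  rewrite H; under eq_fun do rewrite H.
  apply: rsqrt_cvg; first by rewrite mxE big_ord1 !mxE mulr_gt0.
  by apply: coord_cvg; apply: mulmx_cvg => //; exact: trmx_cvg.
by apply: mulmx_cvg; [exact: mulmx_cvg|exact: trmx_cvg].
Qed.

End upsilon_continuity.

(** * Stacked vectors and direct sums through block embeddings *)

Section block_embeddings.
Variables (R : realType) (a q : nat).

(** The embedding of the i-th summand. It turns the stacked mean into a sum of linear images of the
    group means and the direct sum into a sum of conjugated blocks, the form in which conditional
    normality is proved. *)
Definition block_embed (i : 'I_a) : 'M[R]_(\sum_(j < a) q, q) :=
  \mxcol_(j < a) ((j == i)%:R%:M : 'M[R]_q).

Lemma mxcol_embed (v : 'I_a -> 'cV[R]_q) :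
  \mxcol_(i < a) v i = \sum_(i < a) block_embed i *m v i.
Proof.
under [RHS]eq_bigr do rewrite mxcol_mul.
rewrite -mxcol_sum; apply/eq_mxcolP => j; rewrite (bigD1 j) //= eqxx mul1mx big1 ?addr0 // => i ij.
by rewrite eq_sym (negbTE ij) mul_scalar_mx scale0r.
Qed.

Lemma mxdiag_embed (B : 'I_a -> 'M[R]_q) :
  \mxdiag_(i < a) B i = \sum_(i < a) block_embed i *m B i *m (block_embed i)^T.
Proof.
under [RHS]eq_bigr do rewrite mxcol_mul tr_mxcol mul_mxcol_mxrow.
rewrite -mxblock_sum /mxdiag; apply/eq_mxblockP => j k.
rewrite (bigD1 j) //= eqxx mul1mx big1 ?addr0 => [|i ij]; last first.
  by rewrite eq_sym (negbTE ij) mul_scalar_mx scale0r mul0mx.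
rewrite tr_scalar_mx [k == j]eq_sym; case: (eqVneq j k) => [_|_] /=; last by rewrite mul_mx_scalar scale0r.
by rewrite conform_mx_id mulmx1.
Qed.

Lemma mxdiag_cvg (T : Type) (F : set_system T) {FF : Filter F}
    (B_ : 'I_a -> T -> 'M[R]_q) (B : 'I_a -> 'M[R]_q) :
  (forall i, B_ i k @[k --> F] --> B i) ->
  \mxdiag_(i < a) B_ i k @[k --> F] --> \mxdiag_(i < a) B i.
Proof.
move=> BB; rewrite mxdiag_embed.
rewrite [X in X @ _](_ : _ = fun k => \sum_(i < a) block_embed i *m B_ i k *m (block_embed i)^T);
  last by apply/funext => k; rewrite mxdiag_embed.
apply: cvg_bigsum => i; apply: mulmx_cvg; last exact: cvg_cst.
by apply: mulmx_cvg => //; exact: cvg_cst.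
Qed.

End block_embeddings.

(** * Convergence in probability as convergence along a filter *)

Section convergence_in_probability.
Context d (Omega : measurableType d) (R : realType) (P : probability Omega R).

(* Convergence in probability is convergence along this filter. *)
Definition prob_filter : set_system (nat * Omega) :=
  [set A | mu_ext P [set w | ~ A (nu, w)] @[nu --> \oo] --> 0%E].

Lemma mu_ext_cvg0_le (A B : nat -> set Omega) :
  (\forall nu \near \oo, A nu `<=` B nu) ->
  mu_ext P (B nu) @[nu --> \oo] --> 0%E -> mu_ext P (A nu) @[nu --> \oo] --> 0%E.
Proof.
move=> AB B0; apply: (@squeeze_cvge _ _ _ _ (fun=> 0%E) _ (fun nu => mu_ext P (B nu))) => //.
  apply: filterS AB => nu AB; rewrite mu_ext_ge0 //=; exact: le_mu_ext.
exact: cvg_cst.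
Qed.

(** With the outer measure no set has to be measurable: subadditivity gives intersections,
    monotonicity gives supersets, and the total mass 1 gives properness. *)
Lemma prob_filter_proper : ProperFilter prob_filter.
Proof.
apply: Build_ProperFilter_ex => [A FA|].
  apply: contrapT => /forallNP A0.
  have : mu_ext P [set w | ~ A (nu, w)] @[nu --> \oo] --> 1%E.
    rewrite (_ : (fun nu => _) = fun=> 1%E); first exact: cvg_cst.
    apply/funext => nu; rewrite (_ : [set w | _] = setT).
      by rewrite measurable_mu_extE // [LHS]probability_setT.
    by apply/seteqP; split=> // w _; exact: A0.
  move=> /(cvg_unique _ FA) => /(_ (@ereal_hausdorff R)) /eqP.
  by rewrite eqe eq_sym oner_eq0.
split.
- rewrite /prob_filter /= (_ : (fun nu => _) = fun=> 0%E); first exact: cvg_cst.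
  apply/funext => nu; rewrite (_ : [set w | _] = set0) ?mu_ext0 //.
  by apply/seteqP; split=> // w /= H; exact: H.
- move=> A B A0 B0; rewrite /prob_filter /=.
  have AB0 : (mu_ext P [set w | ~ A (nu, w)] + mu_ext P [set w | ~ B (nu, w)])%E
      @[nu --> \oo] --> 0%E.
    by rewrite -[X in _ --> X]adde0; apply: cvgeD.
  apply: squeeze_cvge (cvg_cst 0%E) AB0.
  apply: nearW => nu; rewrite mu_ext_ge0 //=.
  apply: le_trans (outer_measureU2 _ _ _).
  by apply: le_mu_ext => w /= /not_andP.
- move=> A B AB; apply: mu_ext_cvg0_le; apply: nearW => nu w /=.
  by move=> nB /AB.
Qed.

#[global] Existing Instance prob_filter_proper.

Lemma cvg_in_probE (V : normedModType R) (Z : nat -> Omega -> V) (z : V) :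
  cvg_in_prob P Z z <-> Z p.1 p.2 @[p --> prob_filter] --> z.
Proof.
split=> [H|/cvgrPdist_lt H e e0].
  apply/cvgrPdist_lt => e e0; rewrite /prob_filter /nbhs /=.
  apply: mu_ext_cvg0_le (H e e0); apply: nearW => nu w /=.
  by move=> /negP; rewrite -leNgt distrC.
apply: mu_ext_cvg0_le (H e e0); apply: nearW => nu w /= ez.
by rewrite distrC; apply/negP; rewrite -leNgt.
Qed.

Lemma cvg_deterministic (V : topologicalType) (z_ : nat -> V) (z : V) :
  z_ nu @[nu --> \oo] --> z -> z_ p.1 @[p --> prob_filter] --> z.
Proof.
move=> zz U /zz Uz; rewrite /nbhs /= /prob_filter /=.
apply: (@mu_ext_cvg0_le _ (fun=> set0)); last by rewrite mu_ext0 //; exact: cvg_cst.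
have {}Uz : \forall nu \near \oo, U (z_ nu) by exact: Uz.
by apply: filterS Uz => nu Unu w nU; exact: (nU Unu).
Qed.

(** Provides positive semidefiniteness of a limit covariance from its approximants rather than from
    its formula, hence the existence of the limit law. *)
Lemma psdmx_cvg q (T : Type) (F : set_system T) {FF : ProperFilter F}
    (S_ : T -> 'M[R]_q) (S : 'M[R]_q) :
  (forall k, psdmx (S_ k)) -> S_ k @[k --> F] --> S -> psdmx S.
Proof.
move=> psd SS; split.
  apply/matrixP => i j; rewrite mxE.
  have H1 : S_ k j i @[k --> F] --> S j i by exact: coord_cvg.
  have H2 : S_ k j i @[k --> F] --> S i j.
    rewrite [X in X @ _](_ : _ = fun k => S_ k i j); first exact: coord_cvg.
    by apply/funext => k; have /matrixP/(_ i j) := (psd k).1; rewrite mxE.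
  by rewrite -(cvg_lim (@norm_hausdorff R R) H1) (cvg_lim (@norm_hausdorff R R) H2).
move=> c; have : qform c (S_ k) @[k --> F] --> qform c S.
  by apply: coord_cvg; apply: mulmx_cvg; [apply: mulmx_cvg => //|]; exact: cvg_cst.
move=> H; rewrite -(cvg_lim (@norm_hausdorff R R) H); apply: limr_ge.
  by apply/cvg_ex; exists (qform c S).
by apply: nearW => k; exact: (psd k).2.
Qed.

End convergence_in_probability.

(** * Conditional laws *)

Section sub_sigma_algebra.
Context d (Omega : measurableType d) (R : realType) (P : probability Omega R).
Variable C : set_system Omega.
Hypothesis mC : C `<=` measurable.
Notation OmegaC := (g_sigma_algebraType C).

Lemma sub_sigma_measurable (B : set Omega) : <<s C >> B -> measurable B.
Proof. by apply: smallest_sub => //; exact: sigma_algebra_measurable. Qed.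

Lemma measurable_wrtP d' (E : measurableType d') (f : Omega -> E) :
  measurable_wrt <<s C >> f <-> measurable_fun setT (f : OmegaC -> E).
Proof.
split=> [mf _ A mA|mf A mA]; first by rewrite setTI; exact: mf.
by have := mf measurableT A mA; rewrite setTI.
Qed.

Lemma measurable_sub_sigma d' (E : measurableType d') (f : Omega -> E) :
  measurable_fun setT (f : OmegaC -> E) -> measurable_fun setT f.
Proof.
by move=> /measurable_wrtP mf _ A mA; rewrite setTI; apply: sub_sigma_measurable; exact: mf.
Qed.

(** The image of P under the identity onto the smaller sigma-algebra. Almost everywhere equality
    from equal integrals is deduced there, because conditional laws are tested on events of the data
    only. *)
Lemma restricted_law : exists PC : probability OmegaC R,
  (forall B, PC B = P B) /\
  forall (f : Omega -> \bar R) B, <<s C >> B -> measurable_fun setT (f : OmegaC -> \bar R) ->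
    (forall w, 0 <= f w)%E -> (\int[PC]_(w in B) f w = \int[P]_(w in B) f w)%E.
Proof.
have mid : measurable_fun setT (id : Omega -> OmegaC).
  by move=> _ B mB; rewrite setTI; exact: sub_sigma_measurable.
have [PC PCE] := image_law P mid; exists PC; split=> // f B CB mf f0.
rewrite integral_mkcond [RHS]integral_mkcond.
apply: (@ge0_integral_image_law _ _ Omega OmegaC R PC P id) => //.
- apply/(@measurable_restrictT _ _ OmegaC _ B f CB); exact: measurable_funTS.
- by move=> w; rewrite patchE; case: ifP.
Qed.

(** For a single Borel set two versions agree off a null set that depends on it. Countably many
    rational boxes determine a law, so one null set suffices for all Borel sets. *)
Lemma cond_law_ae_eq q (Z : Omega -> 'cV[R]_q) (K K' : Omega -> probability 'cV[R]_q R) :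
  cond_law P <<s C >> Z K -> cond_law P <<s C >> Z K' ->
  P.-negligible [set w | ~ forall A, measurable A -> K w A = K' w A].
Proof.
move=> [mK KE] [mK' K'E].
have [PC [PCE iPC]] := restricted_law.
have ae A : measurable A -> P.-negligible [set w | K w A <> K' w A].
  move=> mA.
  have mKA := (measurable_wrtP _).1 (mK A mA).
  have mK'A := (measurable_wrtP _).1 (mK' A mA).
  have : ae_eq PC setT (fun w : OmegaC => K w A) (fun w => K' w A).
    apply: integral_ae_eq => //.
      apply/integrableP; split => //.
      apply: (@le_lt_trans _ _ (\int[PC]_w cst 1%E w)%E).
        apply: ge0_le_integral => //; first exact: measurableT_comp.
        by move=> w _; rewrite gee0_abs // probability_le1.
      by rewrite integral_cst // mul1e [X in (X < _)%E]probability_setT ltry.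
    move=> B _ CB; rewrite !iPC //.
    by rewrite -KE // -K'E.
  move=> [N [mN N0 sN]]; exists N; split.
  - exact: sub_sigma_measurable.
  - by rewrite -PCE.
  - by move=> w /= neq; apply: sN => /= H; apply: neq; exact: H.
pose U (n : nat) := if unpickle n is Some J then [set w | K w (box J) <> K' w (box J)] else set0.
apply: (negligibleS _ (@negligible_bigcup _ _ _ P U _)); last first.
  move=> n; rewrite /U; case: unpickle => [I|]; last exact: negligible_set0.
  by apply: ae; exact: measurable_box.
move=> w /= nE; apply: contrapT => nU; apply: nE => A mA.
have boxE I : K w (box I) = K' w (box I).
  apply: contrapT => H; apply: nU; exists (pickle I) => //.
  by rewrite /U pickleK.
pose g (n : nat) : set 'cV[R]_q := box [ffun=> (- (n%:R), n%:R)].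
apply: (@measure_unique _ _ _ (range (@box R q)) g) => //.
- exact: borel_box.
- by move=> _ _ [I _ <-] [J _ <-]; have [L ->] := box_setI R I J; exists L.
- apply/seteqP; split=> // x _.
  exists (Num.trunc (\sum_j `|x j 0|)).+1 => // j; rewrite ffunE /=.
  rewrite rmorphN /= !ratr_nat -ltr_norml.
  apply: le_lt_trans (truncnS_gt _); rewrite (bigD1 j) //= lerDl; exact: sumr_ge0.
- by move=> _ [I _ <-]; exact: boxE.
- move=> n; rewrite (le_lt_trans (probability_le1 _ _)) ?ltry //; exact: measurable_box.
Qed.

End sub_sigma_algebra.

(** * From covariance matrices to distances between laws *)

Section metric_neighbourhoods.
Variables (R : realType) (q : nat).

(** The metric is tied to weak convergence through sequences only, so a radius h is found by
    contradiction: otherwise normal laws with covariances tending to S would stay at distance e from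
    L. *)
Lemma weak_metric_normal_near
    (dist : probability 'cV[R]_q R -> probability 'cV[R]_q R -> R)
    (S : 'M[R]_q) (L : probability 'cV[R]_q R) (e : R) :
  weak_metric dist -> is_mvnormal 0 S L -> 0 < e ->
  exists2 h, 0 < h & forall T L', is_mvnormal 0 T L' -> `|T - S| < h -> dist L' L < e.
Proof.
move=> [_ _ _ _ distP] NL e0; apply: contrapT => H.
have {}H (k : nat) : exists TL : 'M[R]_q * probability 'cV[R]_q R,
    [/\ is_mvnormal 0 TL.1 TL.2, `|TL.1 - S| < k.+1%:R^-1 & e <= dist TL.2 L].
  apply: contrapT => /forallNP Hk; apply: H; exists k.+1%:R^-1; first by rewrite invr_gt0.
  move=> T L' NT TS; rewrite ltNge; apply/negP => eL.
  by apply: (Hk (T, L')).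
have [TL TLP] := choice H.
have : weak_cvg (fun k => (TL k).2) L.
  apply: (@mvnormal_weak_cvg R q (fun k => (TL k).1) S (fun k => (TL k).2) L _ NL).
    by move=> k; have [] := TLP k.
  apply/cvgrPdist_lt => h h0; near=> k.
  have [_ /lt_trans + _] := TLP k; rewrite distrC; apply.
  near: k; exact: (near_infty_natSinv_lt (PosNum h0)).
move=> /distP /cvgrPdist_lt /(_ e e0) [N _ /(_ N (leqnn N))] /=.
have [_ _ eN] := TLP N; rewrite sub0r normrN => /(le_lt_trans (ler_norm _)).
by rewrite ltNge eN.
Unshelve. all: by end_near. Qed.

Context d (Omega : measurableType d) (P : probability Omega R).

(** K is one version that is normal everywhere. For another version, the event of a large distance
    is covered by the null set where the two differ and the event that T_ is far from S; neither
    step asks for measurability of the distance. *)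
Lemma normal_cond_cvg (C : nat -> set_system Omega) (Z : nat -> Omega -> 'cV[R]_q)
    (K : nat -> Omega -> probability 'cV[R]_q R) (T_ : nat -> Omega -> 'M[R]_q) (S : 'M[R]_q) :
  (forall nu, C nu `<=` measurable) ->
  (forall nu, cond_law P <<s C nu >> (Z nu) (K nu)) ->
  (forall nu w, is_mvnormal 0 (T_ nu w) (K nu w)) ->
  T_ p.1 p.2 @[p --> prob_filter P] --> S ->
  cond_cvg_normal P (fun nu => <<s C nu >>) Z 0 S.
Proof.
move=> mC KE NK TS.
have PS : psdmx S by apply: psdmx_cvg TS => -[nu w]; exact: (NK nu w).1.
have [L NL] := mvnormal_exists PS; exists L => //; split; first by move=> nu; exists (K nu).
move=> K' K'E dist mdist; have [dist0 distE distC distD _] := mdist.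
move=> e e0; have [h h0 Hh] := weak_metric_normal_near mdist NL e0.
have /cvgrPdist_lt/(_ h h0) := TS; rewrite /prob_filter /nbhs /= => T0.
pose N nu := [set w | ~ forall A, measurable A -> K nu w A = K' nu w A].
have N0 nu : mu_ext P (N nu) = 0%E.
  have [B [mB B0 NB]] := cond_law_ae_eq (mC nu) (KE nu) (K'E nu).
  apply/eqP; rewrite eq_le mu_ext_ge0 // andbT -B0 -(measurable_mu_extE P mB).
  exact: le_mu_ext.
apply: squeeze_cvge (cvg_cst 0%E) T0; apply: nearW => nu; rewrite mu_ext_ge0 //=.
rewrite -[leRHS]add0e -{1}(N0 nu); apply: le_trans (outer_measureU2 _ _ _).
apply: le_mu_ext => w /=; rewrite subr0 ger0_norm // => eK.
have [KK'|] := pselect (N nu w); first by left.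
move=> /contrapT KK'; right => TS'.
have : dist (K' nu w) L < e.
  apply: le_lt_trans (distD _ (K nu w) _) _.
  have -> : dist (K' nu w) (K nu w) = 0 by apply/distE => A mA; rewrite KK'.
  by rewrite add0r; apply: Hh (NK nu w) _; rewrite distrC.
by rewrite ltNge eK.
Qed.

End metric_neighbourhoods.

(** * Product kernels and joint conditional laws *)

Section joint_conditional_law.
Context d1 d2 (E1 : measurableType d1) (E2 : measurableType d2) (R : realType).

Lemma measurable_fun_product_kernel d (T : measurableType d)
    (K1 : T -> probability E1 R) (K2 : T -> probability E2 R) (D : set (E1 * E2)) :
  (forall A, measurable A -> measurable_fun setT (fun w => K1 w A)) ->
  (forall A, measurable A -> measurable_fun setT (fun w => K2 w A)) ->
  measurable D -> measurable_fun setT (fun w => (K1 w \x K2 w)%E D).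
Proof.
move=> m1 m2; rewrite measurable_prod_measurableType => mD.
pose G := [set A `*` B | A in @measurable _ E1 & B in @measurable _ E2].
apply: (@dynkin_induction _ _ G (fun D => measurable_fun setT (fun w => (K1 w \x K2 w)%E D))
  _ _ _ _ _ _ D mD).
- exact: measurable_prod_measurableType.
- move=> _ _ [A1 mA1 [B1 mB1 <-]] [A2 mA2 [B2 mB2 <-]].
  exists (A1 `&` A2); first exact: measurableI.
  by exists (B1 `&` B2); [exact: measurableI|rewrite setXI].
- rewrite (_ : (fun w => _) = cst 1%E) //.
  by apply/funext => w; rewrite [LHS](@probability_setT _ _ _ (K1 w \x K2 w : probability _ R)%E).
- move=> _ [A mA [B mB <-]].
  under eq_fun do rewrite product_measure1E //.
  by apply: emeasurable_funM; [exact: m1|exact: m2].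
- move=> S mS IS.
  rewrite (_ : (fun w => _) = (fun w => 1 - (K1 w \x K2 w) S)%E).
    by apply: emeasurable_funB.
  apply/funext => w; exact: (@probability_setC _ _ _ (K1 w \x K2 w : probability _ R)%E).
- move=> F mF tF IF.
  rewrite (_ : (fun w => _) = (fun w => \sum_(0 <= n <oo) (K1 w \x K2 w) (F n))%E).
    by apply: ge0_emeasurable_sum => n *.
  by apply/funext => w; rewrite measure_semi_bigcup //; exact: bigcupT_measurable.
Qed.

(** Both sides are finite measures in D with the same total mass, so agreement on a pi-system
    suffices. The event X and the density r stand for constraints on other vectors of the array and
    their conditional probability. *)
Lemma mixture_identity_generator d (Omega : measurableType d) (P : probability Omega R)
    d' (E : measurableType d') (G : set_system E) (M : Omega -> probability E R)
    (Z : Omega -> E) (B X : set Omega) (r : Omega -> R) :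
  @measurable _ E = <<s G >> -> setI_closed G ->
  (forall D, measurable D -> measurable_fun setT (fun w => M w D)) ->
  measurable_fun setT Z -> measurable X ->
  measurable B -> measurable_fun setT r -> (forall w, 0 <= r w) ->
  (P X = \int[P]_(w in B) (r w)%:E)%E ->
  (forall D, G D -> (P (X `&` Z @^-1` D) = \int[P]_(w in B) (M w D * (r w)%:E))%E) ->
  forall D, measurable D -> (P (X `&` Z @^-1` D) = \int[P]_(w in B) (M w D * (r w)%:E))%E.
Proof.
move=> mG GI mM mZ mX mB mr r0 HT HG.
have mK S : measurable S -> measurable_fun B (fun w => M w S * (r w)%:E)%E.
  move=> mS; apply: measurable_funTS; apply: emeasurable_funM; last exact/measurable_EFinP.
  exact: mM.
have K0 S w : (0 <= M w S * (r w)%:E)%E by rewrite mule_ge0 // lee_fin.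
have mpre S : measurable S -> measurable (X `&` Z @^-1` S).
  by move=> mS; apply: measurableI => //; rewrite -[X in measurable X]setTI; exact: mZ.
move=> D mD; rewrite mG in mD.
apply: (@dynkin_induction _ _ G (fun D => P (X `&` Z @^-1` D) =
   \int[P]_(w in B) (M w D * (r w)%:E))%E _ _ _ _ _ _ D mD) => //.
- rewrite preimage_setT setIT HT; apply: eq_integral => w _.
  by rewrite probability_setT mul1e.
- move=> S mS IS; have mSC := measurableC mS.
  have XS : (P X = P (X `&` Z @^-1` S) + P (X `&` Z @^-1` (~` S)))%E.
    rewrite -measureU; [|exact: mpre|exact: mpre|].
      by rewrite -setIUr -preimage_setU setUv preimage_setT setIT.
    by rewrite setIACA setICr setI0.
  have KS : (\int[P]_(w in B) (r w)%:E =
      \int[P]_(w in B) (M w S * (r w)%:E) + \int[P]_(w in B) (M w (~` S) * (r w)%:E))%E.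
    rewrite -ge0_integralD //; [|exact: mK|exact: mK].
    apply: eq_integral => w _; rewrite -ge0_muleDl // -measureU ?setICr //.
    by rewrite setUv [X in (X * _)%E]probability_setT mul1e.
  move: XS; rewrite HT KS IS; set x := integral _ _ _.
  have fx : x \is a fin_num by rewrite /x -IS; apply: fin_num_measure; exact: mpre.
  by move=> /(congr1 (fun t => t - x)%E); rewrite ![(x + _)%E]addeC !addeK.
- move=> F mF tF IF.
  rewrite preimage_bigcup setI_bigcupr measure_semi_bigcup //.
  - rewrite (eq_eseriesr (fun n _ => IF n)).
    rewrite -integral_nneseries //; last by move=> n; exact: mK.
    apply: eq_integral => w _; rewrite measure_semi_bigcup //; last exact: bigcupT_measurable.
    by rewrite muleC -nneseriesZl //; apply: eq_eseriesr => n _; rewrite muleC.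
  - by move=> n; exact: mpre.
  - apply/trivIsetP => i j _ _ ij.
    have Fij : F i `&` F j = set0 by move/trivIsetP : tF; exact.
    apply/seteqP; split=> // w [[_ Fi] [_ Fj]].
    by have : (F i `&` F j) (Z w) by []; rewrite Fij.
  - by apply: bigcupT_measurable => n; exact: mpre.
Qed.

Lemma product_kernel_identity d (Omega : measurableType d) (P : probability Omega R)
    (K1 : Omega -> probability E1 R) (K2 : Omega -> probability E2 R)
    (Z1 : Omega -> E1) (Z2 : Omega -> E2) (B X : set Omega) (r : Omega -> R) (D : set (E1 * E2)) :
  (forall A, measurable A -> measurable_fun setT (fun w => K1 w A)) ->
  (forall A, measurable A -> measurable_fun setT (fun w => K2 w A)) ->
  measurable_fun setT Z1 -> measurable_fun setT Z2 ->
  measurable B -> measurable X ->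
  measurable_fun setT r -> (forall w, 0 <= r w) ->
  (forall A1 A2, measurable A1 -> measurable A2 ->
     P (X `&` (Z1 @^-1` A1 `&` Z2 @^-1` A2)) =
     \int[P]_(w in B) (K1 w A1 * K2 w A2 * (r w)%:E))%E ->
  measurable D ->
  (P (X `&` (fun w => (Z1 w, Z2 w)) @^-1` D) =
   \int[P]_(w in B) ((K1 w \x K2 w) D * (r w)%:E))%E.
Proof.
move=> m1 m2 mZ1 mZ2 mB mX mr r0 H mD.
pose G := [set A `*` B | A in @measurable _ E1 & B in @measurable _ E2].
apply: (@mixture_identity_generator _ Omega P _ _ G (fun w => (K1 w \x K2 w : probability _ R)%E)
  (fun w => (Z1 w, Z2 w)) B X r) mD.
- exact: measurable_prod_measurableType.
- move=> _ _ [A1 mA1 [B1 mB1 <-]] [A2 mA2 [B2 mB2 <-]].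
  exists (A1 `&` A2); first exact: measurableI.
  by exists (B1 `&` B2); [exact: measurableI|rewrite setXI].
- by move=> S mS; exact: measurable_fun_product_kernel.
- exact: measurable_fun_pair.
- exact: mX.
- exact: mB.
- exact: mr.
- exact: r0.
- have := H _ _ measurableT measurableT; rewrite !preimage_setT !setIT => ->.
  by apply: eq_integral => w _; rewrite !probability_setT !mul1e.
- move=> _ [A1 mA1 [A2 mA2 <-]].
  apply: eq_trans (H A1 A2 mA1 mA2) _; apply: eq_integral => w _.
  by rewrite /= product_measure1E.
Qed.

End joint_conditional_law.

(** * Linear combinations of conditionally independent normal vectors *)

Section conditionally_independent_normals.
Context d (Omega : measurableType d) (R : realType) (P : probability Omega R).
Variables (C : set_system Omega) (a q : nat) (n : 'I_a -> nat).
Variables (Y : 'I_a -> nat -> Omega -> 'cV[R]_q) (Q : 'I_a -> Omega -> probability 'cV[R]_q R).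
Hypothesis mC : C `<=` measurable.
Hypothesis mY : forall i k, measurable_fun setT (Y i k).
Hypothesis mQ : forall i A, measurable A -> measurable_wrt <<s C >> (fun w => Q i w A).
Hypothesis YQ : forall (A : 'I_a -> nat -> set 'cV[R]_q) (B : set Omega),
  (forall i k, measurable (A i k)) -> <<s C >> B ->
  (P (B `&` [set w | forall i k, (k < n i)%N -> A i k (Y i k w)]) =
   \int[P]_(w in B) \prod_(i < a) \prod_(k < n i) Q i w (A i k))%E.
Notation OmegaC := (g_sigma_algebraType C).

Let rect (A : 'I_a -> nat -> set 'cV[R]_q) : set Omega :=
  [set w | forall i k, (k < n i)%N -> A i k (Y i k w)].
(** The conditional probability of [rect A] given the data, taken as a real number so that it can be
    the density r of [product_kernel_identity]. *)
Let weight (A : 'I_a -> nat -> set 'cV[R]_q) (w : Omega) : R :=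
  \prod_(i < a) \prod_(k < n i) fine (Q i w (A i k)).
Let update (A : 'I_a -> nat -> set 'cV[R]_q) (j : 'I_a * nat) D : 'I_a -> nat -> set 'cV[R]_q :=
  fun i k => if (i, k) == j then D else A i k.

Implicit Types (A : 'I_a -> nat -> set 'cV[R]_q) (D : set 'cV[R]_q).

Lemma measurable_law_data i D : measurable D -> measurable_fun setT (fun w : OmegaC => Q i w D).
Proof. by move=> mD; apply/measurable_wrtP; exact: mQ. Qed.

Lemma measurable_law i D : measurable D -> measurable_fun setT (fun w => Q i w D).
Proof. by move=> mD; apply: (measurable_sub_sigma mC); exact: measurable_law_data. Qed.

Lemma weightE A w : (forall i k, measurable (A i k)) ->
  (\prod_(i < a) \prod_(k < n i) Q i w (A i k))%E = (weight A w)%:E.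
Proof.
move=> mA; rewrite /weight -prodEFin; apply: eq_bigr => i _.
rewrite -prodEFin; apply: eq_bigr => k _; rewrite fineK //.
by apply: fin_num_measure; exact: mA.
Qed.

Lemma weight_ge0 A w : 0 <= weight A w.
Proof. by apply: prodr_ge0 => i _; apply: prodr_ge0 => k _; exact: fine_ge0. Qed.

Lemma measurable_weight A : (forall i k, measurable (A i k)) -> measurable_fun setT (weight A).
Proof.
move=> mA; apply: measurable_prod => i _; apply: measurable_prod => k _.
by apply: measurableT_comp => //; exact: measurable_law.
Qed.

Lemma measurable_rect A : (forall i k, measurable (A i k)) -> measurable (rect A).
Proof.
move=> mA; rewrite (_ : rect A = \bigcap_(i in [set: 'I_a]) \bigcap_(k in [set k | (k < n i)%N])
  (Y i k @^-1` A i k)); last first.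
  by apply/seteqP; split=> w H; [move=> i _ k; exact: H|move=> i k; exact: (H i)].
apply: fin_bigcap_measurable => // i _; apply: fin_bigcap_measurable; first exact: finite_II.
by move=> k _; rewrite -[X in measurable X]setTI; exact: mY.
Qed.

(** If position j was unconstrained, requiring D there adds one event; [weight_update] adds the
    corresponding factor to the conditional probability. *)
Lemma rect_update A j D : A j.1 j.2 = setT -> (j.2 < n j.1)%N ->
  rect (update A j D) = rect A `&` Y j.1 j.2 @^-1` D.
Proof.
case: j => i0 k0 /= Aj jn; apply/seteqP; split=> w.
  move=> H; split=> [i k kn|]; last by have := H i0 k0 jn; rewrite /update eqxx.
  have := H i k kn; rewrite /update; case: eqP => [[-> ->]|//] _.
  by rewrite Aj.
by move=> [H HD] i k kn; rewrite /update; case: eqP => [[-> ->]//|_]; exact: H.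
Qed.

Lemma weight_update A j D w : A j.1 j.2 = setT -> (j.2 < n j.1)%N ->
  weight (update A j D) w = fine (Q j.1 w D) * weight A w.
Proof.
case: j => i0 k0 /= Aj jn; rewrite /weight (bigD1 i0) //= [in RHS](bigD1 i0) //= mulrA.
congr (_ * _); last first.
  apply: eq_bigr => i ij; apply: eq_bigr => k _; rewrite /update.
  by rewrite xpair_eqE (negbTE ij).
rewrite (bigD1 (Ordinal jn)) //= [in RHS](bigD1 (Ordinal jn)) //= Aj probability_setT /= mul1r.
rewrite /update eqxx; congr (_ * _); apply: eq_bigr => k kj.
by rewrite xpair_eqE eqxx /=; case: eqP => // E; move: kj; rewrite -val_eqE /= E eqxx.
Qed.

Lemma measurable_update A j D : (forall i k, measurable (A i k)) -> measurable D ->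
  forall i k, measurable (update A j D i k).
Proof. by move=> mA mD i k; rewrite /update; case: eqP. Qed.

(** Pairwise conditional independence within a group is what the second-moment law of large numbers
    asks for. *)
Lemma pair_law i k l (A1 A2 : set 'cV[R]_q) B : (k < n i)%N -> (l < n i)%N -> k != l ->
  measurable A1 -> measurable A2 -> <<s C >> B ->
  (P (B `&` (Y i k @^-1` A1 `&` Y i l @^-1` A2)) = \int[P]_(w in B) (Q i w A1 * Q i w A2))%E.
Proof.
move=> kn ln kl m1 m2 CB.
pose A0 : 'I_a -> nat -> set 'cV[R]_q := fun _ _ => setT.
pose A := update (update A0 (i, k) A1) (i, l) A2.
have mA0 i' k' : measurable (A0 i' k') by exact: measurableT.
have mA i' k' : measurable (A i' k').
  by apply: (measurable_update (i, l)) => // i1 k1; exact: (measurable_update (i, k)).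
have Al : update A0 (i, k) A1 i l = setT by rewrite /update xpair_eqE eqxx /= eq_sym (negbTE kl).
have <- : rect A = Y i k @^-1` A1 `&` Y i l @^-1` A2.
  rewrite /A rect_update // rect_update //= (_ : rect A0 = setT) ?setTI //.
  by apply/seteqP; split.
rewrite YQ //; apply: eq_integral => w _.
rewrite weightE // /A weight_update // weight_update // (_ : weight A0 w = 1).
  by rewrite mulr1 mulrC EFinM !fineK // fin_num_measure.
by rewrite /weight big1 // => i' _; rewrite big1 // => k' _; rewrite probability_setT.
Qed.

Variable S : 'I_a -> Omega -> 'M[R]_q.
Hypothesis NQ : forall i w, is_mvnormal 0 (S i w) (Q i w).
Variables (m : nat) (F : 'I_a * nat -> 'M[R]_(m, q)).

(** Vectors are added one at a time: the kernel of the longer sum is the image of the product of K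
    and Q under z + F y. The kernel so built is normal at every w and not just almost everywhere. *)
Lemma cond_law_linear_sum (J : seq ('I_a * nat)) :
  uniq J -> (forall j, j \in J -> (j.2 < n j.1)%N) ->
  exists K : Omega -> probability 'cV[R]_m R,
    (forall w, is_mvnormal 0 (\sum_(j <- J) F j *m S j.1 w *m (F j)^T) (K w)) /\
    cond_law P <<s C >> (fun w => \sum_(j <- J) F j *m Y j.1 j.2 w) K.
Proof.
move=> uJ Jn.
(* The sum over J also has to be conditionally independent of the vectors not
   in J for the induction to go through; the sets A describe these. *)
suff [K [NK mK KE]] : exists K : Omega -> probability 'cV[R]_m R,
    [/\ forall w, is_mvnormal 0 (\sum_(j <- J) F j *m S j.1 w *m (F j)^T) (K w),
    forall D : set 'cV[R]_m, measurable D -> measurable_fun setT (fun w : OmegaC => K w D) &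
    forall (D : set 'cV[R]_m) A B, measurable D -> (forall i k, measurable (A i k)) -> <<s C >> B ->
      (forall j, j \in J -> A j.1 j.2 = setT) ->
      (P (B `&` rect A `&` (fun w => (\sum_(j <- J) F j *m Y j.1 j.2 w)%R) @^-1` D) =
       \int[P]_(w in B) (K w D * (weight A w)%:E))%E].
  exists K; split=> //; split; first by move=> D mD; apply/measurable_wrtP; exact: mK.
  move=> D B mD CB; have := KE D (fun _ _ => setT) B mD (fun _ _ => measurableT) CB.
  rewrite (_ : rect _ = setT) ?setIT => [->//|]; last by apply/seteqP; split.
  apply: eq_integral => w _; rewrite (_ : weight _ w = 1) ?mule1 //.
  by rewrite /weight big1 // => i' _; rewrite big1 // => k' _; rewrite probability_setT.
elim: J uJ Jn => [|j J IH] /=.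
  move=> _ _; exists (fun=> (dirac (0 : 'cV[R]_m) : probability _ R)); split.
  - by move=> w; rewrite big_nil; exact: mvnormal_dirac0.
  - by move=> D mD; exact: measurable_cst.
  - move=> D A B mD mA CB _.
    rewrite (_ : (fun w => _) = fun=> 0); last by apply/funext => w; rewrite big_nil.
    transitivity (\int[P]_(w in B) (\d_(0%R : 'cV[R]_m) D * (weight A w)%:E))%E; last by [].
    rewrite preimage_cst diracE; case: ifPn => _; last by rewrite setI0 measure0 integral0_eq // => w _; rewrite mul0e.
    rewrite setIT YQ //; apply: eq_integral => w _; by rewrite weightE // mul1e.
move=> /andP[jJ uJ] Jn.
have [|K [NK mK KE]] := IH uJ; first by move=> i iJ; apply: Jn; rewrite inE iJ orbT.
have jn : (j.2 < n j.1)%N by apply: Jn; rewrite mem_head.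
have mZ : measurable_fun setT (fun w => \sum_(j <- J) F j *m Y j.1 j.2 w).
  apply: measurable_fun_vector => i; under eq_fun do rewrite summxE.
  apply: measurable_sum => l; under eq_fun do rewrite mxE.
  apply: measurable_sum => r; apply: measurable_funM => //.
  by apply: measurable_fun_coord; exact: mY.
have /choice[K' K'E] w : exists L : probability 'cV[R]_m R, forall D : set 'cV[R]_m, L D =
    (K w \x Q j.1 w)%E ((fun zy : 'cV[R]_m * 'cV[R]_q => zy.1 + F j *m zy.2) @^-1` D).
  exact: (image_law (K w \x Q j.1 w : probability _ R)%E (measurable_add_mulmx (F j))).
have mpre (D : set 'cV[R]_m) : measurable D ->
    measurable ((fun zy : 'cV[R]_m * 'cV[R]_q => zy.1 + F j *m zy.2) @^-1` D).
  by move=> mD; rewrite -[X in measurable X]setTI; exact: measurable_add_mulmx.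
exists K'; split.
- move=> w; rewrite big_cons addrC.
  by apply: (mvnormal_convolution (NK w) (NQ j.1 w)) => D _; exact: K'E.
- move=> D mD; under eq_fun do rewrite K'E.
  apply: measurable_fun_product_kernel; [exact: mK|exact: measurable_law_data|exact: mpre].
- move=> D A B mD mA CB AJ.
  under eq_integral do rewrite K'E.
  rewrite -(@product_kernel_identity _ _ _ _ R _ Omega P K (Q j.1)
    (fun w => \sum_(j <- J) F j *m Y j.1 j.2 w) (Y j.1 j.2) B (B `&` rect A) (weight A)) //.
  + congr (P _); apply/seteqP; split=> w [H1 H2]; split=> //; move: H2;
      by rewrite /= big_cons addrC.
  + by move=> A' mA'; apply: (measurable_sub_sigma mC); exact: mK.
  + by move=> A' mA'; exact: measurable_law.
  + exact: (sub_sigma_measurable mC).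
  + by apply: measurableI; [exact: (sub_sigma_measurable mC)|exact: measurable_rect].
  + exact: measurable_weight.
  + by move=> w; exact: weight_ge0.
  + move=> A1 A2 m1 m2.
    have Aj : A j.1 j.2 = setT by apply: AJ; rewrite mem_head.
    (* The constraint on the new vector is absorbed into [rect], which the induction hypothesis
       allows since that position is outside J. *)
    rewrite [X in _ `&` X]setIC setIA -[_ `&` _ `&` Y _ _ @^-1` _]setIA -rect_update //.
    rewrite KE //; first last.
    * move=> l lJ; rewrite /update; case: eqP => [E|_].
        by move: jJ; rewrite -E -surjective_pairing lJ.
      by apply: AJ; rewrite inE lJ orbT.
    * exact: measurable_update.
    apply: eq_integral => w _; rewrite weight_update // EFinM fineK ?muleA //.
    exact: fin_num_measure.
  + exact: mpre.
Qed.

End conditionally_independent_normals.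

(** * Law of large numbers for conditionally independent vectors *)

Section mixtures.
Context d (Omega : measurableType d) (R : realType) (P : probability Omega R).
Context d' (T : measurableType d') (Z : Omega -> T) (B : set Omega)
  (K : Omega -> probability T R).
Hypotheses (mZ : measurable_fun setT Z) (mB : measurable B)
  (mK : forall D, measurable D -> measurable_fun setT (fun w => K w D))
  (KE : forall D, measurable D -> (P (B `&` Z @^-1` D) = \int[P]_(w in B) K w D)%E).

Lemma measurable_ge0_kernel_integral (g : T -> \bar R) : measurable_fun setT g ->
  (forall t, 0 <= g t)%E -> measurable_fun setT (fun w => \int[K w]_t g t)%E.
Proof.
move=> mg g0.
exact: (@measurable_fun_integral_kernel _ _ _ _ _ (fun w => K w : measure _ _) mK g g0 mg).
Qed.

(** On indicators both sides give the image under Z of P restricted to B, so [ge0_integral_ext]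
    identifies both with the integral against that measure. *)
Lemma ge0_integral_mixture (g : T -> \bar R) : measurable_fun setT g ->
  (forall t, 0 <= g t)%E ->
  (\int[P]_(w in B) g (Z w) = \int[P]_(w in B) \int[K w]_t g t)%E.
Proof.
move=> mg g0; pose Zf : {mfun Omega >-> T} := HB.pack Z (isMeasurableFun.Build _ _ _ _ Z mZ).
pose mu0 : {measure set T -> \bar R} := pushforward (mrestr P mB) Zf.
pose mu := mu0 mZ.
have mgZ (h : T -> \bar R) : measurable_fun setT h -> measurable_fun B (h \o Z).
  by move=> mh; apply: measurable_funTS; exact: measurableT_comp.
have mZD D : measurable D -> measurable (Z @^-1` D).
  by move=> mD; rewrite -[X in measurable X]setTI; exact: mZ.
have mKg (h : T -> \bar R) : measurable_fun setT h -> (forall t, 0 <= h t)%E ->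
    measurable_fun B (fun w => \int[K w]_t h t)%E.
  by move=> mh h0; apply: measurable_funTS; exact: measurable_ge0_kernel_integral.
transitivity (\int[mu]_t g t)%E; last apply/esym.
- apply: (@ge0_integral_ext _ _ _ mu (fun g => \int[P]_(w in B) g (Z w))%E) => //.
  + move=> D mD; rewrite /mu /mu0 /pushforward /mrestr /=.
    rewrite (_ : (fun w => _) = fun w => (\1_(Z @^-1` D) w)%:E) //.
    by rewrite integral_indic //; exact: mZD.
  + by move=> f h mf mh f0 h0; rewrite ge0_integralD //; exact: mgZ.
  + by move=> k f mf f0 k0; rewrite ge0_integralZl //; exact: mgZ.
  + move=> f mf f0 ndf; rewrite -monotone_convergence //.
    by move=> n; exact: (mgZ (f n)).
- apply: (@ge0_integral_ext _ _ _ mu (fun g => \int[P]_(w in B) \int[K w]_t g t)%E) => //.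
  + move=> D mD; transitivity (P (B `&` Z @^-1` D))%E; last by rewrite setIC.
    rewrite KE //; by apply: eq_integral => w _; rewrite integral_indic // setIT.
  + move=> f h mf mh f0 h0; rewrite -ge0_integralD //.
    * by apply: eq_integral => w _; rewrite ge0_integralD.
    * by move=> w _; exact: integral_ge0.
    * exact: mKg.
    * by move=> w _; exact: integral_ge0.
    * exact: mKg.
  + move=> k f mf f0 k0; rewrite -ge0_integralZl //.
    * by apply: eq_integral => w _; rewrite ge0_integralZl.
    * exact: mKg.
    * by move=> w _; exact: integral_ge0.
  + move=> f mf f0 ndf; rewrite -monotone_convergence //.
    * by apply: eq_integral => w _; rewrite monotone_convergence // => t _; exact: ndf.
    * by move=> n; exact: mKg.
    * by move=> n w _; exact: integral_ge0.
    * by move=> w _ i j ij; apply: ge0_le_integral => // t _; exact: ndf.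
Qed.

Lemma measurable_kernel_integral (g : T -> \bar R) : measurable_fun setT g ->
  measurable_fun setT (fun w => \int[K w]_t g t)%E.
Proof.
move=> mg; under eq_fun do rewrite integralE.
by apply: emeasurable_funB; apply: measurable_ge0_kernel_integral => //;
  [exact: measurable_funepos|exact: measurable_funeneg].
Qed.

Lemma integral_mixture (g : T -> \bar R) : measurable_fun setT g ->
  P.-integrable B (g \o Z) ->
  (\int[P]_(w in B) g (Z w) = \int[P]_(w in B) \int[K w]_t g t)%E.
Proof.
move=> mg /integrableP[_ ig].
have fin (h : T -> \bar R) : measurable_fun setT h -> (forall t, 0 <= h t)%E -> (forall t, h t <= `|g t|)%E ->
    P.-integrable B (fun w => \int[K w]_t h t)%E.
  move=> mh h0 hg; apply/integrableP; split.
    by apply: measurable_funTS; exact: measurable_ge0_kernel_integral.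
  under eq_integral do rewrite gee0_abs ?integral_ge0 //.
  rewrite -ge0_integral_mixture //; apply: le_lt_trans ig.
  apply: ge0_le_integral => //.
  - by apply: measurable_funTS; exact: measurableT_comp.
  - by apply: measurable_funTS; apply: measurableT_comp => //; exact: measurableT_comp.
rewrite integralE.
transitivity (\int[P]_(w in B) (\int[K w]_t g^\+ t - \int[K w]_t g^\- t))%E.
  rewrite integralB //; last 2 first.
  - apply: fin => //; first exact: measurable_funepos.
    by move=> t; rewrite -/((abse \o g) t) fune_abse leeDl.
  - apply: fin => //; first exact: measurable_funeneg.
    by move=> t; rewrite -/((abse \o g) t) fune_abse leeDr.
  rewrite -!ge0_integral_mixture //.
  - by congr (_ - _)%E; apply: eq_integral => w _; rewrite ?funeposE ?funenegE.
  - exact: measurable_funeneg.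
  - exact: measurable_funepos.
by apply: eq_integral => w _; rewrite -integralE.
Qed.

End mixtures.

Lemma square_integrable d (T : measurableType d) (R : realType) (P : probability T R) (f : T -> R) :
  measurable_fun setT f -> P.-integrable setT (fun x => (f x ^+ 2)%:E) ->
  P.-integrable setT (EFin \o f).
Proof.
move=> mf f2; apply: (@le_integrable _ _ _ _ setT measurableT _ (fun x => 1%:E + (f x ^+ 2)%:E)%E).
- exact/measurable_EFinP.
- move=> x _ /=; rewrite lee_fin [leRHS]ger0_norm ?addr_ge0 ?sqr_ge0 //.
  rewrite ler_norml; apply/andP; split; nra.
- by apply: integrableD => //; exact: (finite_measure_integrable_cst P 1 measurableT).
Qed.

Lemma integral_product d (E : measurableType d) (R : realType) (Q1 Q2 : probability E R) (f g : E -> R) :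
  measurable_fun setT f -> measurable_fun setT g ->
  Q1.-integrable setT (EFin \o f) -> Q2.-integrable setT (EFin \o g) ->
  (\int[Q1 \x Q2]_z (f z.1 * g z.2)%:E = \int[Q1]_x (f x)%:E * \int[Q2]_y (g y)%:E)%E.
Proof.
move=> mf mg f1 g2.
have mfg : measurable_fun setT (fun z : E * E => (f z.1 * g z.2)%:E).
  by apply/measurable_EFinP; apply: measurable_funM; exact: measurableT_comp.
rewrite -integral12_prod_meas1; last first.
  apply/integrable12ltyP => //=.
  under eq_integral => x _ do under eq_integral => y _ do rewrite normrM EFinM.
  have /integrableP[_ fl] := f1; have /integrableP[_ gl] := g2.
  under eq_integral => x _.
    rewrite ge0_integralZl //; last by apply/measurable_EFinP; exact: measurableT_comp.
    over.
  rewrite ge0_integralZr //.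
  - by apply: lte_mul_pinfty => //; [exact: integral_ge0|rewrite ge0_fin_numE //; exact: integral_ge0].
  - by apply/measurable_EFinP; exact: measurableT_comp.
  - exact: integral_ge0.
rewrite /fubini_F /=; under eq_integral => x _.
  under eq_integral => y _ do rewrite EFinM.
  rewrite integralZl //; over.
rewrite -(fineK (integrable_fin_num measurableT g2)) /=.
by rewrite integralZr.
Qed.

Section second_moment_of_means.
Context d (Omega : measurableType d) (R : realType) (P : probability Omega R).
Context d' (E : measurableType d') (n : nat) (Z : nat -> Omega -> E) (B : set Omega)
  (Q : Omega -> probability E R) (f : E -> R) (h c : R).
Hypotheses (n0 : (0 < n)%N) (mZ : forall k, measurable_fun setT (Z k)) (mB : measurable B)
  (mQ : forall D, measurable D -> measurable_fun setT (fun w => Q w D))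
  (Q1 : forall k D, (k < n)%N -> measurable D ->
     (P (B `&` Z k @^-1` D) = \int[P]_(w in B) Q w D)%E)
  (Q2 : forall k l D1 D2, (k < n)%N -> (l < n)%N -> k != l -> measurable D1 -> measurable D2 ->
     (P (B `&` (Z k @^-1` D1 `&` Z l @^-1` D2)) = \int[P]_(w in B) (Q w D1 * Q w D2))%E)
  (mf : measurable_fun setT f) (h0 : 0 <= h) (c0 : 0 <= c)
  (f2 : forall w, (Q w).-integrable setT (fun x => (f x ^+ 2)%:E))
  (fh : forall w, B w -> (`| \int[Q w]_x (f x)%:E | <= h%:E)%E)
  (fc : forall w, B w -> (\int[Q w]_x (f x ^+ 2)%:E <= c%:E)%E).

Lemma mean_square_bound k : (k < n)%N -> (\int[P]_(w in B) (f (Z k w) ^+ 2)%:E <= c%:E)%E.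
Proof.
move=> kn; have mf2 : measurable_fun setT (fun x => (f x ^+ 2)%:E).
  by apply/measurable_EFinP; exact: measurable_funX.
rewrite (ge0_integral_mixture (mZ k) mB mQ (fun D => Q1 kn) mf2); last first.
  by move=> x; rewrite lee_fin sqr_ge0.
apply: (@le_trans _ _ (\int[P]_(w in B) cst c%:E w)%E).
  apply: ge0_le_integral => //.
  - by move=> w _; apply: integral_ge0 => x _; rewrite lee_fin sqr_ge0.
  - apply: measurable_funTS; apply: measurable_ge0_kernel_integral => // x.
    by rewrite lee_fin sqr_ge0.
rewrite integral_cst //; apply: le_trans (lee_wpmul2l _ (probability_le1 P mB)) _;
  by rewrite ?mule1 ?lee_fin.
Qed.

Lemma mean_term_square_integrable k : (k < n)%N ->
  P.-integrable B (fun w => (f (Z k w) ^+ 2)%:E).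
Proof.
move=> kn; apply/integrableP; split.
  apply: measurable_funTS; apply/measurable_EFinP; apply: measurable_funX.
  exact: measurableT_comp.
under eq_integral do rewrite gee0_abs ?lee_fin ?sqr_ge0 //.
exact: le_lt_trans (mean_square_bound kn) (ltry _).
Qed.

Lemma mean_term_product_integrable k l : (k < n)%N -> (l < n)%N ->
  P.-integrable B (fun w => (f (Z k w) * f (Z l w))%:E).
Proof.
move=> kn ln; apply: (@le_integrable _ _ _ _ _ mB _
  (fun w => (f (Z k w) ^+ 2)%:E + (f (Z l w) ^+ 2)%:E)%E).
- by apply: measurable_funTS; apply/measurable_EFinP; apply: measurable_funM; exact: measurableT_comp.
- move=> w _ /=; rewrite lee_fin [leRHS]ger0_norm ?addr_ge0 ?sqr_ge0 //.
  rewrite normrM -(real_normK (num_real (f (Z k w)))) -(real_normK (num_real (f (Z l w)))).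
  have := normr_ge0 (f (Z k w)); have := normr_ge0 (f (Z l w)).
  move: `|f (Z k w)| `|f (Z l w)| => u v; nra.
- by apply: integrableD => //; exact: mean_term_square_integrable.
Qed.

(** By conditional independence the conditional mean of the product is the square of the conditional
    mean of one term, at most h^2 on B. *)
Lemma mean_cross_bound k l : (k < n)%N -> (l < n)%N -> k != l ->
  (\int[P]_(w in B) (f (Z k w) * f (Z l w))%:E <= (h ^+ 2)%:E)%E.
Proof.
move=> kn ln kl.
have mQQ D : measurable D -> measurable_fun setT (fun w => (Q w \x Q w : probability _ R)%E D).
  by move=> mD; exact: measurable_fun_product_kernel.
have QQE D : measurable D -> (P (B `&` (fun w => (Z k w, Z l w)) @^-1` D) =
    \int[P]_(w in B) (Q w \x Q w : probability _ R) D)%E.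
  move=> mD; rewrite (@product_kernel_identity _ _ _ _ R _ Omega P Q Q (Z k) (Z l) B B (cst 1)) //.
  - by apply: eq_integral => w _; rewrite mule1.
  - by move=> A1 A2 m1 m2; rewrite Q2 //; apply: eq_integral => w _; rewrite mule1.
have mff : measurable_fun setT (fun z : E * E => (f z.1 * f z.2)%:E).
  by apply/measurable_EFinP; apply: measurable_funM; exact: measurableT_comp.
have mZZ : measurable_fun setT (fun w => (Z k w, Z l w)) by exact: measurable_fun_pair.
have /= -> := integral_mixture mZZ mB mQQ QQE mff (mean_term_product_integrable kn ln).
under eq_integral => w _.
  have fi := square_integrable mf (f2 w).
  rewrite integral_product // -(fineK (integrable_fin_num measurableT fi)) -EFinM -expr2; over.
apply: (@le_trans _ _ (\int[P]_(w in B) cst (h ^+ 2)%:E w)%E).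
  apply: ge0_le_integral => //.
  - by move=> w _; rewrite lee_fin sqr_ge0.
  - apply: measurable_funTS; apply/measurable_EFinP; apply: measurable_funX.
    apply: measurableT_comp => //; apply: measurable_kernel_integral => //.
    exact/measurable_EFinP.
  - move=> w Bw; rewrite lee_fin -[leLHS]real_normK ?num_real //.
    apply: lerXn2r; rewrite ?nnegrE //.
    rewrite -lee_fin; have := fh Bw.
    by rewrite -[X in (`|X| <= _)%E -> _](fineK (integrable_fin_num measurableT (square_integrable mf (f2 w)))).
rewrite integral_cst //; apply: le_trans (lee_wpmul2l _ (probability_le1 P mB)) _;
  by rewrite ?mule1 ?lee_fin ?sqr_ge0.
Qed.

Lemma mean_second_moment :
  (\int[P]_(w in B) ((n%:R^-1 * \sum_(k < n) f (Z k w)) ^+ 2)%:E <= (h ^+ 2 + c / n%:R)%:E)%E.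
Proof.
have nR0 : 0 < n%:R :> R by rewrite ltr0n.
have E2 w : ((n%:R^-1 * \sum_(k < n) f (Z k w)) ^+ 2)%:E =
    ((n%:R ^- 2)%:E * \sum_(k < n) \sum_(l < n) (f (Z k w) * f (Z l w))%:E)%E.
  rewrite exprMn -exprVn EFinM; congr (_ * _)%E.
  rewrite expr2 big_distrl /= -sumEFin; apply: eq_bigr => k _.
  by rewrite big_distrr /= -sumEFin.
under eq_integral do rewrite E2.
have ikl (k l : 'I_n) : P.-integrable B (fun w => (f (Z k w) * f (Z l w))%:E).
  exact: mean_term_product_integrable.
rewrite integralZl //; last by apply: integrable_sum => // k _; exact: integrable_sum.
rewrite integral_sum //; last by move=> k; exact: integrable_sum.
under eq_bigr do rewrite integral_sum //.
(* The diagonal terms, bounded by c, are granted the surplus h^2, so that the double sum is n^2 h^2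
   + n c. *)
apply: (@le_trans _ _ ((n%:R ^- 2)%:E * (\sum_(k < n) \sum_(l < n)
    (h ^+ 2 + (k == l)%:R * c)%:E))%E).
  apply: lee_wpmul2l; first by rewrite lee_fin invr_ge0 exprn_ge0.
  apply: lee_sum => k _; apply: lee_sum => l _.
  have [<-|kl] := eqVneq k l.
    apply: le_trans (mean_square_bound (ltn_ord k)) _.
    by rewrite lee_fin mul1r lerDr sqr_ge0.
  by rewrite mul0r addr0; apply: mean_cross_bound.
under eq_bigr do rewrite sumEFin.
rewrite sumEFin -EFinM lee_fin.
have sum1 (k : 'I_n) : \sum_(l < n) (h ^+ 2 + (k == l)%:R * c) = n%:R * h ^+ 2 + c.
  rewrite big_split /= sumr_const card_ord -[h ^+ 2 *+ n]mulr_natl; congr (_ + _).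
  rewrite (bigD1 k) //= eqxx mul1r big1 ?addr0 // => l lk.
  by rewrite eq_sym (negbTE lk) mul0r.
under eq_bigr do rewrite sum1.
rewrite sumr_const card_ord -mulr_natl le_eqVlt; apply/orP; left; apply/eqP.
by field; rewrite gt_eqF.
Qed.

Lemma mean_tail (e : R) : 0 < e ->
  (P (B `&` [set w | (e <= `|n%:R^-1 * \sum_(k < n) f (Z k w)|)%R]) <=
   ((h ^+ 2 + c / n%:R) / e ^+ 2)%:E)%E.
Proof.
move=> e0; pose M w := n%:R^-1 * \sum_(k < n) f (Z k w).
have mM : measurable_fun setT M.
  by apply: measurable_funM => //; apply: measurable_sum => k; exact: measurableT_comp.
have mA : measurable [set w | e <= `|M w|].
  rewrite -[X in measurable X]setTI.
  rewrite (_ : [set w | _] = (fun w => `|M w|) @^-1` `[e, +oo[%classic).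
    by apply: (measurableT_comp (@normr_measurable R setT) mM) => //; exact: measurable_itv.
  by apply/seteqP; split=> w /=; rewrite in_itv /= andbT.
rewrite EFinM lee_pdivlMr ?exprn_gt0 //; apply: le_trans mean_second_moment.
rewrite setIC -integral_indic // muleC -ge0_integralZl //; last 2 first.
- by apply: measurable_funTS; apply/measurable_EFinP; exact: measurable_indic.
- by rewrite lee_fin sqr_ge0.
apply: ge0_le_integral => //.
- by move=> w _; rewrite -EFinM lee_fin mulr_ge0 ?sqr_ge0.
- by apply: measurable_funTS; apply: measurable_funeM; apply/measurable_EFinP; exact: measurable_indic.
- by apply: measurable_funTS; apply/measurable_EFinP; exact: measurable_funX.
- move=> w _; rewrite -EFinM lee_fin indicE; have [/[!inE] /= Aw|_] := boolP (w \in _).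
    rewrite mulr1 -[leRHS]real_normK ?num_real //.
    by apply: lerXn2r; rewrite ?nnegrE // ltW.
  by rewrite mulr0 sqr_ge0.
Qed.

End second_moment_of_means.

Section law_of_large_numbers.
Context d (Omega : measurableType d) (R : realType) (P : probability Omega R).
Context d' (E : measurableType d') (C : nat -> set_system Omega) (n : nat -> nat)
  (Z : nat -> nat -> Omega -> E) (Q : nat -> Omega -> probability E R).
Hypotheses (mC : forall nu, C nu `<=` measurable) (noo : n nu @[nu --> \oo] --> \oo)
  (mZ : forall nu k, measurable_fun setT (Z nu k))
  (mQ : forall nu D, measurable D ->
     measurable_fun setT (fun w : g_sigma_algebraType (C nu) => Q nu w D))
  (QQ : forall nu k l D1 D2 B, (k < n nu)%N -> (l < n nu)%N -> k != l ->
     measurable D1 -> measurable D2 -> <<s C nu >> B ->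
     (P (B `&` (Z nu k @^-1` D1 `&` Z nu l @^-1` D2)) =
      \int[P]_(w in B) (Q nu w D1 * Q nu w D2))%E).

(** The law of one vector is a marginal of a pair law; the second index exists because there are at
    least two. *)
Lemma single_law nu k D B : (1 < n nu)%N -> (k < n nu)%N -> measurable D -> <<s C nu >> B ->
  (P (B `&` Z nu k @^-1` D) = \int[P]_(w in B) Q nu w D)%E.
Proof.
move=> n1 kn mD CB; have [l ln kl] : exists2 l, (l < n nu)%N & k != l.
  by case: k kn => [|k] kn; [exists 1%N|exists 0%N => //; exact: ltn_trans n1].
have := QQ kn ln kl mD measurableT CB; rewrite preimage_setT setIT => ->.
by apply: eq_integral => w _; rewrite probability_setT mule1.
Qed.

(** The moment bounds are required on events B of the data only, whose probability tends to 1, as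
    the unconditional moments may be infinite. The conditional mean need not vanish: it has to be at
    most h on B for every h, with c allowed to depend on h. *)
Lemma mean_cvg0 (f : E -> R) : measurable_fun setT f ->
  (forall nu w, (Q nu w).-integrable setT (fun x => (f x ^+ 2)%:E)) ->
  (forall h, 0 < h -> exists2 c, 0 <= c & exists B : nat -> set Omega,
    [/\ forall nu, <<s C nu >> (B nu), P (~` B nu) @[nu --> \oo] --> 0%E &
      forall nu w, B nu w -> (`| \int[Q nu w]_x (f x)%:E | <= h%:E)%E /\
        (\int[Q nu w]_x (f x ^+ 2)%:E <= c%:E)%E]) ->
  (n p.1)%:R^-1 * \sum_(k < n p.1) f (Z p.1 k p.2) @[p --> prob_filter P] --> (0 : R).
Proof.
move=> mf f2 fB.
suff : cvg_in_prob P (fun nu w => (n nu)%:R^-1 * \sum_(k < n nu) f (Z nu k w) : R^o) 0.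
  by move=> /cvg_in_probE.
move=> e e0; apply/fine_cvgP; split.
  apply: nearW => nu; rewrite ge0_fin_numE ?mu_ext_ge0 //.
  apply: (@le_lt_trans _ _ (mu_ext P setT)); first exact: le_mu_ext.
  by rewrite measurable_mu_extE // (le_lt_trans (probability_le1 _ _)) ?ltry.
apply/cvgrPdist_lt => r r0.
have [h h0 hr] : exists2 h, 0 < h & h ^+ 2 / e ^+ 2 < r / 3.
  exists (Num.min 1 (e ^+ 2 * r / 6)).
    by rewrite lt_min ltr01 /= divr_gt0 // mulr_gt0 // exprn_gt0.
  set h := Num.min _ _.
  have h1 : h <= 1 by rewrite ge_min lexx.
  have h2 : h <= e ^+ 2 * r / 6 by rewrite ge_min lexx orbT.
  have h0 : 0 <= h by rewrite le_min ler01 /= divr_ge0 // mulr_ge0 ?sqr_ge0 // ltW.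
  rewrite ltr_pdivrMr ?exprn_gt0 //.
  have : 0 < e ^+ 2 * r by rewrite mulr_gt0 // exprn_gt0.
  rewrite [r / 3 * _](_ : _ = (e ^+ 2 * r) / 3); last by ring.
  move: (e ^+ 2 * r) h2 => t h2 t0; nra.
have [c c0 [B [CB B0 QB]]] := fB h h0.
near=> nu.
have n1 : (1 < n nu)%N by near: nu; exact: (noo (nbhs_infty_ge 2%N)).
have cn : c / (n nu)%:R / e ^+ 2 < r / 3.
  have e2 : 0 < e ^+ 2 by rewrite exprn_gt0.
  have nb : (Num.trunc (3 * c / (r * e ^+ 2)) < n nu)%N.
    by near: nu; exact: (noo (nbhs_infty_ge (Num.trunc (3 * c / (r * e ^+ 2))).+1)).
  have : 3 * c / (r * e ^+ 2) < (n nu)%:R.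
    by apply: lt_le_trans (truncnS_gt _) _; rewrite ler_nat.
  rewrite ltr_pdivrMr ?mulr_gt0 // ltr_pdivrMr // ltr_pdivrMr ?ltr0n 1?ltnW //.
  move: (e ^+ 2) => t; nra.
have Br : (P (~` B nu) < (r / 3)%:E)%E.
  near: nu; have /fine_cvgP[fB0 /cvgrPdist_lt/(_ (r / 3))] := B0.
  rewrite divr_gt0 // => /(_ isT); apply: filterS2 fB0 => nu fB0.
  by rewrite /= sub0r normrN ger0_norm ?fine_ge0 // -lte_fin fineK.
have mB := sub_sigma_measurable (@mC nu) (CB nu).
rewrite /=; set A := [set w | _]; have mA : measurable A.
  pose M w := (n nu)%:R^-1 * \sum_(k < n nu) f (Z nu k w).
  have mM : measurable_fun setT M.
    by apply: measurable_funM => //; apply: measurable_sum => k; exact: measurableT_comp.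
  rewrite -[X in measurable X]setTI.
  rewrite (_ : A = (fun w => `|M w|) @^-1` `[e, +oo[%classic).
    by apply: (measurableT_comp (@normr_measurable R setT) mM) => //; exact: measurable_itv.
  by apply/seteqP; split=> w /=; rewrite /A /= in_itv /= andbT subr0.
rewrite sub0r normrN ger0_norm ?fine_ge0 ?mu_ext_ge0 // measurable_mu_extE //.
rewrite -lte_fin fineK ?fin_num_measure //.
have PBA : (P (B nu `&` A) <= ((h ^+ 2 + c / (n nu)%:R) / e ^+ 2)%:E)%E.
  have := @mean_tail _ Omega R P _ E (n nu) (Z nu) (B nu) (Q nu) f h c (ltnW n1)
    (mZ nu) mB (fun D mD => measurable_sub_sigma (@mC nu) (mQ mD))
    (fun k D kn mD => single_law n1 kn mD (CB nu))
    (fun k l D1 D2 kn ln kl m1 m2 => QQ kn ln kl m1 m2 (CB nu)) mf (ltW h0) c0 (f2 nu)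
    (fun w Bw => (QB nu w Bw).1) (fun w Bw => (QB nu w Bw).2) e e0.
  by rewrite (_ : [set w | (e <= _)%R] = A) //; apply/seteqP; split=> w; rewrite /A /= subr0.
apply: (@le_lt_trans _ _ (P (B nu `&` A) + P (~` B nu))%E).
  apply: le_trans (measureU2 _ _ _); rewrite ?le_measure ?inE //.
  - by apply: measurableU; [exact: measurableI|exact: measurableC].
  - by move=> w Aw; have [Bw|nBw] := pselect (B nu w); [left|right].
  - exact: measurableI.
  - exact: measurableC.
apply: lt_le_trans (lee_ltD _ PBA Br) _; last first.
  rewrite lee_fin mulrDl; move: hr cn; lra.
by rewrite fin_num_measure //; exact: measurableI.
Unshelve. all: by end_near. Qed.

End law_of_large_numbers.

(** * Consistency of sample covariance matrices *)

Lemma bessel_ratio_cvg (R : realType) :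
  m%:R / (m%:R - 1) @[m --> \oo] --> (1 : R).
Proof.
rewrite -(@cvg_shiftS R^o (fun m => m%:R / (m%:R - 1))).
rewrite (_ : [sequence _]_m = fun m => (1 - harmonic m)^-1 : R).
  have : (1 - harmonic m : R)^-1 @[m --> \oo] --> (1 - 0 : R)^-1.
    apply: cvgV; first by rewrite subr0 oner_neq0.
    by apply: cvgB; [exact: cvg_cst|exact: cvg_harmonic].
  by rewrite subr0 invr1.
(* For m = 0 both sides are 0, because the inverse of 0 is 0. *)
apply/funext => -[|m] /=; first by rewrite subrr invr0 mulr0 /harmonic /= invr1 subrr invr0.
have x0 : m.+1%:R + 1 != 0 :> R by rewrite natr1 pnatr_eq0.
by rewrite /harmonic /= -natr1 addrK -[X in (_ - X)^-1]mul1r -[X in (X - _)^-1](divff x0) -mulrBl addrK invf_div.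
Qed.

(** The number s will be the limiting covariance: subtracting it inside the average leaves means
    that tend to 0, to which [mean_cvg0] applies. *)
Lemma sum_deviation_products (R : numFieldType) n (u v : nat -> R) (s : R) :
  \sum_(k < n) (u k - n%:R^-1 * \sum_(i < n) u i) * (v k - n%:R^-1 * \sum_(i < n) v i) =
  n%:R * (n%:R^-1 * (\sum_(k < n) (u k * v k - s)) + s -
    (n%:R^-1 * \sum_(k < n) u k) * (n%:R^-1 * \sum_(k < n) v k)).
Proof.
have [->|n0] := eqVneq n 0%N; first by rewrite big_ord0 mul0r.
have nR : n%:R != 0 :> R by rewrite pnatr_eq0.
set A := \sum_(i < n) u i; set B := \sum_(i < n) v i.
under eq_bigr do rewrite mulrBl !mulrBr opprB.
rewrite big_split /= 2!sumrB -mulr_suml [in RHS]sumrB !sumr_const card_ord -/A -/B.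
rewrite -[_ * _ *+ n]mulr_natl -[s *+ n]mulr_natl -mulr_sumr -/B.
by field.
Qed.

Lemma sample_cov_entry (R : realType) q n (x : nat -> 'cV[R]_q) (S : 'M[R]_q) j l :
  sample_cov n x j l = n%:R / (n%:R - 1) *
   (n%:R^-1 * (\sum_(k < n) (x k j 0 * x k l 0 - S j l)) + S j l -
    (n%:R^-1 * \sum_(k < n) x k j 0) * (n%:R^-1 * \sum_(k < n) x k l 0)).
Proof.
rewrite mxE summxE [n%:R / _]mulrC -[in RHS](mulrA (_ - 1)^-1); congr (_ * _).
have mE i : sample_mean n x i 0 = n%:R^-1 * \sum_(k < n) x k i 0 by rewrite mxE summxE.
have /= <- := sum_deviation_products n (fun k => x k j 0) (fun k => x k l 0) (S j l).
apply: eq_bigr => k _; rewrite mxE big_ord1 -!mE.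
by move: (sample_mean n x) => m; rewrite !mxE.
Qed.

Lemma sqr_mulB_le (R : realFieldType) (u v s : R) :
  (u * v - s) ^+ 2 <= u ^+ 4 + v ^+ 4 + 2 * s ^+ 2.
Proof. have := sqr_ge0 (u * v + s); have := sqr_ge0 (u ^+ 2 - v ^+ 2); nra. Qed.

Section sample_covariance_consistency.
Context d (Omega : measurableType d) (R : realType) (P : probability Omega R).
Variables (q : nat) (C : nat -> set_system Omega) (n : nat -> nat)
  (Z : nat -> nat -> Omega -> 'cV[R]_q) (Q : nat -> Omega -> probability 'cV[R]_q R).
Hypotheses (mC : forall nu, C nu `<=` measurable) (noo : n nu @[nu --> \oo] --> \oo)
  (mZ : forall nu k, measurable_fun setT (Z nu k))
  (mQ : forall nu D, measurable D ->
     measurable_fun setT (fun w : g_sigma_algebraType (C nu) => Q nu w D))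
  (QQ : forall nu k l D1 D2 B, (k < n nu)%N -> (l < n nu)%N -> k != l ->
     measurable D1 -> measurable D2 -> <<s C nu >> B ->
     (P (B `&` (Z nu k @^-1` D1 `&` Z nu l @^-1` D2)) =
      \int[P]_(w in B) (Q nu w D1 * Q nu w D2))%E).
Variables (T : nat -> Omega -> 'M[R]_q) (S : 'M[R]_q) (c : R).
Hypotheses (c0 : 0 <= c) (TS : T p.1 p.2 @[p --> prob_filter P] --> S)
  (Q1 : forall nu w j, (\int[Q nu w]_x (x j 0)%:E = 0)%E)
  (Q2 : forall nu w j l, (\int[Q nu w]_x (x j 0 * x l 0)%:E = (T nu w j l)%:E)%E)
  (Q4 : forall nu w j, (\int[Q nu w]_x (x j 0 ^+ 4)%:E <= (c * (1 + T nu w j j ^+ 2))%:E)%E).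

Let mX j : measurable_fun setT (fun x : 'cV[R]_q => x j 0).
Proof. exact: measurable_coord. Qed.

Lemma fourth_power_integrable nu w j : (Q nu w).-integrable setT (fun x => (x j 0 ^+ 4)%:E).
Proof.
apply/integrableP; split; first by apply/measurable_EFinP; exact: measurable_funX.
under eq_integral do rewrite gee0_abs ?lee_fin ?(exprM _ 2 2) ?sqr_ge0 //.
under eq_integral do rewrite -exprM.
exact: le_lt_trans (Q4 nu w j) (ltry _).
Qed.

Lemma square_power_integrable nu w j : (Q nu w).-integrable setT (fun x => (x j 0 ^+ 2)%:E).
Proof.
apply: (@square_integrable _ _ R (Q nu w) (fun x : 'cV[R]_q => x j 0 ^+ 2)).
  exact: measurable_funX.
by under eq_fun do rewrite -exprM; exact: fourth_power_integrable.
Qed.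

Lemma coordinate_product_integrable nu w j l :
  (Q nu w).-integrable setT (fun x => (x j 0 * x l 0)%:E).
Proof.
apply: (@le_integrable _ _ _ _ _ measurableT _
  (fun x : 'cV[R]_q => (x j 0 ^+ 2)%:E + (x l 0 ^+ 2)%:E)%E).
- by apply/measurable_EFinP; exact: measurable_funM.
- move=> x _ /=; rewrite lee_fin [leRHS]ger0_norm ?addr_ge0 ?sqr_ge0 //.
  rewrite ler_norml; move: (x j 0) (x l 0) => u v; apply/andP; split; nra.
- by apply: integrableD => //; exact: square_power_integrable.
Qed.

(** The entries of T are integrals of the kernel Q by the hypothesis on second moments, which makes
    these events measurable with respect to the data. *)
Lemma second_moments_near h : 0 < h -> exists B : nat -> set Omega,
  [/\ forall nu, <<s C nu >> (B nu), P (~` B nu) @[nu --> \oo] --> 0%E &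
    forall nu w, B nu w -> forall j l, `|T nu w j l - S j l| <= h].
Proof.
move=> h0; pose B nu := [set w | forall j l, `|T nu w j l - S j l| <= h].
have CB nu : <<s C nu >> (B nu).
  have mT j l : measurable_fun setT (fun w : g_sigma_algebraType (C nu) => T nu w j l).
    rewrite (_ : (fun w => _) = fun w => fine (\int[Q nu w]_x (x j 0 * x l 0)%:E)%E).
      apply: measurableT_comp => //.
      apply: (@measurable_kernel_integral _ (g_sigma_algebraType (C nu)) R _ _ (Q nu)); first exact: mQ.
      by apply/measurable_EFinP; exact: measurable_funM.
    by apply/funext => w; rewrite Q2.
  rewrite (_ : B nu = \bigcap_(j in [set: 'I_q]) \bigcap_(l in [set: 'I_q])
      (fun w => `|T nu w j l - S j l|) @^-1` `]-oo, h]%classic).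
    apply: (@fin_bigcap_measurable _ (g_sigma_algebraType (C nu))) => // j _.
    apply: (@fin_bigcap_measurable _ (g_sigma_algebraType (C nu))) => // l _.
    rewrite -[X in measurable X]setTI.
    have mTS := measurable_funB (mT j l) (measurable_cst (S j l)).
    by apply: (measurableT_comp (@normr_measurable R setT) mTS) => //; exact: measurable_itv.
  apply/seteqP; split=> w /= H; first by move=> j _ l _ /=; rewrite in_itv /=.
  by move=> j l; have /= := H j I l I; rewrite in_itv.
exists B; split => //.
have : \forall p \near prob_filter P, forall j l, `|T p.1 p.2 j l - S j l| <= h.
  apply: filter_forall => j; apply: filter_forall => l.
  have TSjl : T p.1 p.2 j l @[p --> prob_filter P] --> S j l by exact: coord_cvg.
  by move: TSjl => /cvgrPdistC_le; apply.
rewrite /prob_filter /nbhs /= => H; apply: cvg_trans H; apply: near_eq_cvg; apply: nearW => nu.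
by rewrite measurable_mu_extE //; apply: measurableC; exact: (sub_sigma_measurable (@mC nu) (CB nu)).
Qed.

(** Serves both for Y, where T is the estimate of Upsilon, and for the residuals, where T is
    constant. The fourth moment bound c (1 + T j j ^+ 2) fits both: for a normal coordinate that
    moment is a multiple of the squared variance, for the residuals it is a fixed finite number. *)
Lemma sample_cov_cvg :
  sample_cov (n p.1) (fun k => Z p.1 k p.2) @[p --> prob_filter P] --> S.
Proof.
have diag_bound nu w j h : h <= 1 -> `|T nu w j j - S j j| <= h -> `|T nu w j j| <= `|S j j| + 1.
  move=> h1 Th; rewrite -[T _ _ _ _](subrK (S j j)) addrC.
  by apply: le_trans (ler_normD _ _) _; rewrite lerD2l (le_trans Th).
have mdev j l : measurable_fun setT (fun x : 'cV[R]_q => x j 0 * x l 0 - S j l).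
  by apply: measurable_funB => //; exact: measurable_funM.
have isum nu w j l : (Q nu w).-integrable setT (fun x : 'cV[R]_q =>
    (x j 0 ^+ 4)%:E + (x l 0 ^+ 4)%:E + (2 * S j l ^+ 2)%:E)%E.
  apply: integrableD => //; last exact: finite_measure_integrable_cst.
  by apply: integrableD => //; exact: fourth_power_integrable.
have pow4_ge0 (u : R) : 0 <= u ^+ 4 by rewrite (exprM _ 2 2) sqr_ge0.
have cprod j l : (n p.1)%:R^-1 *
    \sum_(k < n p.1) (Z p.1 k p.2 j 0 * Z p.1 k p.2 l 0 - S j l) @[p --> prob_filter P] --> (0 : R).
  apply: (mean_cvg0 mC noo mZ mQ QQ (f := fun x : 'cV[R]_q => x j 0 * x l 0 - S j l)) => //.
  - move=> nu w; apply: le_integrable (isum nu w j l) => //.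
      by apply/measurable_EFinP; exact: measurable_funX.
    move=> x _ /=; rewrite lee_fin ger0_norm ?sqr_ge0 // ger0_norm; first exact: sqr_mulB_le.
    exact: le_trans (sqr_ge0 _) (sqr_mulB_le _ _ _).
  (* Closeness h bounds the conditional mean of the deviation, while closeness 1 bounds the
     variances, so the constant below is independent of h. *)
  - move=> h h0; have m0 : 0 < Num.min h 1 by rewrite lt_min h0 ltr01.
    have [B [CB B0 BT]] := second_moments_near m0.
    exists (c * (1 + (`|S j j| + 1) ^+ 2) + c * (1 + (`|S l l| + 1) ^+ 2) + 2 * S j l ^+ 2).
      by rewrite !addr_ge0 // mulr_ge0 ?addr_ge0 ?sqr_ge0.
    exists B; split=> // nu w Bw; split.
      under eq_integral do rewrite EFinB.
      rewrite integralB //; first last.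
      - exact: finite_measure_integrable_cst.
      - exact: coordinate_product_integrable.
      rewrite Q2 integral_cst // [X in (_ - _ * X)%E]probability_setT mule1 lee_fin.
      by apply: le_trans (BT nu w Bw j l) _; rewrite ge_min lexx.
    have mm : Num.min h 1 <= 1 by rewrite ge_min lexx orbT.
    have Q4' i : (\int[Q nu w]_x (x i 0 ^+ 4)%:E <= (c * (1 + (`|S i i| + 1) ^+ 2))%:E)%E.
      apply: le_trans (Q4 nu w i) _; rewrite lee_fin ler_wpM2l // lerD2l -[leLHS]real_normK ?num_real //.
      by apply: lerXn2r; rewrite ?nnegrE ?addr_ge0 //; exact: diag_bound mm (BT nu w Bw i i).
    apply: (@le_trans _ _ (\int[Q nu w]_x
        ((x j 0 ^+ 4)%:E + (x l 0 ^+ 4)%:E + (2 * S j l ^+ 2)%:E))%E).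
      apply: ge0_le_integral => //.
      - by move=> x _; rewrite lee_fin sqr_ge0.
      - by apply/measurable_EFinP; exact: measurable_funX.
      - exact: measurable_int (isum nu w j l).
      - by move=> x _; rewrite lee_fin; exact: sqr_mulB_le.
    rewrite integralD //; last exact: finite_measure_integrable_cst; last first.
      by apply: integrableD => //; exact: fourth_power_integrable.
    rewrite integralD ?integral_cst //; do ?exact: fourth_power_integrable.
    rewrite [X in (_ + _ * X)%E]probability_setT mule1 EFinD; apply: leeD => //.
    by rewrite EFinD; apply: leeD.
have cmean j : (n p.1)%:R^-1 * \sum_(k < n p.1) Z p.1 k p.2 j 0 @[p --> prob_filter P] --> (0 : R).
  apply: (mean_cvg0 mC noo mZ mQ QQ (f := fun x : 'cV[R]_q => x j 0)) => //.
  - by move=> nu w; exact: square_power_integrable.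
  - move=> h h0; have [B [CB B0 BT]] := second_moments_near ltr01.
    exists (`|S j j| + 1); first by rewrite addr_ge0.
    exists B; split=> // nu w Bw; rewrite Q1 abse0 lee_fin ltW //; split=> //.
    rewrite Q2 lee_fin; apply: le_trans (ler_norm _) _.
    exact: diag_bound (lexx _) (BT nu w Bw j j).
apply: mx_cvg => j l.
rewrite (_ : (fun p => _) = fun p => (n p.1)%:R / ((n p.1)%:R - 1) *
  ((n p.1)%:R^-1 * (\sum_(k < n p.1) (Z p.1 k p.2 j 0 * Z p.1 k p.2 l 0 - S j l)) + S j l -
    ((n p.1)%:R^-1 * \sum_(k < n p.1) Z p.1 k p.2 j 0) *
    ((n p.1)%:R^-1 * \sum_(k < n p.1) Z p.1 k p.2 l 0))); last first.
  by apply/funext => p; exact: sample_cov_entry.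
rewrite [X in _ --> X](_ : _ = 1 * (0 + S j l - 0 * 0)); last by rewrite mul1r add0r mul0r subr0.
apply: cvgM.
  apply: (@cvg_deterministic _ _ _ P R^o (fun nu => (n nu)%:R / ((n nu)%:R - 1)) 1).
  have := @bessel_ratio_cvg R => /(cvg_comp _ _ noo); exact.
by apply: cvgB; [apply: cvgD => //; exact: cvg_cst|exact: cvgM].
Qed.

End sample_covariance_consistency.

Section normal_moments.
Variables (R : realType) (q : nat) (S : 'M[R]_q) (L : probability 'cV[R]_q R).
Hypothesis LS : is_mvnormal 0 S L.
Notation gamma := (normal_prob (0 : R) 1).

Lemma mvnormal_coord_mean j : (\int[L]_x (x j 0)%:E = 0)%E.
Proof.
by rewrite -(mvnormal_first LS (delta_mx j 0)); apply: eq_integral => x _; rewrite linform_delta.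
Qed.

Lemma mvnormal_coord_fourth j :
  (\int[L]_x (x j 0 ^+ 4)%:E = ((fine (\int[gamma]_z (z ^+ 4)%:E)) * S j j ^+ 2)%:E)%E.
Proof.
have := mvnormal_fourth LS (delta_mx j 0); rewrite qform_delta => E.
rewrite mulrC EFinM fineK ?ge0_fin_numE ?gamma_fourth_lty //; last first.
  by apply: integral_ge0 => z _; rewrite lee_fin exprn_even_ge0.
by rewrite -E; apply: eq_integral => x _; rewrite linform_delta.
Qed.

(** Polarization: [is_mvnormal] describes linear forms only, so a product is recovered from squares
    of the forms for e_j + e_l, e_j and e_l. *)
Lemma mvnormal_coord_product j l : (\int[L]_x (x j 0 * x l 0)%:E = (S j l)%:E)%E.
Proof.
have i2 c := mvnormal_linform_integrable LS c (isT : (2 <= 4)%N).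
pose dj : 'cV[R]_q := delta_mx j 0; pose dl : 'cV[R]_q := delta_mx l 0.
have E (x : 'cV[R]_q) : (x j 0 * x l 0)%:E =
    (2^-1%:E * ((linform (dj + 1 *: dl) x ^+ 2)%:E - (linform dj x ^+ 2)%:E -
      (linform dl x ^+ 2)%:E))%E.
  have -> : linform (dj + 1 *: dl) x = x j 0 + x l 0.
    by rewrite scale1r linearD /= mulmxDl mxE !linform_delta.
  rewrite !linform_delta -!EFinB -EFinM; congr (_%:E); by field.
under eq_integral do rewrite E.
rewrite integralZl //; last by apply: integrableB => //; exact: integrableB.
rewrite integralB //; last exact: integrableB.
rewrite integralB // !(mvnormal_second LS) qformD; last exact: LS.1.1.
rewrite !qform_delta linform_delta -!EFinB -EFinM; congr (_%:E).
have -> : (S *m dl) j 0 = S j l.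
  rewrite mxE (bigD1 l) //= mxE !eqxx mulr1 big1 ?addr0 // => i il.
  by rewrite mxE (negbTE il) mulr0.
by field.
Qed.

End normal_moments.

Section residual_covariance_consistency.
Context d (Omega : measurableType d) (R : realType) (P : probability Omega R).
Variables (q : nat) (Z : nat -> Omega -> 'cV[R]_q) (n : nat -> nat) (V : 'M[R]_q).
Hypotheses (mZ : forall k, measurable_fun setT (Z k)) (noo : n nu @[nu --> \oo] --> \oo)
  (indepZ : forall k l A B, k != l -> measurable A -> measurable B ->
     (P (Z k @^-1` A `&` Z l @^-1` B) = P (Z k @^-1` A) * P (Z l @^-1` B))%E)
  (identZ : forall k A, measurable A -> P (Z k @^-1` A) = P (Z 0%N @^-1` A))
  (Z4 : ('E_P[fun w => (enorm (Z 0%N w) ^+ 4)%R] < +oo)%E)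
  (Z1 : meanv P (Z 0%N) = 0) (ZV : V = covmx P (Z 0%N)).

Lemma enorm_fourth (x : 'cV[R]_q) : enorm x ^+ 4 = (\sum_j x j 0 ^+ 2) ^+ 2.
Proof. by rewrite (exprM _ 2 2) sqr_sqrtr // sumr_ge0 // => i _; exact: sqr_ge0. Qed.

Lemma coord_le_enorm (x : 'cV[R]_q) j : x j 0 ^+ 4 <= enorm x ^+ 4.
Proof.
rewrite enorm_fourth (exprM _ 2 2); have s0 i : 0 <= x i 0 ^+ 2 by exact: sqr_ge0.
by apply: lerXn2r; rewrite ?nnegrE ?sumr_ge0 // (bigD1 j) //= lerDl sumr_ge0.
Qed.

(** Lets unconditional independence be read as conditional independence given the sigma-algebra
    generated by no sets. *)
Lemma trivial_sigma_algebra (T : Type) (B : set T) : <<s set0 >> B -> B = set0 \/ B = setT.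
Proof.
suff : <<s set0 >> `<=` [set A : set T | A = set0 \/ A = setT] by apply.
apply: smallest_sub => //; split=> [|A [->|->]|A AE].
- by left.
- by right; rewrite setD0.
- by left; rewrite setDv.
- have [[k Ak]|nA] := pselect (exists k, A k = setT).
    by right; apply/seteqP; split=> // x _; exists k => //; rewrite Ak.
  left; apply/seteqP; split=> // x [k _].
  by have [->//|Ak] := AE k; case: nA; exists k.
Qed.

Lemma sample_cov_shift n0 (m : 'cV[R]_q) (x : nat -> 'cV[R]_q) :
  sample_cov n0 (fun k => m + x k) = sample_cov n0 x.
Proof.
have [->|n0P] := eqVneq n0 0%N; first by rewrite /sample_cov !big_ord0.
have mE : sample_mean n0 (fun k => m + x k) = m + sample_mean n0 x.
  rewrite /sample_mean big_split /= scalerDr sumr_const card_ord -[m *+ _]scaler_nat scalerA.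
  by rewrite mulVf ?scale1r // pnatr_eq0.
rewrite /sample_cov mE; congr (_ *: _); apply: eq_bigr => k _.
have -> : m + x k - (m + sample_mean n0 x) = x k - sample_mean n0 x by rewrite opprD addrACA subrr add0r.
by [].
Qed.

(** The case of [sample_cov_cvg] in which the kernel is constantly the law of one residual; c is the
    fourth moment of its norm, which bounds those of the coordinates. *)
Lemma residual_sample_cov_cvg :
  sample_cov (n p.1) (fun k => Z k p.2) @[p --> prob_filter P] --> V.
Proof.
have [L LE] := image_law P (mZ 0%N).
have LE' A : measurable A -> L A = P (Z 0%N @^-1` A) by move=> _; exact: LE.
have mc j : measurable_fun setT (fun w => Z 0%N w j 0) by exact: measurable_fun_coord.
have mx j := measurable_coord (R := R) (q := q) j.
have ie : P.-integrable setT (fun w => (enorm (Z 0%N w) ^+ 4)%:E).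
  apply/integrableP; split.
    apply/measurable_EFinP; under eq_fun do rewrite enorm_fourth.
    by apply: measurable_funX; apply: measurable_sum => j; exact: measurable_funX.
  under eq_integral do rewrite gee0_abs ?lee_fin ?exprn_even_ge0 //.
  by move: Z4; rewrite unlock.
have i4 j : P.-integrable setT (fun w => (Z 0%N w j 0 ^+ 4)%:E).
  apply: le_integrable ie => //; first by apply/measurable_EFinP; exact: measurable_funX.
  by move=> w _ /=; rewrite lee_fin !ger0_norm ?exprn_even_ge0 // coord_le_enorm.
have i2 j : P.-integrable setT (fun w => (Z 0%N w j 0 ^+ 2)%:E).
  apply: (@square_integrable _ _ R P (fun w => Z 0%N w j 0 ^+ 2)); first exact: measurable_funX.
  by under eq_fun do rewrite -exprM; exact: i4.
have i1 j : P.-integrable setT (fun w => (Z 0%N w j 0)%:E).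
  exact: square_integrable (mc j) (i2 j).
have iprod j l : P.-integrable setT (fun w => (Z 0%N w j 0 * Z 0%N w l 0)%:E).
  apply: (@le_integrable _ _ _ _ _ measurableT _
    (fun w => (Z 0%N w j 0 ^+ 2)%:E + (Z 0%N w l 0 ^+ 2)%:E)%E).
  - by apply/measurable_EFinP; exact: measurable_funM.
  - move=> w _ /=; rewrite lee_fin [leRHS]ger0_norm ?addr_ge0 ?sqr_ge0 //.
    rewrite ler_norml; move: (Z 0%N w j 0) (Z 0%N w l 0) => u v; apply/andP; split; nra.
  - by apply: integrableD.
have mean0 j : (\int[P]_w (Z 0%N w j 0)%:E = 0)%E.
  have /matrixP/(_ j 0) := Z1; rewrite !mxE unlock => E.
  by rewrite -(fineK (integrable_fin_num measurableT (i1 j))) E.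
pose c := fine ('E_P[fun w => (enorm (Z 0%N w) ^+ 4)%R]).
have cE : (c%:E = \int[P]_w (enorm (Z 0%N w) ^+ 4)%:E)%E.
  by rewrite /c unlock fineK // integrable_fin_num.
have c0 : 0 <= c.
  by rewrite -lee_fin cE; apply: integral_ge0 => w _; rewrite lee_fin exprn_even_ge0.
have VE j l : (V j l)%:E = (\int[P]_w (Z 0%N w j 0 * Z 0%N w l 0)%:E)%E.
  rewrite ZV mxE unlock unlock !mean0 /= -[RHS](fineK (integrable_fin_num measurableT (iprod j l))).
  by congr (fine _)%:E; apply: eq_integral => w _; rewrite !fctE /= !subr0.
apply: (@sample_cov_cvg _ Omega R P q (fun=> set0) n (fun=> Z) (fun _ _ => L) _ noo _ _ _
  (fun _ _ => V) V c) => //.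
- by move=> nu A.
- move=> nu k l D1 D2 B kn ln kl m1 m2 /trivial_sigma_algebra[->|->].
    by rewrite set0I measure0 integral_set0.
  rewrite setTI integral_cst // [X in (_ * X)%E]probability_setT mule1.
  by rewrite indepZ // !LE (identZ _ m1) (identZ _ m2).
- exact: cvg_cst.
- by move=> nu w j; rewrite (integral_image_law (mZ 0%N) LE'); [exact: mean0|exact/measurable_EFinP|exact: i1].
- move=> nu w j l; rewrite VE (integral_image_law (mZ 0%N) LE'); [by []| |exact: iprod].
  by apply/measurable_EFinP; exact: measurable_funM.
- move=> nu w j; rewrite (ge0_integral_image_law (mZ 0%N) LE'); last 2 first.
  + by apply/measurable_EFinP; exact: measurable_funX.
  + by move=> x; rewrite lee_fin exprn_even_ge0.
  apply: (@le_trans _ _ c%:E).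
    rewrite cE; apply: ge0_le_integral => //.
    * by move=> w' _; rewrite lee_fin exprn_even_ge0.
    * by apply/measurable_EFinP; exact: measurable_funX.
    * exact: measurable_int ie.
    * by move=> w' _; rewrite lee_fin coord_le_enorm.
  by rewrite lee_fin ler_peMr // lerDl sqr_ge0.
Qed.

End residual_covariance_consistency.

(** * Conditional laws of the means *)

Section conditional_law_of_means.
Context d (Omega : measurableType d) (R : realType) (P : probability Omega R).
Variables (C : set_system Omega) (a q : nat) (n : 'I_a -> nat).
Variables (Y : 'I_a -> nat -> Omega -> 'cV[R]_q) (S : 'I_a -> Omega -> 'M[R]_q).
Hypotheses (mC : C `<=` measurable) (mY : forall i k, measurable_fun setT (Y i k))
  (YS : cond_indep_normal P <<s C >> n Y S).

(** The list r covers both assertions on means: a single group with a scalar matrix, or all groups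
    with scaled block embeddings. *)
Lemma cond_law_weighted_means m (F : 'I_a -> 'M[R]_(m, q)) (r : seq 'I_a) : uniq r ->
  exists K : Omega -> probability 'cV[R]_m R,
    (forall w, is_mvnormal 0
      (\sum_(i <- r) (n i)%:R^-1 *: (F i *m S i w *m (F i)^T)) (K w)) /\
    cond_law P <<s C >>
      (fun w => \sum_(i <- r) F i *m sample_mean (n i) (fun k => Y i k w)) K.
Proof.
move=> ur; have [Q [mQ NQ YQ]] := YS.
pose J := [seq (i, k) | i <- r, k <- iota 0 (n i)].
have uJ : uniq J by apply: allpairs_uniq_dep => // [i _|[i k] [j l] _ _ /= [-> ->]//]; exact: iota_uniq.
have Jn j : j \in J -> (j.2 < n j.1)%N.
  by move=> /allpairsPdep[i [k [_ + ->]]] /=; rewrite mem_iota.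
have [K [NK KE]] := cond_law_linear_sum mC mY mQ YQ NQ
  (fun j : 'I_a * nat => (n j.1)%:R^-1 *: F j.1) uJ Jn.
have iotaE i : iota 0 (n i) = index_iota 0 (n i) by rewrite /index_iota subn0.
exists K; split=> [w|].
  rewrite (_ : \sum_(i <- r) _ =
    \sum_(j <- J) ((n j.1)%:R^-1 *: F j.1) *m S j.1 w *m ((n j.1)%:R^-1 *: F j.1)^T) //.
  rewrite big_allpairs_dep; apply: eq_bigr => i _ /=.
  rewrite iotaE big_mkord sumr_const card_ord linearZ /= -!scalemxAl -scalemxAr scalerA.
  rewrite -[RHS]scaler_nat scalerA; congr (_ *: _).
  (* There are n i equal terms, each with the squared weight of the mean; for an empty group both
     sides vanish because the inverse of 0 is 0. *)
  have [->|n0] := eqVneq (n i) 0%N; first by rewrite invr0 mul0r.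
  by rewrite mulrA divff ?mul1r // pnatr_eq0.
rewrite (_ : (fun w => _) = fun w => \sum_(j <- J) ((n j.1)%:R^-1 *: F j.1) *m Y j.1 j.2 w) //.
apply/funext => w; rewrite big_allpairs_dep; apply: eq_bigr => i _ /=.
rewrite iotaE big_mkord -mulmx_sumr /sample_mean -scalemxAl -scalemxAr //.
Qed.

End conditional_law_of_means.

Theorem theorem4p1
  (R : realType) (dO : measure_display) (Omega : measurableType dO)
  (P : probability Omega R) (d a : nat) (hd : (2 <= d)%N) (ha : (1 <= a)%N)
  (mu : 'I_a -> 'cV[R]_d) (eps X : 'I_a -> nat -> Omega -> 'cV[R]_d)
  (hX : forall i k w, X i k w = mu i + eps i k w)
  (heps : forall i k, measurable_fun setT (eps i k))
  (hindep : mutually_independent P (fun ik : 'I_a * nat => eps ik.1 ik.2))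
  (hident : forall i k A, measurable A ->
     P (eps i k @^-1` A) = P (eps i 0%N @^-1` A))
  (hmom : forall i, ('E_P[fun w => (enorm (eps i 0%N w) ^+ 4)%R] < +oo)%E)
  (hmean : forall i, meanv P (eps i 0%N) = 0)
  (V : 'I_a -> 'M[R]_d) (hV : forall i, V i = covmx P (eps i 0%N))
  (hVpos : forall i j, 0 < V i j j)
  (Sigma : 'I_a -> 'M[R]_(dimp d))
  (hSigma : forall i, Sigma i =
     covmx P (fun w => vech (eps i 0%N w *m (eps i 0%N w)^T)))
  (n : nat -> 'I_a -> nat) (N : nat -> nat)
  (hN : forall nu, N nu = (\sum_(i < a) n nu i)%N)
  (hn : forall b : nat, \forall nu \near \oo, forall i, (b <= n nu i)%N)
  (kappa : 'I_a -> R) (hkappa : forall i, 0 < kappa i <= 1)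
  (hnN : forall i, (n nu i)%:R / (N nu)%:R @[nu --> \oo] --> kappa i)
  (G : nat -> set_system Omega) (hG : forall nu, G nu = data_sigma (n nu) X)
  (Vhat : nat -> 'I_a -> Omega -> 'M[R]_d)
  (hVhat : forall nu i w, Vhat nu i w = sample_cov (n nu i) (fun k => X i k w))
  (Sigmahat : nat -> 'I_a -> Omega -> 'M[R]_(dimp d))
  (hSh_data : forall nu i, measurable_wrt (G nu) (Sigmahat nu i))
  (hSh_psd : forall nu i w, psdmx (Sigmahat nu i w))
  (hSh_cons : forall i,
     cvg_in_prob P (fun nu => Sigmahat nu i) (Sigma i))
  (Y : nat -> 'I_a -> nat -> Omega -> 'cV[R]_(dimpu d))
  (hYm : forall nu i k, measurable_fun setT (Y nu i k))
  (hY : forall nu, cond_indep_normal P (G nu) (n nu) (Y nu)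
     (fun i w => Upsilon (Vhat nu i w) (Sigmahat nu i w)))
  (Ybar : nat -> 'I_a -> Omega -> 'cV[R]_(dimpu d))
  (hYbar : forall nu i w,
     Ybar nu i w = sample_mean (n nu i) (fun k => Y nu i k w))
  (Upsdag : nat -> 'I_a -> Omega -> 'M[R]_(dimpu d))
  (hUpsdag : forall nu i w,
     Upsdag nu i w = sample_cov (n nu i) (fun k => Y nu i k w)) :
  [/\ forall i, cond_cvg_normal P G
        (fun nu w => Num.sqrt (N nu)%:R *: Ybar nu i w)
        0 ((kappa i)^-1 *: Upsilon (V i) (Sigma i)),
      cond_cvg_normal P G
        (fun nu w => Num.sqrt (N nu)%:R *: (\mxcol_(i < a) Ybar nu i w))
        0 (\mxdiag_(i < a) ((kappa i)^-1 *: Upsilon (V i) (Sigma i))),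
      forall i, cvg_in_prob P (fun nu => Upsdag nu i)
        (Upsilon (V i) (Sigma i)) &
      cvg_in_prob P
        (fun nu w => \mxdiag_(i < a)
           (((N nu)%:R / (n nu i)%:R) *: Upsdag nu i w))
        (\mxdiag_(i < a) ((kappa i)^-1 *: Upsilon (V i) (Sigma i)))].
Proof.
pose C nu : set_system Omega := [set B | exists i k A,
  [/\ (k < n nu i)%N, measurable A & B = X i k @^-1` A]].
have mC nu : C nu `<=` measurable.
  move=> _ [i [k [A [_ mA ->]]]]; rewrite -[X in measurable X]setTI.
  have -> : X i k = fun w => mu i + eps i k w by apply/funext.
  apply: measurable_fun_vector => // j; under eq_fun do rewrite mxE.
  by apply: measurable_funD => //; apply: measurable_fun_coord; exact: heps.
have {hG} EG : G = fun nu => <<s C nu >> by apply/funext => nu; rewrite hG.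
subst G.
have noo i : n nu i @[nu --> \oo] --> \oo.
  move=> A [b _ bA]; have := hn b; apply: filterS => nu bn; exact/bA/bn.
have VV i : Vhat p.1 i p.2 @[p --> prob_filter P] --> V i.
  rewrite (_ : (fun p => _) = fun p => sample_cov (n p.1 i) (fun k => eps i k p.2)).
    apply: (residual_sample_cov_cvg (heps i) (noo i) _ (hident i) (hmom i) (hmean i) (hV i)).
    move=> k l A B kl mA mB.
    have lk : ((i, l) == (i, k)) = false by rewrite xpair_eqE eqxx eq_sym (negbTE kl).
    have := hindep [:: (i, k); (i, l)] (fun ik => if ik == (i, k) then A else B).
    rewrite !big_cons big_nil mule1 eqxx lk => <- //; last 2 first.
    - by rewrite /= inE eq_sym lk.
    - by move=> ik; case: ifP.
    congr (P _); apply/seteqP; split=> w /=.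
      by move=> [wA wB] ik; rewrite !inE => /orP[]/eqP->; rewrite ?eqxx ?lk.
    move=> H; split; first by have := H (i, k); rewrite eqxx; apply; rewrite mem_head.
    by have := H (i, l); rewrite lk; apply; rewrite !inE eqxx orbT.
  apply/funext => p; rewrite hVhat -[RHS](sample_cov_shift _ (mu i)).
  by rewrite (_ : (fun k => X i k p.2) = fun k => mu i + eps i k p.2) //; apply/funext.
pose T nu i w := Upsilon (Vhat nu i w) (Sigmahat nu i w).
have TT i : T p.1 i p.2 @[p --> prob_filter P] --> Upsilon (V i) (Sigma i).
  by apply: Upsilon_cvg => //; apply/(cvg_in_probE P (fun nu => Sigmahat nu i)).
have Nn i : (N p.1)%:R / (n p.1 i)%:R @[p --> prob_filter P] --> (kappa i)^-1.
  apply: (@cvg_deterministic _ _ _ P R^o (fun nu => (N nu)%:R / (n nu i)%:R)).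
  under eq_fun do rewrite -invf_div.
  by apply: cvgV => //; have /andP[k0 _] := hkappa i; rewrite gt_eqF.
have UU i : Upsdag p.1 i p.2 @[p --> prob_filter P] --> Upsilon (V i) (Sigma i).
  have /choice[Q QP] := hY.
  (* The fourth moment of a standard normal variable is the constant c with which [sample_cov_cvg]
     is applied. *)
  have N4 : 0 <= fine (\int[normal_prob (0 : R) 1]_z (z ^+ 4)%:E).
    by apply: fine_ge0; apply: integral_ge0 => z _; rewrite lee_fin exprn_even_ge0.
  rewrite (_ : (fun p => _) = fun p => sample_cov (n p.1 i) (fun k => Y p.1 i k p.2)); last first.
    by apply/funext => p; exact: hUpsdag.
  apply: (@sample_cov_cvg _ Omega R P _ C (n ^~ i) (fun nu => Y nu i) (fun nu => Q nu i)
    mC (noo i) _ _ _ (fun nu => T nu i) _ _ N4 (TT i)).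
  - by move=> nu k; exact: hYm.
  - by move=> nu D mD; have [mQ _ _] := QP nu; exact: (measurable_law_data mQ).
  - move=> nu k l D1 D2 B kn ln kl m1 m2 CB; have [mQ _ YQ] := QP nu.
    exact: (pair_law YQ kn ln kl m1 m2 CB).
  - by move=> nu w j; have [_ NQ _] := QP nu; exact: (mvnormal_coord_mean (NQ i w)).
  - by move=> nu w j l; have [_ NQ _] := QP nu; exact: (mvnormal_coord_product (NQ i w)).
  - move=> nu w j; have [_ NQ _] := QP nu; rewrite (mvnormal_coord_fourth (NQ i w)).
    by rewrite lee_fin ler_wpM2l // lerDr.
(* The scaling sqrt N enters the covariance twice and the mean contributes 1 / n_i, which gives the
   factor N / n_i with limit 1 / kappa_i. *)
have cE nu i : (n nu i)%:R^-1 * Num.sqrt (N nu)%:R * Num.sqrt (N nu)%:R = (N nu)%:R / (n nu i)%:R :> R.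
  by rewrite -mulrA -expr2 sqr_sqrtr // mulrC.
split.
- move=> i.
  have /choice[K KP] nu := cond_law_weighted_means (@mC nu) (hYm nu) (hY nu)
    (fun=> (Num.sqrt (N nu)%:R)%:M) (r := [:: i]) isT.
  apply: (@normal_cond_cvg _ _ _ _ P C _ K (fun nu w => ((N nu)%:R / (n nu i)%:R) *: T nu i w)) => //.
  - move=> nu; have [_] := KP nu.
    rewrite (_ : (fun w => _) = fun w => Num.sqrt (N nu)%:R *: Ybar nu i w) //.
    by apply/funext => w; rewrite big_seq1 mul_scalar_mx hYbar.
  - move=> nu w; have [/(_ w) + _] := KP nu.
    rewrite big_seq1 tr_scalar_mx mul_scalar_mx mul_mx_scalar !scalerA.
    by rewrite cE.
  - exact: scalemx_cvg.
- have /choice[K KP] nu := cond_law_weighted_means (@mC nu) (hYm nu) (hY nu)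
    (fun i => Num.sqrt (N nu)%:R *: block_embed R (dimpu d) i) (index_enum_uniq _).
  apply: (@normal_cond_cvg _ _ _ _ P C _ K (fun nu w =>
    \mxdiag_(i < a) (((N nu)%:R / (n nu i)%:R) *: T nu i w))) => //.
  - move=> nu; have [_] := KP nu.
    rewrite (_ : (fun w => _) = fun w => Num.sqrt (N nu)%:R *: \mxcol_(i < a) Ybar nu i w) //.
    apply/funext => w; rewrite mxcol_embed scaler_sumr; apply: eq_bigr => i _.
    by rewrite -scalemxAl hYbar.
  - move=> nu w; have [/(_ w) + _] := KP nu.
    rewrite mxdiag_embed; congr (is_mvnormal _ _ _); apply: eq_bigr => i _.
    rewrite linearZ /= -!scalemxAl -!scalemxAr !scalerA -scalemxAl; congr (_ *: _).
    by rewrite cE.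
  - by apply: mxdiag_cvg => i; exact: scalemx_cvg.
- by move=> i; apply/cvg_in_probE.
- apply/cvg_in_probE; apply: mxdiag_cvg => i; exact: scalemx_cvg.
Qed.
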